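(* Let $n\in\mathbb Z$, $n\neq0$, and suppose $(p,q,c)$ lies on the surface $\Sigma_{N,n}$ defined by $(-p^{1/2})^n=q^{-c-N}$. Then the operators $t(z)=\mathrm{Tr}\big[a^{-n}L^+(q^{c/2}z)L^-(z)^{-1}\big]$ satisfy the following exchange relations with the generators $L(w)$ of ${\cal A}_{q,p}(\widehat{sl}(N)_c)$: $$t(z)\,L(w)=F_N\Big(n,\frac wz\Big)\,L(w)\,t(z),$$ where $$F_N(r,x)=\begin{cases}\displaystyle q^{2r(1-\frac1N)}\prod_{k=0}^{r-1}\frac{\Theta_{q^{2N}}(x^{-2}p^{-k})\,\Theta_{q^{2N}}(x^2p^k)}{\Theta_{q^{2N}}(x^{-2}q^2p^{-k})\,\Theta_{q^{2N}}(x^2q^2p^k)}& r>0,\\[3mm]\displaystyle q^{-2|r|(1-\frac1N)}\prod_{k=1}^{|r|}\frac{\Theta_{q^{2N}}(x^{-2}q^2p^{k})\,\Theta_{q^{2N}}(x^2q^2p^{-k})}{\Theta_{q^{2N}}(x^{-2}p^{k})\,\Theta_{q^{2N}}(x^2p^{-k})}& r<0.\end{cases}$$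
   Context: Parameters. $N\ge 2$ is an integer; $q,p,c$ are generic complex parameters for which the expressions below make sense (for the infinite products: $|q|<1$, $|p|<1$), with fixed logarithms so that fractional powers are defined. Put $p^*=pq^{-2c}$ and $(p^* )^{1/2}=p^{1/2}q^{-c}$. Notation: $(x;a)_\infty=\prod_{m\ge0}(1-xa^m)$, $(x;a,b)_\infty=\prod_{m,l\ge0}(1-xa^mb^l)$, $\Theta_a(x)=(x;a)_\infty(ax^{-1};a)_\infty(a;a)_\infty$. $R$-matrix. Write $z=e^{i\pi\xi}$, $q=e^{i\pi\zeta}$, $p=e^{2i\pi\tau}$, $\omega=e^{2i\pi/N}$, $\vartheta\left[{\gamma_1\atop\gamma_2}\right](\xi,\tau)=\sum_{m\in\mathbb Z}\exp\big(i\pi(m+\gamma_1)^2\tau+2i\pi(m+\gamma_1)(\xi+\gamma_2)\big)$. Let $g,h$ be the $N\times N$ matrices $g_{ij}=\omega^i\delta_{ij}$, $h_{ij}=\delta_{i+1,j}$ (indices mod $N$), $I_{(\alpha_1,\alpha_2)}=g^{\alpha_2}h^{\alpha_1}$, $g^{1/2}$ a fixed diagonal square root of $g$, $a=g^{1/2}hg^{1/2}$, and $$W_{(\alpha_1,\alpha_2)}(\xi,\zeta,\tau)=\frac1N\,\frac{\vartheta\left[{1/2+\alpha_1/N\atop 1/2+\alpha_2/N}\right](\xi+\zeta/N,\tau)}{\vartheta\left[{1/2+\alpha_1/N\atop 1/2+\alpha_2/N}\right](\zeta/N,\tau)},$$ $$\frac1{\kappa(z^2)}=\frac{(q^{2N}z^{-2};p,q^{2N})_\infty(q^2z^2;p,q^{2N})_\infty(pz^{-2};p,q^{2N})_\infty(pq^{2N-2}z^2;p,q^{2N})_\infty}{(q^{2N}z^2;p,q^{2N})_\infty(q^2z^{-2};p,q^{2N})_\infty(pz^2;p,q^{2N})_\infty(pq^{2N-2}z^{-2};p,q^{2N})_\infty},$$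 $$\widetilde R(z,q,p)=z^{2/N-2}\frac1{\kappa(z^2)}\frac{\vartheta\left[{1/2\atop1/2}\right](\zeta,\tau)}{\vartheta\left[{1/2\atop1/2}\right](\xi+\zeta,\tau)}\sum_{\alpha_1,\alpha_2\in\mathbb Z_N}W_{(\alpha_1,\alpha_2)}(\xi,\zeta,\tau)\,I_{(\alpha_1,\alpha_2)}\otimes I_{(\alpha_1,\alpha_2)}^{-1},$$ $R(z)=R(z,q,p)=(g^{1/2}\otimes g^{1/2})\widetilde R(z,q,p)(g^{-1/2}\otimes g^{-1/2})$. Further $\tau_N(z)=z^{2/N-2}\Theta_{q^{2N}}(qz^2)/\Theta_{q^{2N}}(qz^{-2})$ (it satisfies $\tau_N(q^Nz)=\tau_N(z)$, $\tau_N(z^{-1})=\tau_N(z)^{-1}$), $\widehat R_{12}(x)=\tau_N(q^{1/2}x^{-1})R_{12}(x)$, $\widehat R^*_{12}(x)=\widehat R_{12}(x,q,p^* )$. Subscripts denote the tensor factors of copies of $\mathbb C^N$ acted on ($R_{21}$ is $R_{12}$ with the two spaces exchanged) and $t_i$ denotes transposition in space $i$. Known properties: $R_{12}(z)R_{13}(w)R_{23}(w/z)=R_{23}(w/z)R_{13}(w)R_{12}(z)$; $R_{12}(z)R_{21}(z^{-1})=1$; $R_{12}(z)^{t_2}R_{21}(q^{-N}z^{-1})^{t_2}=1$; $R_{12}(-z)=\omega(g^{-1}\otimes 1)R_{12}(z)(g\otimes1)$; $\widehat R_{12}(-p^{1/2}z)=(a\otimes1)^{-1}\widehat R_{21}(z^{-1})^{-1}(a\otimes1)$.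 Algebra. ${\cal A}_{q,p}(\widehat{gl}(N)_c)$ is the algebra generated by the entries (modes) of $L(z)=(L_{ij}(z))_{1\le i,j\le N}$, $L_{ij}(z)=\sum_{n\in\mathbb Z}L_{ij}(n)z^n$, with relations $\widehat R_{12}(z/w)L_1(z)L_2(w)=L_2(w)L_1(z)\widehat R^*_{12}(z/w)$, where $L_1=L\otimes 1$, $L_2=1\otimes L$; ${\cal A}_{q,p}(\widehat{sl}(N)_c)$ is its quotient by $q\text{-}\det L(z)=q^{c/2}$, where $q\text{-}\det L(z)=\sum_{\sigma\in{\mathfrak S}_N}\varepsilon(\sigma)\prod_{i=1}^NL_{i,\sigma(i)}(zq^{i-N-1})$ is central. The relations are understood as analytic (not merely formal series) relations in the spectral parameters. Derived operators. $L^+(z)=L(q^{c/2}z)$, $L^-(z)=a\,L(-p^{1/2}z)\,a^{-1}$ (assumed invertible). $\mathrm{Tr}$ is the trace over the auxiliary space $\mathbb C^N$, so $t(z)$ is a scalar in the auxiliary space and the relation holds for each matrix entry of $L(w)$.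
   Formalization: The surface condition is taken for the fixed logarithms (n times log of -p^{1/2} equals (-c-N) log q exactly, not just modulo 2πi, where the claim fails for N≥3); relations are identities of meromorphic functions, stated for w²/z² not of the form q^{2j}p^k(p* )^l. *)

(* Defs.v *)
From HB Require Import structures.
From mathcomp Require Import all_boot all_order all_algebra all_fingroup.
From mathcomp Require Import complex mxtens.
From mathcomp Require Import boolp classical_sets reals topology normedtype.
From mathcomp Require Import sequences exp trigo.

Set Implicit Arguments.
Unset Strict Implicit.
Unset Printing Implicit Defensive.

Import Order.TTheory GRing.Theory Num.Theory.
Import numFieldNormedType.Exports.

Local Open Scope ring_scope.
Local Open Scope complex_scope.

(* Conventions.  All multiplicative parameters are given by fixed logarithms:
     q = e^{i pi zeta},  p = e^{2 i pi tau},  p^{1/2} = e^{i pi tau},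
     z = e^{i pi xi}
   with zeta, tau, xi complex; a fractional power such as z^{2/N-2} or q^{c/2}
   is e^{i pi (2/N-2) xi}, e^{i pi zeta c/2}.  Since the R-matrix involves
   z^{2/N} and is not a single-valued function of z when N > 2, spectral
   parameters are represented by their logarithm: multiplying z by q^s is
   xi |-> xi + s zeta, multiplying z by -1 is xi |-> xi + 1, and multiplying z
   by -p^{1/2} is xi |-> xi + tau + 1.
   Matrix indices i = 1..N are represented by i - 1 : 'I_N. *)

Definition cexp (R : realType) (z : R[i]) : R[i] :=
  (expR (complex.Re z))%:C * (cos (complex.Im z) +i* sin (complex.Im z)).

Definition epi (R : realType) (x : R[i]) : R[i] := cexp ((0 +i* pi) * x).

Definition limC (R : realType) (u : nat -> R[i]) : R[i] :=
  limn (fun n => complex.Re (u n)) +i* limn (fun n => complex.Im (u n)).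

(* sum over all m in Z; only used for absolutely convergent families *)
Definition zsum (R : realType) (f : int -> R[i]) : R[i] :=
  limC (fun n => \sum_(0 <= k < n) (f (Posz k) + f (Negz k))).

Definition qpoch (R : realType) (x a : R[i]) : R[i] :=
  limC (fun n => \prod_(0 <= m < n) (1 - x * a ^+ m)).

(* (x; a, b)_oo, as the limit of the square partial products; only used for
   |a|, |b| < 1, where the product converges absolutely *)
Definition qpoch2 (R : realType) (x a b : R[i]) : R[i] :=
  limC (fun n =>
    \prod_(0 <= m < n) \prod_(0 <= l < n) (1 - x * a ^+ m * b ^+ l)).

Definition Theta (R : realType) (a x : R[i]) : R[i] :=
  qpoch x a * qpoch (a * x^-1) a * qpoch a a.

Definition vartheta (R : realType) (g1 g2 xi tau : R[i]) : R[i] :=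
  zsum (fun m => cexp ((0 +i* pi) * (m%:~R + g1) ^+ 2 * tau
                       + 2 * (0 +i* pi) * (m%:~R + g1) * (xi + g2))).

Definition omega (R : realType) (N : nat) : R[i] := epi (2 / N%:R).

(* diagonal entries omega^1, ..., omega^N *)
Definition gmx (R : realType) (N : nat) : 'M[R[i]]_N :=
  \matrix_(i, j) (omega R N ^+ i.+1 *+ (i == j)).

Definition hmx (R : realType) (N : nat) : 'M[R[i]]_N :=
  \matrix_(i, j) (i.+1 == j %[mod N])%:R.

Definition Imx (R : realType) (N : nat) (a1 a2 : nat) : 'M[R[i]]_N :=
  gmx R N ^+ a2 *m hmx R N ^+ a1.

Definition is_sqrt_g (R : realType) (N : nat) (g12 : 'M[R[i]]_N) : Prop :=
  is_diag_mx g12 /\ g12 *m g12 = gmx R N.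

Definition amx (R : realType) (N : nat) (g12 : 'M[R[i]]_N) : 'M[R[i]]_N :=
  g12 *m hmx R N *m g12.

Definition mxexpz (R : realType) (N : nat) (M : 'M[R[i]]_N) (n : int) :
    'M[R[i]]_N :=
  match n with
  | Posz k => M ^+ k
  | Negz k => invmx M ^+ k.+1
  end.

Definition Wcoef (R : realType) (N a1 a2 : nat) (xi zeta tau : R[i]) : R[i] :=
  let g1 := 1 / 2 + a1%:R / N%:R in
  let g2 := 1 / 2 + a2%:R / N%:R in
  N%:R^-1 * (vartheta g1 g2 (xi + zeta / N%:R) tau
             / vartheta g1 g2 (zeta / N%:R) tau).

(* 1 / kappa(y), for y = z^2 *)
Definition kappa_inv (R : realType) (N : nat) (q p y : R[i]) : R[i] :=
  let b := q ^+ N.*2 in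
  (qpoch2 (b / y) p b * qpoch2 (q ^+ 2 * y) p b
   * qpoch2 (p / y) p b * qpoch2 (p * q ^+ (N.*2 - 2) * y) p b)
  / (qpoch2 (b * y) p b * qpoch2 (q ^+ 2 / y) p b
     * qpoch2 (p * y) p b * qpoch2 (p * q ^+ (N.*2 - 2) / y) p b).

Definition Rtilde (R : realType) (N : nat) (zeta tau xi : R[i]) :
    'M[R[i]]_(N * N) :=
  (epi ((2 / N%:R - 2) * xi)
   * kappa_inv N (epi zeta) (epi (2 * tau)) (epi xi ^+ 2)
   * (vartheta (1 / 2) (1 / 2) zeta tau
      / vartheta (1 / 2) (1 / 2) (xi + zeta) tau))
  *: \sum_(a1 < N) \sum_(a2 < N)
       Wcoef N a1 a2 xi zeta tau
       *: (Imx R N a1 a2 *t invmx (Imx R N a1 a2)).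

Definition Rmx (R : realType) (N : nat) (g12 : 'M[R[i]]_N)
    (zeta tau xi : R[i]) : 'M[R[i]]_(N * N) :=
  (g12 *t g12) *m Rtilde N zeta tau xi *m (invmx g12 *t invmx g12).

Definition tauN (R : realType) (N : nat) (zeta xi : R[i]) : R[i] :=
  let q := epi zeta in
  let z := epi xi in
  epi ((2 / N%:R - 2) * xi)
  * (Theta (q ^+ N.*2) (q * z ^+ 2) / Theta (q ^+ N.*2) (q * z ^- 2)).

Definition Rhat (R : realType) (N : nat) (g12 : 'M[R[i]]_N)
    (zeta tau xi : R[i]) : 'M[R[i]]_(N * N) :=
  tauN N zeta (zeta / 2 - xi) *: Rmx g12 zeta tau xi.

(* logarithm of p^*, that is p^* = p q^{-2c}, (p^* )^{1/2} = p^{1/2} q^{-c} *)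
Definition taustar (R : realType) (zeta tau c : R[i]) : R[i] := tau - c * zeta.

(* The infinite products converge for q, p and p^*, and the denominators
   vartheta[...](zeta/N, .) of W do not vanish: they do exactly when q^2 is an
   integral power of p (resp. p^* ). *)
Definition admissible (R : realType) (zeta tau c : R[i]) : Prop :=
  let q := epi zeta in
  let p := epi (2 * tau) in
  let ps := epi (2 * taustar zeta tau c) in
  [/\ `|q| < 1, `|p| < 1, `|ps| < 1
    & forall k : int, q ^+ 2 <> p ^ k /\ q ^+ 2 <> ps ^ k].

(* x = e^{i pi xi} is off the countable set of possible zeros and poles
   (x^2 in q^{2Z} p^Z p^*^Z) of the coefficients of the exchange relations.
   Relations that are analytic in the spectral parameters are identities of
   meromorphic functions; they are imposed, and asserted, at such x. *)
Definition generic_ratio (R : realType) (zeta tau c xi : R[i]) : Prop :=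
  forall j k l : int,
    epi xi ^+ 2 <> epi zeta ^ (2 * j) * epi (2 * tau) ^ k
                   * epi (2 * taustar zeta tau c) ^ l.

Definition scal_mx (R : realType) (m : nat) (A : algType R[i])
    (M : 'M[R[i]]_m) : 'M[A]_m :=
  map_mx (in_alg A) M.

(* L u stands for L(z) with z = e^{i pi u} *)
Definition RLL (R : realType) (N : nat) (g12 : 'M[R[i]]_N)
    (zeta tau c : R[i]) (A : algType R[i]) (L : R[i] -> 'M[A]_N) : Prop :=
  forall u v : R[i], generic_ratio zeta tau c (u - v) ->
    scal_mx A (Rhat g12 zeta tau (u - v)) *m (L u *t 1%:M) *m (1%:M *t L v)
    = (1%:M *t L v) *m (L u *t 1%:M)
      *m scal_mx A (Rhat g12 zeta (taustar zeta tau c) (u - v)).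

(* The factors are multiplied in the order i = 1, ..., N.  With i shifted by
   one, z q^{i-N-1} becomes z q^{i-N}. *)
Definition qdet (R : realType) (N : nat) (zeta : R[i]) (A : algType R[i])
    (L : R[i] -> 'M[A]_N) (u : R[i]) : A :=
  \sum_(s : 'S_N) (-1) ^+ s
    * \prod_(i < N) L (u + (i%:R - N%:R) * zeta) i (s i).

(* L is a family of generators, in the algebra A, satisfying the defining
   relations of A_{q,p}(\hat{sl}(N)_c). *)
Definition Aqp_sl (R : realType) (N : nat) (g12 : 'M[R[i]]_N)
    (zeta tau c : R[i]) (A : algType R[i]) (L : R[i] -> 'M[A]_N) : Prop :=
  RLL g12 zeta tau c L
  /\ forall u : R[i], qdet zeta L u = (epi (zeta * c / 2))%:A.

Definition Lplus (R : realType) (N : nat) (zeta c : R[i]) (A : algType R[i])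
    (L : R[i] -> 'M[A]_N) (u : R[i]) : 'M[A]_N :=
  L (u + c / 2 * zeta).

Definition Lminus (R : realType) (N : nat) (g12 : 'M[R[i]]_N) (tau : R[i])
    (A : algType R[i]) (L : R[i] -> 'M[A]_N) (u : R[i]) : 'M[A]_N :=
  scal_mx A (amx g12) *m L (u + tau + 1) *m scal_mx A (invmx (amx g12)).

Definition is_mxinv (A : nzRingType) (N : nat) (M M' : 'M[A]_N) : Prop :=
  M *m M' = 1%:M /\ M' *m M = 1%:M.

(* t(z); Lminv u is the inverse of L^-(z) *)
Definition tgen (R : realType) (N : nat) (g12 : 'M[R[i]]_N) (zeta c : R[i])
    (n : int) (A : algType R[i]) (L Lminv : R[i] -> 'M[A]_N) (u : R[i]) : A :=
  \tr (scal_mx A (mxexpz (amx g12) (- n))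
       *m Lplus zeta c L (u + c / 2 * zeta) *m Lminv u).

(* (-p^{1/2})^n = q^{-c-N}, with the logarithm tau + 1 of -p^{1/2}; the
   equation is between logarithms because shifts of the spectral parameter by
   the two sides must have the same effect on the multivalued R-matrix. *)
Definition on_surface (R : realType) (N : nat) (zeta tau c : R[i]) (n : int) :
    Prop :=
  n%:~R * (tau + 1) = (- c - N%:R) * zeta.

Definition F_N (R : realType) (N : nat) (zeta tau : R[i]) (r : int) (x : R[i]) :
    R[i] :=
  let q := epi zeta in
  let p := epi (2 * tau) in
  let Th := Theta (q ^+ N.*2) in
  if 0 < r then
    epi (2 * r%:~R * (1 - 1 / N%:R) * zeta)
    * \prod_(0 <= k < `|r|%N)
        ((Th (x ^- 2 * p ^- k) * Th (x ^+ 2 * p ^+ k))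
         / (Th (x ^- 2 * q ^+ 2 * p ^- k) * Th (x ^+ 2 * q ^+ 2 * p ^+ k)))
  else
    epi (- 2 * (`|r|%N)%:R * (1 - 1 / N%:R) * zeta)
    * \prod_(1 <= k < `|r|%N.+1)
        ((Th (x ^- 2 * q ^+ 2 * p ^+ k) * Th (x ^+ 2 * q ^+ 2 * p ^- k))
         / (Th (x ^- 2 * p ^+ k) * Th (x ^+ 2 * p ^- k))).

(* Main.v *)
Require Import Defs.
From HB Require Import structures.
From mathcomp Require Import all_boot all_order all_algebra all_fingroup.
From mathcomp Require Import complex mxtens.
From mathcomp Require Import boolp classical_sets functions reals topology normedtype.
From mathcomp Require Import sequences exp trigo.
From mathcomp Require Import ring lra zify.

Set Implicit Arguments.
Unset Strict Implicit.
Unset Printing Implicit Defensive.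

Import Order.TTheory GRing.Theory Num.Theory.
Import numFieldNormedType.Exports.
Local Open Scope ring_scope.
Local Open Scope complex_scope.

(* By the Jacobi triple product the coefficients of the R-matrix are the theta
   quotients [Wt].  Theta functions of a given quasi-periodicity form a space
   whose dimension is their order; comparing values at lattice points in such
   spaces shows that [Wt], as a function on (Z/N)^2, is up to a factor its own
   symplectic Fourier transform with xi and zeta exchanged.  With Parseval this
   gives the unitarity and crossing sums of [Wt], hence those of the R-matrix.

   Put y = u - v, P = L^+(q^{c/2} z), M = L^-(z).  Quasi-periodicity of the
   R-matrix under xi |-> xi + tau + 1 lets one eliminate R^* between the RLL
   relations of P and M:
     L_2 P_1 M_1^-1
       = (Lam(y+c zeta)/Lam(y)) Rhat(y+c zeta) P_1 M_1^-1 Rhat(y)^-1 L_2.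
   On the surface y + c zeta = y - N zeta - n (tau + 1), so that a^-n turns
   Rhat(y+c zeta) into a multiple of Rhat(y - N zeta), and the crossing relation
   makes the R-matrices disappear from the partial trace.  The scalars collected
   on the way multiply up to F_N; each of its factors is a value of [Lam]. *)

(** * Limits and absolutely summable families in [R[i]] *)

Local Open Scope classical_set_scope.

(** Since p^* = p q^{-2c}, the argument y + tau + 1 is both y moved by the quasi-period for p and y
    + c zeta moved by the quasi-period for p^*. Undoing these shifts, the relation for M carries the
    same R^* at y + c zeta as the relation for P, and R^* can be eliminated. One function [Lam]
    serves both nomes, because it only involves theta functions of nome q^{2N}.

    The entries of P, M and L do not commute, so the trace is not cyclic; only scalar entries can be
    contracted across P M^-1, and crossing is exactly such a contraction.

    Crossing holds because N zeta divided by N is zeta: after Fourier duality the two theta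
    quotients in the crossing sum are reciprocal, and a bare character sum remains. Unitarity holds
    because duality makes its coefficients antisymmetric in xi and zeta up to theta squares; they
    vanish at xi = zeta, and this second zero removes the line left over in a space of order two.

    Dimension bounds come from Laurent coefficients, where quasi-periodicity is a linear recursion,
    so counting zeros is replaced by linear algebra. *)

Notation normc := Normc.normc.

Section ComplexLimits.
Variable R : realType.
Implicit Types (u v : nat -> R[i]) (l m : R[i]).

Lemma normc_ge0 (x : R[i]) : 0 <= normc x.
Proof. by case: x => a b; apply: sqrtr_ge0. Qed.

Lemma normcD (x y : R[i]) : normc (x + y) <= normc x + normc y.
Proof. exact: le_normcD. Qed.

Lemma normcNE (x : R[i]) : normc (- x) = normc x.
Proof. exact: normcN. Qed.

Lemma normcB (x y : R[i]) : normc (x - y) = normc (y - x).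
Proof. by rewrite -normcNE opprB. Qed.

Lemma normcX (x : R[i]) n : normc (x ^+ n) = normc x ^+ n.
Proof. by elim: n => [|n IH]; rewrite ?expr0 ?Normc.normc1 // !exprS Normc.normcM IH. Qed.

Lemma normc_eq0 (x : R[i]) : (normc x == 0) = (x == 0).
Proof. by apply/eqP/eqP => [/Normc.eq0_normc|->] //; rewrite Normc.normc0. Qed.

Lemma normc_real (a : R) : 0 <= a -> normc a%:C = a.
Proof. by move=> a0; rewrite /= expr0n addr0 sqrtr_sqr ger0_norm. Qed.

Lemma normc_sum (I : Type) (s : seq I) (P : pred I) (F : I -> R[i]) :
  normc (\sum_(i <- s | P i) F i) <= \sum_(i <- s | P i) normc (F i).
Proof.
apply: (big_ind2 (fun x y => normc x <= y)) => [|x1 x2 y1 y2 h1 h2|//].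
  by rewrite Normc.normc0.
by apply: le_trans (normcD _ _) _; apply: lerD.
Qed.

Lemma Re_le_normc (x : R[i]) : `|complex.Re x| <= normc x.
Proof. by have := normc_ge_Re x; rewrite lecR. Qed.

Lemma Im_le_normc (x : R[i]) : `|complex.Im x| <= normc x.
Proof.
case: x => a b /=; rewrite -[`|b|]ger0_norm ?normr_ge0 // -sqrtr_sqr.
by rewrite ler_sqrt ?addr_ge0 ?sqr_ge0 // real_normK ?num_real // lerDr sqr_ge0.
Qed.

Lemma normc_le_ReIm (x : R[i]) : normc x <= `|complex.Re x| + `|complex.Im x|.
Proof.
case: x => a b /=; rewrite -[X in _ <= X]ger0_norm ?addr_ge0 //.
rewrite -sqrtr_sqr ler_sqrt ?sqr_ge0 // sqrrD !real_normK ?num_real //.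
have := mulrn_wge0 2 (mulr_ge0 (normr_ge0 a) (normr_ge0 b)); lra.
Qed.

(** Componentwise, to agree with [limC], whose value is a pair of real limits. *)
Definition cvgc u l : Prop :=
  (@complex.Re R \o u) @ \oo --> complex.Re l /\
  (@complex.Im R \o u) @ \oo --> complex.Im l.

Lemma limCE u l : cvgc u l -> limC u = l.
Proof.
by case: l => a b [/= ha hb]; congr (_ +i* _); apply: cvg_lim.
Qed.

Lemma cvgc_uniq u l m : cvgc u l -> cvgc u m -> l = m.
Proof. by move=> /limCE <- /limCE <-. Qed.

Lemma eq_cvgc u v l : u =1 v -> cvgc u l -> cvgc v l.
Proof. by move=> /funext ->. Qed.

Lemma cvgc_cst l : cvgc (fun=> l) l.
Proof. by split; apply: cvg_cst. Qed.

Lemma cvgcD u v l m : cvgc u l -> cvgc v m -> cvgc (fun n => u n + v n) (l + m).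
Proof.
case: l m => [a b] [c d] [/= h1 h2] [/= h3 h4]; split => /=.
  have -> : (@complex.Re R \o (fun n => u n + v n)) =
            (@complex.Re R \o u) + (@complex.Re R \o v).
    by apply/funext => n /=; rewrite fctE /=; case: (u n) (v n) => ? ? [].
  exact: cvgD.
have -> : (@complex.Im R \o (fun n => u n + v n)) =
          (@complex.Im R \o u) + (@complex.Im R \o v).
  by apply/funext => n /=; rewrite fctE /=; case: (u n) (v n) => ? ? [].
exact: cvgD.
Qed.

Lemma cvgcM u v l m : cvgc u l -> cvgc v m -> cvgc (fun n => u n * v n) (l * m).
Proof.
case: l m => [a b] [c d] [/= h1 h2] [/= h3 h4]; split => /=.
  have -> : (@complex.Re R \o (fun n => u n * v n)) =
     (@complex.Re R \o u) * (@complex.Re R \o v) - (@complex.Im R \o u) * (@complex.Im R \o v).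
    by apply/funext => n; rewrite !fctE /=; case: (u n) (v n) => ? ? [].
  by apply: cvgB; apply: cvgM.
have -> : (@complex.Im R \o (fun n => u n * v n)) =
   (@complex.Re R \o u) * (@complex.Im R \o v) + (@complex.Im R \o u) * (@complex.Re R \o v).
  by apply/funext => n; rewrite !fctE /=; case: (u n) (v n) => ? ? [].
by apply: cvgD; apply: cvgM.
Qed.

Lemma cvgcZ a u l : cvgc u l -> cvgc (fun n => a * u n) (a * l).
Proof. by apply: cvgcM; apply: cvgc_cst. Qed.

Lemma cvgcB u v l m : cvgc u l -> cvgc v m -> cvgc (fun n => u n - v n) (l - m).
Proof.
move=> hu /(cvgcZ (-1)) hv; rewrite -mulN1r.
by apply: eq_cvgc (cvgcD hu hv) => n; rewrite mulN1r.
Qed.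

Lemma cvgc_sum (I : Type) (s : seq I) (F : I -> nat -> R[i]) (G : I -> R[i]) :
  (forall i, cvgc (F i) (G i)) ->
  cvgc (fun n => \sum_(i <- s) F i n) (\sum_(i <- s) G i).
Proof.
move=> h; elim: s => [|i s IH].
  by rewrite big_nil; apply: eq_cvgc (cvgc_cst _) => n; rewrite big_nil.
by rewrite big_cons; apply: eq_cvgc (cvgcD (h i) IH) => n; rewrite big_cons.
Qed.

Lemma cvgc_shift k u l : cvgc (fun n => u (n + k)%N) l <-> cvgc u l.
Proof.
split=> -[h1 h2]; split.
- by rewrite -(cvg_shiftn k).
- by rewrite -(cvg_shiftn k).
- by move: h1; rewrite -(cvg_shiftn k).
- by move: h2; rewrite -(cvg_shiftn k).
Qed.

Lemma cvgc_le u l (d : nat -> R) :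
  (forall n, normc (u n - l) <= d n) -> d @ \oo --> 0 -> cvgc u l.
Proof.
move=> h hd; split.
  apply/cvgrPdist_lt => e e0; 
  apply: filterS (cvgr_lt _ hd _ e0) => n; apply: le_lt_trans; apply: le_trans (h n).
  have := Re_le_normc (u n - l); rewrite distrC.
  by rewrite [complex.Re (_ - _)](_ : _ = complex.Re (u n) - complex.Re l) //; case: (u n) {h} l => ? ? [].
apply/cvgrPdist_lt => e e0; 
apply: filterS (cvgr_lt _ hd _ e0) => n; apply: le_lt_trans; apply: le_trans (h n).
have := Im_le_normc (u n - l); rewrite distrC.
by rewrite [complex.Im (_ - _)](_ : _ = complex.Im (u n) - complex.Im l) //; case: (u n) {h} l => ? ? [].
Qed.

Lemma cvgc_dist u l : cvgc u l -> (fun n => normc (u n - l)) @ \oo --> 0.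
Proof.
move=> h; have := cvgcB h (cvgc_cst l); rewrite subrr => -[h1 h2].
apply: (@squeeze_cvgr _ _ _ _ (cst 0)
  (fun n => `|complex.Re (u n - l)| + `|complex.Im (u n - l)|)).
- by apply: nearW => n; rewrite normc_ge0 normc_le_ReIm.
- exact: cvg_cst.
- by have := cvgD (cvg_norm h1) (cvg_norm h2); rewrite !normr0 addr0; apply.
Qed.

Lemma cvgc_norm u l : cvgc u l -> (fun n => normc (u n)) @ \oo --> normc l.
Proof.
move=> /cvgc_dist h; apply/cvgrPdist_lt => e e0.
apply: filterS (cvgr_lt _ h _ e0) => n; apply: le_lt_trans.
have h1 := normcD (u n - l) l; have h2 := normcD (l - u n) (u n).
rewrite !subrK in h1 h2; rewrite ler_norml; move: h1 h2; rewrite (normcB l).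
lra.
Qed.

Lemma cvgc_norm_le u l k b :
  (forall n, (k <= n)%N -> normc (u n) <= b) -> cvgc u l -> normc l <= b.
Proof.
move=> h /cvgc_norm hu; apply: (cvgr_to_le hu).
by exists k.
Qed.

(* [Re u + Q] and [Im u + Q] are nondecreasing and bounded. *)
Lemma cvgc_dominated u (Q : nat -> R) B :
  (forall n, normc (u n.+1 - u n) <= Q n.+1 - Q n) -> (forall n, Q n <= B) ->
  exists2 l, cvgc u l & forall n, normc (l - u n) <= B - Q n.
Proof.
move=> h hB.
have hmn n k : normc (u (n + k)%N - u n) <= Q (n + k)%N - Q n.
  elim: k => [|k IH]; first by rewrite addn0 !subrr Normc.normc0.
  rewrite addnS -(subrKA (u (n + k)%N)).
  by apply: le_trans (normcD _ _) _; have := h (n + k)%N; lra.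
have hQ n k : Q n <= Q (n + k)%N.
  by rewrite -subr_ge0; apply: le_trans (hmn n k); apply: normc_ge0.
have cQ : cvgn Q.
  apply: nondecreasing_is_cvgn; first by move=> n m /subnKC <-.
  by exists B => _ [n _ <-].
have cv (f : R[i] -> R) : (forall x y, f (x - y) = f x - f y) ->
    (forall x, `|f x| <= normc x) -> cvgn (f \o u).
  move=> fB fle.
  have hf n k : `|f (u (n + k)%N) - f (u n)| <= Q (n + k)%N - Q n.
    by rewrite -fB; apply: le_trans (fle _) (hmn n k).
  have -> : f \o u = ((f \o u) + Q) - Q by rewrite addrK.
  apply: is_cvgB cQ; apply: nondecreasing_is_cvgn.
    move=> n m /subnKC <-; rewrite !fctE /=; have := hf n (m - n)%N.
    by rewrite ler_norml; lra.
  exists (f (u 0%N) + B - Q 0%N + B) => _ [n _ <-]; rewrite !fctE /=.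
  have := hf 0%N n; rewrite add0n ler_norml; have := hB n; lra.
have c1 : cvgn (@complex.Re R \o u).
  by apply: cv Re_le_normc => -[? ?] [].
have c2 : cvgn (@complex.Im R \o u).
  by apply: cv Im_le_normc => -[? ?] [].
exists (limn (@complex.Re R \o u) +i* limn (@complex.Im R \o u)); first by split.
move=> n.
have hc : cvgc (fun j => u j - u n)
    (limn (@complex.Re R \o u) +i* limn (@complex.Im R \o u) - u n).
  by apply: cvgcB (cvgc_cst _); split.
apply: (cvgc_norm_le (k := n) _ hc) => m /subnKC <-.
by apply: le_trans (hmn _ _) _; have := hB (n + (m - n))%N; lra.
Qed.

Lemma series_cvgc (F : nat -> R[i]) (D : nat -> R) B :
  (forall k, normc (F k) <= D k) -> (forall n, \sum_(0 <= k < n) D k <= B) ->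
  exists2 l, cvgc (fun n => \sum_(0 <= k < n) F k) l &
    forall n, normc (l - \sum_(0 <= k < n) F k) <= B - \sum_(0 <= k < n) D k.
Proof.
move=> h hB; apply: cvgc_dominated hB => n.
by rewrite !big_nat_recr //= [X in normc X]addrC addKr [X in _ <= X]addrC addKr.
Qed.

(** Dominated convergence for series: the tails beyond K are bounded uniformly in M by the tail of
    [D], and the finite heads converge term by term. *)
Lemma tannery (F : nat -> nat -> R[i]) (G : nat -> R[i]) (D : nat -> R) B
    (S : nat -> R[i]) T :
  (forall M k, normc (F M k) <= D k) ->
  (forall n, \sum_(0 <= k < n) D k <= B) ->
  (forall k, cvgc (F^~ k) (G k)) ->
  (forall M, cvgc (fun n => \sum_(0 <= k < n) F M k) (S M)) ->
  cvgc (fun n => \sum_(0 <= k < n) G k) T ->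
  cvgc S T.
Proof.
move=> hD hB hG hS hT.
have D0 k : 0 <= D k by apply: le_trans (hD 0%N k); apply: normc_ge0.
have hDG k : normc (G k) <= D k.
  by apply: (@cvgc_norm_le (F^~ k) _ 0) => [n _|] //.
have cD : cvgn (fun n => \sum_(0 <= k < n) D k).
  apply: nondecreasing_is_cvgn; last by exists B => _ [n _ <-].
  move=> n m /subnKC <-; elim: (m - n)%N => [|j IH]; first by rewrite addn0.
  by apply: le_trans IH _; rewrite addnS big_nat_recr //= lerDl.
(* The given [B] may exceed the sum of [D]; only with the exact sum does the tail estimate tend to
   zero. *)
set Binf := limn (fun n => \sum_(0 <= k < n) D k) in cD.
have hBinf n : \sum_(0 <= k < n) D k <= Binf.
  apply: nondecreasing_cvgn_le cD _ => i m /subnKC <-.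
  elim: (m - i)%N => [|j IH]; first by rewrite addn0.
  by apply: le_trans IH _; rewrite addnS big_nat_recr //= lerDl.
have tail (f : nat -> R[i]) s : (forall k, normc (f k) <= D k) ->
    cvgc (fun n => \sum_(0 <= k < n) f k) s ->
    forall n, normc (s - \sum_(0 <= k < n) f k) <= Binf - \sum_(0 <= k < n) D k.
  move=> hf hs; have [l hl hn] := series_cvgc hf hBinf.
  by rewrite (cvgc_uniq hs hl).
suff hST : (fun M => normc (S M - T)) @ \oo --> 0.
  exact: cvgc_le (fun n => lexx _) hST.
apply/cvgrPdist_lt => e e0.
have e3 : 0 < e / 3 by rewrite divr_gt0.
have [K _ /(_ K (leqnn K)) hK] :
    \forall n \near \oo, Binf - \sum_(0 <= k < n) D k < e / 3.
  move/cvgrPdist_lt: cD => /(_ _ e3); apply: filterS => n.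
  exact: le_lt_trans (ler_norm _).
have hFK : cvgc (fun M => \sum_(0 <= k < K) F M k) (\sum_(0 <= k < K) G k).
  exact: cvgc_sum.
apply: filterS (cvgr_lt _ (cvgc_dist hFK) _ e3) => M hM.
rewrite sub0r normrN ger0_norm ?normc_ge0 //.
have h1 := tail _ _ (hD M) (hS M) K; have := tail _ _ hDG hT K.
rewrite normcB => h2.
have h3 := normcD (S M - \sum_(0 <= k < K) F M k) (\sum_(0 <= k < K) F M k - T).
have h4 := normcD (\sum_(0 <= k < K) F M k - \sum_(0 <= k < K) G k)
  (\sum_(0 <= k < K) G k - T).
rewrite !subrKA in h3 h4; lra.
Qed.

End ComplexLimits.

(** * Absolutely convergent sums over the integers *)

Section IntSums.
Variable R : realType.
Implicit Types (f g : int -> R[i]) (s : seq int).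

(** Bounding all finite subfamilies, rather than the partial sums of [zsum], makes summability
    invariant under translation of the index. *)
Definition zbnd f (B : R) : Prop :=
  forall s, uniq s -> \sum_(k <- s) normc (f k) <= B.

Definition zsummable f : Prop := exists B, zbnd f B.

(** The integers from -n to n - 1, which index the n-th partial sum of [zsum]. *)
Definition zbox n : seq int :=
  [seq Posz k | k <- iota 0 n] ++ [seq Negz k | k <- iota 0 n].

Lemma zbox_uniq n : uniq (zbox n).
Proof.
rewrite cat_uniq !map_inj_uniq ?iota_uniq //=; last 2 first.
- by move=> i j [].
- by move=> i j [].
by rewrite andbT; apply/hasPn => _ /mapP[k _ ->]; apply/mapP => -[].
Qed.

Lemma mem_zbox n k : (k \in zbox n) = (match k with Posz j => j | Negz j => j end < n)%N.
Proof.
rewrite mem_cat; case: k => j.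
  rewrite (mem_map (f := Posz)) ?mem_iota ?add0n => [|? ? []] //.
  by case: (j < n)%N => //=; apply/mapP => -[].
rewrite (mem_map (f := Negz)) ?mem_iota ?add0n => [|? ? []] //.
by case: (j < n)%N; rewrite ?orbT ?orbF //=; apply/mapP => -[].
Qed.

Lemma big_zbox (V : nmodType) n (F : int -> V) :
  \sum_(0 <= k < n) (F (Posz k) + F (Negz k)) = \sum_(k <- zbox n) F k.
Proof.
by rewrite big_cat /= !big_map big_split /= /index_iota subn0.
Qed.

Lemma zbox_sub s : exists n, {subset s <= zbox n}.
Proof.
elim: s => [|k s [n IH]]; first by exists 0%N.
exists (maxn n (match k with Posz j => j | Negz j => j end).+1) => i.
rewrite inE => /orP[/eqP->|/IH]; rewrite !mem_zbox.
  by rewrite leq_max ltnSn orbT.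
by move=> h; rewrite leq_max h.
Qed.

Lemma sum_subset s t (F : int -> R) : (forall k, 0 <= F k) -> uniq s ->
  {subset s <= t} -> \sum_(k <- s) F k <= \sum_(k <- t) F k.
Proof.
move=> F0; elim: s t => [|k s IH] t; first by rewrite big_nil sumr_ge0.
rewrite cons_uniq => /andP[ks us] st.
have kt : k \in t by apply: st; rewrite mem_head.
rewrite big_cons (perm_big _ (perm_to_rem kt)) big_cons lerD2l; apply: IH => // i si.
have /= := st i; rewrite inE si orbT => /(_ isT); rewrite (perm_mem (perm_to_rem kt)) inE.
by case/orP => // /eqP ik; rewrite ik (negPf ks) in si.
Qed.

Lemma zbnd_box f B :
  (forall n, \sum_(0 <= k < n) (normc (f (Posz k)) + normc (f (Negz k))) <= B) ->
  zbnd f B.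
Proof.
move=> h s us; have [n sn] := zbox_sub s.
apply: le_trans (sum_subset _ us sn) _; first by move=> k; exact: normc_ge0.
by rewrite -big_zbox.
Qed.

Lemma zsum_bnd_cvg f B : zbnd f B ->
  cvgc (fun n => \sum_(k <- zbox n) f k) (zsum f) /\ normc (zsum f) <= B.
Proof.
move=> h.
have hB n : \sum_(0 <= k < n) (normc (f (Posz k)) + normc (f (Negz k))) <= B.
  by rewrite (big_zbox n (fun k => normc (f k))); apply: h; exact: zbox_uniq.
have [l hl hn] := series_cvgc (fun k => normcD (f (Posz k)) (f (Negz k))) hB.
have <- : l = zsum f by rewrite /zsum (limCE hl).
split; first by apply: eq_cvgc hl => n; rewrite big_zbox.
by have := hn 0%N; rewrite !big_geq // !subr0.
Qed.

Lemma zsum_cvg f : zsummable f -> cvgc (fun n => \sum_(k <- zbox n) f k) (zsum f).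
Proof. by case=> B /zsum_bnd_cvg[]. Qed.

Lemma zsum_le f B : zbnd f B -> normc (zsum f) <= B.
Proof. by case/zsum_bnd_cvg. Qed.

Lemma zsummable_le f g (K : R) : (forall k, normc (f k) <= K * normc (g k)) ->
  0 <= K -> zsummable g -> zsummable f.
Proof.
move=> h K0 [B hB]; exists (K * B) => s us.
apply: le_trans (ler_sum _ (fun k _ => h k)) _.
by rewrite -mulr_sumr ler_wpM2l // hB.
Qed.

Lemma zsummableZ a f : zsummable f -> zsummable (fun k => a * f k).
Proof.
apply: (@zsummable_le _ _ (normc a)); last exact: normc_ge0.
by move=> k; rewrite Normc.normcM.
Qed.

Lemma zsummableD f g : zsummable f -> zsummable g -> zsummable (fun k => f k + g k).
Proof.
move=> [B hB] [D hD]; exists (B + D) => s us.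
apply: le_trans (ler_sum _ (fun k _ => normcD _ _)) _.
by rewrite big_split lerD ?hB ?hD.
Qed.

Lemma zsumZ a f : zsummable f -> zsum (fun k => a * f k) = a * zsum f.
Proof.
move=> hf; apply: cvgc_uniq (zsum_cvg (zsummableZ a hf)) _.
by apply: eq_cvgc (cvgcZ a (zsum_cvg hf)) => n; rewrite mulr_sumr.
Qed.

Lemma zsumD f g : zsummable f -> zsummable g ->
  zsum (fun k => f k + g k) = zsum f + zsum g.
Proof.
move=> hf hg; apply: cvgc_uniq (zsum_cvg (zsummableD hf hg)) _.
by apply: eq_cvgc (cvgcD (zsum_cvg hf) (zsum_cvg hg)) => n; rewrite big_split.
Qed.

Lemma eq_zsum f g : f =1 g -> zsum f = zsum g.
Proof. by move=> /funext ->. Qed.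

Lemma zsum0 f : (forall k, f k = 0) -> zsum f = 0.
Proof.
move=> f0; have h : zbnd f 0.
  by move=> s _; rewrite big1 // => k _; rewrite f0 Normc.normc0.
by apply/eqP; rewrite -normc_eq0 eq_le normc_ge0 (zsum_le h).
Qed.

Lemma zsum_sum (I : Type) (r : seq I) (F : I -> int -> R[i]) :
  (forall i, zsummable (F i)) ->
  zsummable (fun k => \sum_(i <- r) F i k) /\
  zsum (fun k => \sum_(i <- r) F i k) = \sum_(i <- r) zsum (F i).
Proof.
move=> h; elim: r => [|i r [IH1 IH2]].
  have -> : (fun k => \sum_(i <- [::]) F i k) = (fun=> 0 : R[i]).
    by apply/funext => k; rewrite big_nil.
  rewrite big_nil; split; last exact: zsum0.
  by exists 0 => s _; rewrite big1 // => k _; rewrite Normc.normc0.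
have -> : (fun k => \sum_(i <- i :: r) F i k) = (fun k => F i k + \sum_(i <- r) F i k).
  by apply/funext => k; rewrite big_cons.
by rewrite big_cons zsumD // IH2; split => //; apply: zsummableD.
Qed.

Lemma zbnd_shift j f B : zbnd f B -> zbnd (fun k => f (k + j)) B.
Proof.
move=> h s us; rewrite -(big_map (fun k => k + j) xpredT (fun k => normc (f k))).
by apply: h; rewrite map_inj_uniq // => x y /addIr.
Qed.

Lemma zsummable_shift j f : zsummable f -> zsummable (fun k => f (k + j)).
Proof. by case=> B /zbnd_shift h; exists B. Qed.

Lemma zsum_supp n f : (forall k, k \notin zbox n -> f k = 0) ->
  zsum f = \sum_(k <- zbox n) f k.
Proof.
move=> h; rewrite /zsum; apply: limCE.
apply/(cvgc_shift n); apply: eq_cvgc (cvgc_cst _) => m.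
rewrite -!big_zbox addnC [RHS](@big_cat_nat _ _ _ n) ?leq_addr //=.
rewrite [X in _ + X]big_nat [X in _ + X]big1 ?addr0 // => k /andP[nk _].
by rewrite !h ?addr0 // mem_zbox -leqNgt.
Qed.

Lemma tannery_zsum (F : nat -> int -> R[i]) (G : int -> R[i]) D :
  (forall M k, normc (F M k) <= normc (D k)) -> zsummable D ->
  (forall k, cvgc (F^~ k) (G k)) ->
  cvgc (fun M => zsum (F M)) (zsum G).
Proof.
move=> hF [B hB] hG.
have bF M : zbnd (F M) B.
  by move=> s us; apply: le_trans (ler_sum _ (fun k _ => hF M k)) (hB _ us).
have bG : zbnd G B.
  move=> s us; apply: le_trans (hB _ us); apply: ler_sum => k _.
  by apply: (cvgc_norm_le (k := 0%N) _ (hG k)) => M _; exact: hF.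
apply: (@tannery _ (fun M k => F M (Posz k) + F M (Negz k))
  (fun k => G (Posz k) + G (Negz k))
  (fun k => normc (D (Posz k)) + normc (D (Negz k))) B).
- by move=> M k; apply: le_trans (normcD _ _) _; apply: lerD.
- by move=> n; rewrite (big_zbox n (fun k => normc (D k))); apply/hB/zbox_uniq.
- by move=> k; apply: cvgcD.
- move=> M; have /zsum_bnd_cvg[h _] := bF M.
  by apply: eq_cvgc h => n; rewrite -big_zbox.
- have /zsum_bnd_cvg[h _] := bG.
  by apply: eq_cvgc h => n; rewrite -big_zbox.
Qed.

(** The partial sums over [zbox n] are not symmetric: shifting the index changes them by f n - f
    (-n), which tends to 0. *)
Lemma zsum_shift1 f : zsummable f -> zsum (fun k => f (k + 1)) = zsum f.
Proof.
move=> hf; have [B hB] := hf.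
apply: cvgc_uniq (zsum_cvg (zsummable_shift 1 hf)) _.
have e0 : cvgc (fun n => f n - f (- n%:Z)) 0.
  have h (g : nat -> int) : injective g -> cvgc (fun n => f (g n)) 0.
    move=> gi.
    have hg n : \sum_(0 <= k < n) normc (f (g k)) <= B.
      rewrite -(big_map g xpredT (fun k => normc (f k))).
      by apply: hB; rewrite map_inj_uniq // iota_uniq.
    (* The terms are differences of consecutive partial sums of a convergent series, hence tend to
       0. *)
    have [l hl _] := series_cvgc (fun k => lexx (normc (f (g k)))) hg.
    have := cvgcB (proj2 (cvgc_shift 1 _ _) hl) hl; rewrite subrr.
    by apply: eq_cvgc => n; rewrite addn1 big_nat_recr //= addrAC subrr add0r.
  rewrite -(subr0 0); apply: cvgcB; apply: h.
    by move=> i j [].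
  by move=> i j /oppr_inj [].
rewrite -[zsum f]addr0; apply: eq_cvgc (cvgcD (zsum_cvg hf) e0) => n.
rewrite -!big_zbox; elim: n => [|n IH].
  by rewrite !big_geq // add0r oppr0 subrr.
rewrite [in RHS]big_nat_recr // -IH big_nat_recr //=.
have -> : Posz n + 1 = n.+1 by rewrite -addn1 PoszD.
have -> : Negz n + 1 = - n%:Z by rewrite NegzE; lia.
by rewrite NegzE; ring.
Qed.

Lemma zsum_shift j f : zsummable f -> zsum (fun k => f (k + j)) = zsum f.
Proof.
have hn (m : nat) g : zsummable g -> zsum (fun k => g (k + m%:Z)) = zsum g.
  move=> hg; elim: m => [|m IH]; first by apply: eq_zsum => k; rewrite addr0.
  rewrite -IH -[RHS]zsum_shift1; last exact: zsummable_shift.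
  by apply: eq_zsum => k; congr g; lia.
move=> hf; case: j => m; first exact: hn.
rewrite -[LHS](hn m.+1); last exact: zsummable_shift.
by apply: eq_zsum => k; congr f; rewrite NegzE; lia.
Qed.

(** A Fubini argument: the sum over m truncated to [zbox M] moves inside the sum over k, and
    Tannery's theorem with majorant a multiple of f passes to the limit, the inner sums tending to a
    translate of [zsum g]. *)
Lemma cauchy_product f g : zsummable f -> zsummable g ->
  zsummable (fun m => zsum (fun k => f k * g (m - k))) /\
  zsum (fun m => zsum (fun k => f k * g (m - k))) = zsum f * zsum g.
Proof.
move=> hf hg; have [A hA] := hf; have [B hB] := hg.
have A0 : 0 <= A by have := hA [::] isT; rewrite big_nil.
have B0 : 0 <= B by have := hB [::] isT; rewrite big_nil.
have gB k : normc (g k) <= B by have := hB [:: k] isT; rewrite big_seq1.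
have gsh k : zbnd (fun m => g (m - k)) B by apply: (zbnd_shift (- k)).
have sfg m : zsummable (fun k => f k * g (m - k)).
  apply: (@zsummable_le _ f B) => // k.
  by rewrite Normc.normcM mulrC ler_wpM2r ?normc_ge0.
have sc : zsummable (fun m => zsum (fun k => f k * g (m - k))).
  exists (A * B) => s us.
  have hc : (fun K => \sum_(m <- s) normc (\sum_(k <- zbox K) f k * g (m - k)))
      @ \oo --> \sum_(m <- s) normc (zsum (fun k => f k * g (m - k))).
    elim: s {us} => [|m s IH].
      rewrite big_nil (_ : (fun _ => _) = cst 0); first exact: cvg_cst.
      by apply/funext => K; rewrite big_nil.
    rewrite big_cons (_ : (fun _ => _) =
      (fun K => normc (\sum_(k <- zbox K) f k * g (m - k))) +
      (fun K => \sum_(m <- s) normc (\sum_(k <- zbox K) f k * g (m - k)))).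
      by apply: cvgD IH; apply: cvgc_norm; exact: zsum_cvg.
    by apply/funext => K; rewrite big_cons.
  apply: (cvgr_to_le hc); apply: nearW => K.
  apply: le_trans (ler_sum _ (fun m _ => normc_sum _ _ _)) _.
  rewrite exchange_big /=.
  apply: (@le_trans _ _ (\sum_(k <- zbox K) normc (f k) * B)).
    apply: ler_sum => k _; under eq_bigr do rewrite Normc.normcM.
    by rewrite -mulr_sumr ler_wpM2l ?normc_ge0 // gsh.
  by rewrite -mulr_suml ler_wpM2r // hA // zbox_uniq.
split=> //; apply: cvgc_uniq (zsum_cvg sc) _.
have -> : zsum f * zsum g = zsum (fun k => f k * zsum g).
  by rewrite mulrC -zsumZ //; apply: eq_zsum => k; rewrite mulrC.
apply: (@eq_cvgc _ (fun M => zsum (fun k => f k * \sum_(m <- zbox M) g (m - k)))).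
  move=> M; rewrite -(zsum_sum _ (fun m => sfg m)).2.
  by apply: eq_zsum => k; rewrite mulr_sumr.
apply: (@tannery_zsum _ _ (fun k => B%:C * f k)).
- move=> M k; rewrite !Normc.normcM normc_real // mulrC ler_wpM2r ?normc_ge0 //.
  by apply: le_trans (normc_sum _ _ _) _; apply/gsh/zbox_uniq.
- exact: zsummableZ.
- move=> k; apply: cvgcZ; rewrite -(zsum_shift (- k) hg).
  exact: zsum_cvg (zsummable_shift _ hg).
Qed.

End IntSums.

(** * Infinite products *)

Section InfiniteProducts.
Variable R : realType.
Implicit Types (a b x : R[i]).

Lemma prod1D_ge1 (I : Type) (t : seq I) (u : I -> R) :
  (forall i, 0 <= u i) -> 1 <= \prod_(i <- t) (1 + u i).
Proof.
move=> u0; elim: t => [|i t IH]; first by rewrite big_nil.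
by rewrite big_cons; have := u0 i; nra.
Qed.

Lemma prod1D_dist (I : Type) (t : seq I) (u : I -> R[i]) :
  normc (\prod_(i <- t) (1 + u i) - 1) <= \prod_(i <- t) (1 + normc (u i)) - 1.
Proof.
elim: t => [|i t IH]; first by rewrite !big_nil !subrr Normc.normc0.
rewrite !big_cons; set P := \prod_(i <- t) (1 + u i); set Q := \prod_(i <- t) (1 + normc (u i)).
have -> : (1 + u i) * P - 1 = (1 + u i) * (P - 1) + u i by ring.
apply: le_trans (normcD _ _) _; rewrite Normc.normcM.
have h := normcD 1 (u i); rewrite Normc.normc1 in h.
have := normc_ge0 (u i); have := normc_ge0 (P - 1); have := normc_ge0 (1 + u i).
move: IH; rewrite -/P -/Q => IH; nra.
Qed.

Lemma prod1D_le_exp (I : Type) (t : seq I) (u : I -> R) :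
  (forall i, 0 <= u i) -> \prod_(i <- t) (1 + u i) <= expR (\sum_(i <- t) u i).
Proof.
move=> u0; elim: t => [|i t IH]; first by rewrite !big_nil expR0.
rewrite !big_cons expRD; apply: ler_pM => //; last exact: expR_ge1Dx.
  by have := u0 i; lra.
by apply: le_trans (prod1D_ge1 _ u0).
Qed.

(** Increments of the complex product are dominated by those of the real product of 1 + |u i|, which
    the exponential bounds. General growing index sets cover both single and double products. The
    estimate of the distance to 1 is what later yields nonvanishing. *)
Lemma prod1D_cvgc (I : eqType) (s : nat -> seq I) (u : I -> R[i]) B :
  (forall n, uniq (s n)) -> (forall n, {subset s n <= s n.+1}) ->
  (forall n, \sum_(i <- s n) normc (u i) <= B) ->
  exists2 l, cvgc (fun n => \prod_(i <- s n) (1 + u i)) l &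
             normc (l - 1) <= expR B - 1.
Proof.
move=> us ss hB.
have hQ n : \prod_(i <- s n) (1 + normc (u i)) <= expR B.
  apply: le_trans (prod1D_le_exp _ (fun i => normc_ge0 (u i))) _.
  by rewrite ler_expR.
have hs n : perm_eq (s n.+1) (s n ++ [seq i <- s n.+1 | i \notin s n]).
  apply: uniq_perm => //.
    rewrite cat_uniq us filter_uniq // andbT /=.
    by apply/hasPn => i; rewrite mem_filter => /andP[].
  move=> i; rewrite mem_cat mem_filter; case: (boolP (i \in s n)) => //=.
  exact: ss.
have [n|l hl _] := @cvgc_dominated _ (fun n => \prod_(i <- s n) (1 + u i)) _ _ _ hQ.
  rewrite !(perm_big _ (hs n)) !big_cat /=; set t := [seq i <- s n.+1 | i \notin s n].
  set P := \prod_(i <- s n) (1 + u i); set Q := \prod_(i <- s n) (1 + normc (u i)).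
  set T := \prod_(i <- t) (1 + u i); set T' := \prod_(i <- t) (1 + normc (u i)).
  have -> : P * T - P = P * (T - 1) by ring.
  have -> : Q * T' - Q = Q * (T' - 1) by ring.
  rewrite Normc.normcM; apply: ler_pM; rewrite ?normc_ge0 ?prod1D_dist //.
  have hPQ : normc (P - 1) <= Q - 1 := prod1D_dist (s n) u.
  by have := normcD (P - 1) 1; rewrite subrK Normc.normc1; lra.
exists l => //.
apply: (cvgc_norm_le (k := 0%N) _ (cvgcB hl (cvgc_cst 1))) => n _.
by apply: le_trans (prod1D_dist _ _) _; rewrite lerD2r.
Qed.


Lemma sum_geo_le (r : R) n : 0 <= r < 1 -> \sum_(0 <= k < n) r ^+ k <= (1 - r)^-1.
Proof.
case/andP=> r0 r1; have r1' : 0 < 1 - r by rewrite subr_gt0.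
rewrite -[X in _ <= X]mul1r ler_pdivlMr // big_mkord.
have -> : (\sum_(k < n) r ^+ k) * (1 - r) = 1 - r ^+ n.
  by rewrite -[RHS]opprB subrX1; ring.
by rewrite lerBlDr lerDl exprn_ge0.
Qed.

(** From expR (-1/4) >= 3/4 one gets expR (1/4) <= 4/3 < 2; a product whose exponents sum to at most
    1/4 therefore stays away from 0. *)
Lemma expRB1_small (B : R) : B <= 4^-1 -> expR B - 1 < 1.
Proof.
move=> B4; have h1 : expR B <= expR 4^-1 by rewrite ler_expR.
have h2 := expR_ge1Dx (- 4^-1 : R); rewrite expRN in h2.
have h3 : 0 < expR (4^-1 : R) := expR_gt0 _.
have h4 : expR (4^-1 : R) * (expR (4^-1 : R))^-1 = 1 by rewrite divff ?gt_eqF.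
nra.
Qed.

Lemma small_pow (C : R) a : normc a < 1 -> exists k, C * normc a ^+ k <= 4^-1.
Proof.
move=> a1; have h : 0 < 4^-1 :> R by rewrite invr_gt0.
have a1' : `|normc a| < 1 by rewrite ger0_norm ?normc_ge0.
have [k _ /(_ k (leqnn k)) hk] := cvgr_lt _ (cvg_geometric C a1') _ h.
by exists k; exact: ltW.
Qed.

Lemma qpoch_lim x a : normc a < 1 ->
  cvgc (fun n => \prod_(0 <= m < n) (1 - x * a ^+ m)) (qpoch x a) /\
  normc (qpoch x a - 1) <= expR (normc x / (1 - normc a)) - 1.
Proof.
move=> a1.
have [||n|l hl h1] := @prod1D_cvgc _ (iota 0) (fun m => - (x * a ^+ m))
    (normc x / (1 - normc a)).
- by move=> n; exact: iota_uniq.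
- by move=> n i; rewrite !mem_iota !add0n => /andP[_ /leqW].
- under eq_bigr do rewrite normcNE Normc.normcM normcX.
  rewrite -mulr_sumr ler_wpM2l ?normc_ge0 //.
  have := @sum_geo_le (normc a) n; rewrite /index_iota subn0; apply.
  by rewrite normc_ge0.
have hl' : cvgc (fun n => \prod_(0 <= m < n) (1 - x * a ^+ m)) l.
  by apply: eq_cvgc hl => n; rewrite /index_iota subn0.
by rewrite /qpoch (limCE hl').
Qed.

Lemma qpoch_cvgc x a : normc a < 1 ->
  cvgc (fun n => \prod_(0 <= m < n) (1 - x * a ^+ m)) (qpoch x a).
Proof. by case/(qpoch_lim x). Qed.

Lemma qpochS x a : normc a < 1 -> qpoch x a = (1 - x) * qpoch (x * a) a.
Proof.
move=> a1; apply: cvgc_uniq (proj2 (cvgc_shift 1 _ _) (qpoch_cvgc x a1)) _.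
apply: eq_cvgc (cvgcZ _ (qpoch_cvgc (x * a) a1)) => n.
rewrite addn1 big_nat_recl // expr0 mulr1; congr (_ * _).
by apply: eq_bigr => i _; rewrite exprS mulrA.
Qed.

Lemma qpochSn n x a : normc a < 1 ->
  qpoch x a = \prod_(0 <= m < n) (1 - x * a ^+ m) * qpoch (x * a ^+ n) a.
Proof.
move=> a1; elim: n => [|n IH]; first by rewrite big_geq // mul1r expr0 mulr1.
rewrite IH big_nat_recr //= -[RHS]mulrA; congr (_ * _).
by rewrite exprSr mulrA; exact: qpochS.
Qed.

(** After finitely many nonzero factors are split off, the remaining product is at distance less
    than 1 from 1. *)
Lemma qpoch_neq0 x a : normc a < 1 -> (forall k : nat, x * a ^+ k != 1) ->
  qpoch x a != 0.
Proof.
move=> a1 hx; have [k hk] := small_pow (normc x / (1 - normc a)) a1.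
rewrite (qpochSn k) // mulf_neq0 //.
  by rewrite prodf_seq_neq0; apply/allP => i _; rewrite subr_eq0 eq_sym hx.
have [_ h] := qpoch_lim (x * a ^+ k) a1; apply/eqP => h0; move: h.
rewrite h0 sub0r normcNE Normc.normc1 leNgt expRB1_small //.
by rewrite Normc.normcM normcX mulrAC.
Qed.

Definition square_index n : seq (nat * nat) :=
  [seq (m, l) | m <- iota 0 n, l <- iota 0 n].

Lemma mem_square n i : (i \in square_index n) = ((i.1 < n) && (i.2 < n))%N.
Proof.
apply/allpairsP/idP => [[[m l] /= [h1 h2 ->]]|].
  by move: h1 h2; rewrite !mem_iota /= => -> ->.
by case: i => m l /= /andP[h1 h2]; exists (m, l); rewrite !mem_iota h1 h2.
Qed.

Lemma qpoch2_lim x a b : normc a < 1 -> normc b < 1 ->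
  cvgc (fun n => \prod_(0 <= m < n) \prod_(0 <= l < n) (1 - x * a ^+ m * b ^+ l))
    (qpoch2 x a b) /\
  normc (qpoch2 x a b - 1) <=
    expR (normc x / ((1 - normc a) * (1 - normc b))) - 1.
Proof.
move=> a1 b1.
have [||n|l hl h1] := @prod1D_cvgc _ square_index
    (fun i => - (x * a ^+ i.1 * b ^+ i.2))
    (normc x / ((1 - normc a) * (1 - normc b))).
- by move=> n; apply: allpairs_uniq; rewrite ?iota_uniq // => -[? ?] [].
- by move=> n i; rewrite !mem_square => /andP[h1 h2]; rewrite !leqW.
- rewrite big_allpairs_dep /=.
  under eq_bigr => i _ do under eq_bigr => j _ do
    rewrite normcNE !Normc.normcM !normcX.
  under eq_bigr => i _ do rewrite -mulr_sumr.
  rewrite -mulr_suml -mulr_sumr -mulrA ler_wpM2l ?normc_ge0 // invfM.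
  have ha := @sum_geo_le (normc a) n; have hb := @sum_geo_le (normc b) n.
  rewrite /index_iota subn0 in ha hb.
  apply: ler_pM; rewrite ?ha ?hb ?normc_ge0 //.
    by apply: sumr_ge0 => i _; rewrite exprn_ge0 ?normc_ge0.
  by apply: sumr_ge0 => i _; rewrite exprn_ge0 ?normc_ge0.
have hl' : cvgc (fun n => \prod_(0 <= m < n) \prod_(0 <= l < n)
    (1 - x * a ^+ m * b ^+ l)) l.
  by apply: eq_cvgc hl => n; rewrite big_allpairs_dep /index_iota subn0.
by rewrite /qpoch2 (limCE hl').
Qed.

Lemma qpoch2_cvgc x a b : normc a < 1 -> normc b < 1 ->
  cvgc (fun n => \prod_(0 <= m < n) \prod_(0 <= l < n) (1 - x * a ^+ m * b ^+ l))
    (qpoch2 x a b).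
Proof. by move=> a1 b1; case: (qpoch2_lim x a1 b1). Qed.

Lemma qpoch2C x a b : qpoch2 x a b = qpoch2 x b a.
Proof.
rewrite /qpoch2; congr limC; apply/funext => n; rewrite exchange_big /=.
by apply: eq_bigr => i _; apply: eq_bigr => j _; rewrite mulrAC.
Qed.

Lemma qpoch2S x a b : normc a < 1 -> normc b < 1 ->
  qpoch2 x a b = qpoch x b * qpoch2 (x * a) a b.
Proof.
move=> a1 b1.
(* The row m = n, missing from the square partial product, tends to 1. So the rectangles with n + 1
   rows and n columns have the same limit as the squares, and from them row 0 splits off exactly. *)
have hn : cvgc (fun n => \prod_(0 <= l < n) (1 - x * a ^+ n * b ^+ l)) 1.
  apply: (@cvgc_le _ _ _ (fun n => expR (normc x / (1 - normc b) * normc a ^+ n) - 1)).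
    move=> n; apply: le_trans (prod1D_dist _ _) _; rewrite lerD2r.
    apply: le_trans (prod1D_le_exp _ (fun i => normc_ge0 _)) _; rewrite ler_expR.
    under eq_bigr do rewrite normcNE Normc.normcM normcX.
    rewrite -mulr_sumr Normc.normcM normcX mulrAC.
    rewrite ler_wpM2r ?exprn_ge0 ?normc_ge0 //.
    by rewrite ler_wpM2l ?normc_ge0 // sum_geo_le // normc_ge0.
  have a1' : `|normc a| < 1 by rewrite ger0_norm ?normc_ge0.
  have h := cvg_comp _ _ (cvg_geometric (normc x / (1 - normc b)) a1')
    (@continuous_expR R 0).
  by have := cvgB h (cvg_cst (1 : R)); rewrite expR0 subrr; apply.
apply: (cvgc_uniq (u := fun n => \prod_(0 <= m < n.+1) \prod_(0 <= l < n)
    (1 - x * a ^+ m * b ^+ l))).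
  rewrite -[qpoch2 x a b]mulr1.
  by apply: eq_cvgc (cvgcM (qpoch2_cvgc x a1 b1) hn) => n; rewrite big_nat_recr.
apply: eq_cvgc (cvgcM (qpoch_cvgc x b1) (qpoch2_cvgc (x * a) a1 b1)) => n.
rewrite big_nat_recl // expr0 mulr1; congr (_ * _).
by apply: eq_bigr => i _; apply: eq_bigr => j _; rewrite exprS mulrA.
Qed.

Lemma qpoch2_neq0 x a b : normc a < 1 -> normc b < 1 ->
  (forall k l : nat, x * a ^+ k * b ^+ l != 1) -> qpoch2 x a b != 0.
Proof.
move=> a1 b1 hx.
have [K hK] := small_pow (normc x / ((1 - normc a) * (1 - normc b))) a1.
have hS k : qpoch2 x a b = (\prod_(0 <= m < k) qpoch (x * a ^+ m) b) *
    qpoch2 (x * a ^+ k) a b.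
  elim: k => [|k ->]; first by rewrite big_geq // mul1r expr0 mulr1.
  rewrite big_nat_recr //= -[RHS]mulrA; congr (_ * _).
  by rewrite exprSr mulrA; exact: qpoch2S.
rewrite (hS K) mulf_neq0 //.
  by rewrite prodf_seq_neq0; apply/allP => i _; apply: qpoch_neq0.
have [_ h] := qpoch2_lim (x * a ^+ K) a1 b1; apply/eqP => h0; move: h.
rewrite h0 sub0r normcNE Normc.normc1 leNgt expRB1_small //.
by rewrite Normc.normcM normcX mulrAC.
Qed.

End InfiniteProducts.

(** * The exponential and the Jacobi triple product *)

Section Exponential.
Variable R : realType.
Implicit Types (x y : R[i]).

Lemma cexpD x y : cexp (x + y) = cexp x * cexp y.
Proof.
case: x y => [a b] [c d]; rewrite /cexp /= expRD cosD sinD /=.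
by apply/eqP; rewrite eq_complex /=; apply/andP; split; apply/eqP; ring.
Qed.

Lemma epiD x y : epi (x + y) = epi x * epi y.
Proof. by rewrite /epi mulrDr cexpD. Qed.

Lemma epi0 : epi 0 = 1 :> R[i].
Proof.
rewrite /epi mulr0 /cexp /= expR0 cos0 sin0.
by apply/eqP; rewrite eq_complex /=; apply/andP; split; apply/eqP; ring.
Qed.

Lemma epi_neq0 x : epi x != 0.
Proof.
apply/eqP => h; have := epiD x (- x); rewrite subrr epi0 h mul0r => /eqP.
by rewrite oner_eq0.
Qed.

Lemma epiN x : epi (- x) = (epi x)^-1.
Proof.
by apply: (mulfI (epi_neq0 x)); rewrite -epiD subrr epi0 divff // epi_neq0.
Qed.

Lemma epi1 : epi 1 = -1 :> R[i].
Proof.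
rewrite /epi mulr1 /cexp /= expR0 cospi sinpi.
by apply/eqP; rewrite eq_complex /=; apply/andP; split; apply/eqP; ring.
Qed.

Lemma epiMn n x : epi (n%:R * x) = epi x ^+ n.
Proof.
elim: n => [|n IH]; first by rewrite mul0r epi0.
by rewrite -natr1 mulrDl mul1r epiD IH exprSr.
Qed.

Lemma epiMz (m : int) x : epi (m%:~R * x) = epi x ^ m.
Proof.
case: m => n; first exact: epiMn.
by rewrite NegzE mulrNz mulNr epiN epiMn.
Qed.

Lemma epi_int2 (m : int) : epi (2 * m%:~R) = 1 :> R[i].
Proof.
rewrite mulrC epiMz (_ : 2 = 1 + 1) // epiD epi1 mulrNN mulr1.
by rewrite exp1rz.
Qed.

End Exponential.

Section JacobiTriple.
Variable R : realType.
Implicit Types (u : nat -> R[i]) (l : R[i]).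

Lemma cvgcV u l : l != 0 -> cvgc u l -> cvgc (fun n => (u n)^-1) l^-1.
Proof.
case: l => a b l0 [/= h1 h2].
have n0 : a ^+ 2 + b ^+ 2 != 0.
  apply: contraNneq l0 => /eqP; rewrite paddr_eq0 ?sqr_ge0 // !sqrf_eq0.
  by case/andP => /eqP -> /eqP ->.
have hn : (fun n => complex.Re (u n) ^+ 2 + complex.Im (u n) ^+ 2) @ \oo -->
    a ^+ 2 + b ^+ 2.
  by apply: cvgD; apply: (cvgM (f := _) (g := _)).
have hV : (fun n => (complex.Re (u n) ^+ 2 + complex.Im (u n) ^+ 2)^-1) @ \oo -->
    (a ^+ 2 + b ^+ 2)^-1 by exact: cvgV.
split => /=.
  rewrite (_ : _ \o _ = (@complex.Re R \o u) *
    (fun n => (complex.Re (u n) ^+ 2 + complex.Im (u n) ^+ 2)^-1)).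
    exact: cvgM.
  by apply/funext => n; rewrite !fctE /=; case: (u n).
rewrite (_ : _ \o _ = - ((@complex.Im R \o u) *
  (fun n => (complex.Re (u n) ^+ 2 + complex.Im (u n) ^+ 2)^-1))).
  by apply: cvgN; exact: cvgM.
by apply/funext => n; rewrite !fctE /=; case: (u n) => ? ? /=.
Qed.

Lemma cvgc_bounded u l : cvgc u l -> exists2 B, 0 <= B & forall n, normc (u n) <= B.
Proof.
move=> /cvgc_norm h.
have [k _ hk] := cvgr_le _ h (normc l + 1) ltac:(by rewrite ltrDl).
exists (normc l + 1 + \sum_(i < k) normc (u i)).
  by rewrite !addr_ge0 ?normc_ge0 // sumr_ge0 // => i _; exact: normc_ge0.
move=> n; case: (leqP k n) => [kn|nk].
  apply: le_trans (hk n kn) _; rewrite lerDl sumr_ge0 // => i _; exact: normc_ge0.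
rewrite (bigD1 (Ordinal nk)) //= addrCA lerDl !addr_ge0 ?normc_ge0 //.
by rewrite sumr_ge0 // => i _; exact: normc_ge0.
Qed.

Lemma ratio_bound (g : nat -> R) K : (forall k, 0 <= g k) ->
  (forall k, (K <= k)%N -> g k.+1 <= g k / 2) ->
  forall n, \sum_(0 <= k < n) g k <= \sum_(0 <= k < K) g k + 2 * g K.
Proof.
move=> g0 hg.
(* Adding twice the next term turns the partial sums past K into a nonincreasing quantity. *)
have hm m : \sum_(0 <= k < K + m) g k + 2 * g (K + m)%N <=
    \sum_(0 <= k < K) g k + 2 * g K.
  elim: m => [|m IH]; first by rewrite addn0.
  by rewrite addnS big_nat_recr //=; have := hg _ (leq_addr m K); lra.
move=> n; case: (leqP K n) => [/subnKC <-|nK].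
  by apply: le_trans (hm (n - K)%N); rewrite lerDl mulr_ge0.
rewrite -(subnKC (ltnW nK)) [X in _ <= X + _](@big_cat_nat _ _ _ n) ?leq_addr //=.
by rewrite -addrA lerDl addr_ge0 ?mulr_ge0 ?sumr_ge0.
Qed.

(* [tri j = j (j - 1) / 2], a natural number for every integer [j] *)
Definition tri (j : int) : nat :=
  match j with Posz n => 'C(n, 2) | Negz n => 'C(n.+2, 2) end.

Lemma tri2 (j : int) : (tri j)%:Z * 2 = j * (j - 1).
Proof.
have h (n : nat) : ('C(n.+1, 2) * 2 = n.+1 * n)%N.
  by rewrite bin2 /= muln2 -[in RHS](odd_double_half (n.+1 * n)) oddM /= andNb.
case: j => [[|n]|n] //=.
  by rewrite -PoszM h PoszM; congr (_ * _); lia.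
by rewrite -PoszM h NegzE PoszM; lia.
Qed.

Lemma triD1 (j : int) : (tri (j + 1))%:Z = (tri j)%:Z + j.
Proof. have := tri2 (j + 1); have := tri2 j; nia. Qed.

Definition theta_coef (p y : R[i]) (n : int) : R[i] :=
  (-1) ^ n * p ^+ tri n * y ^ n.

Lemma theta_coefS (p y : R[i]) n : p != 0 -> y != 0 ->
  theta_coef p y (n + 1) = - y * p ^ n * theta_coef p y n.
Proof.
move=> p0 y0; rewrite /theta_coef !exprnP triD1.
rewrite !expfzDr ?oppr_eq0 ?oner_eq0 // !expr1z; ring.
Qed.

(** The ratio of consecutive terms is |y| |p|^k going up and the inverse of such a quantity going
    down. Each half gets its own threshold, [K] from |y| and [K'] from 1/|y|, past which terms at
    least halve. *)
Lemma theta_coef_summable (p y : R[i]) : normc p < 1 -> p != 0 -> y != 0 ->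
  zsummable (theta_coef p y).
Proof.
move=> p1 p0 y0.
have np0 : 0 < normc p by rewrite lt_def normc_ge0 normc_eq0 p0.
have ny0 : 0 < normc y by rewrite lt_def normc_ge0 normc_eq0 y0.
have pw k m : (k <= m)%N -> normc p ^+ m <= normc p ^+ k.
  by move=> km; apply: ler_wiXn2l; rewrite ?ltW.
have [K hK] := small_pow (normc y) p1.
have [K' hK'] := small_pow (normc y)^-1 p1.
have h1 := @ratio_bound (fun k => normc (theta_coef p y (Posz k))) K
  (fun k => normc_ge0 _) _.
have h2 := @ratio_bound (fun k => normc (theta_coef p y (Negz k))) K'
  (fun k => normc_ge0 _) _.
eexists; apply: zbnd_box => n; rewrite big_split; apply: lerD.
  apply: h1 => k kK; rewrite -addn1 PoszD theta_coefS //.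
  rewrite 2!Normc.normcM normcNE -exprnP normcX mulrC ler_wpM2l ?normc_ge0 //.
  apply: le_trans (ler_wpM2l (ltW ny0) (pw _ _ kK)) _.
  by apply: le_trans hK _; lra.
apply: h2 => k kK.
have e : Negz k = Negz k.+1 + 1 by rewrite !NegzE; lia.
rewrite [in X in _ <= X]e theta_coefS //.
rewrite (Normc.normcM (- y * _)) (Normc.normcM (- y)) normcNE.
set g := normc (theta_coef _ _ _).
have -> : normc (p ^ Negz k.+1) = (normc p ^+ k.+2)^-1.
  by rewrite Normc.normcV normcX.
have g0 : 0 <= g by exact: normc_ge0.
have P0 : 0 < normc p ^+ k.+2 by rewrite exprn_gt0.
have h : 2 <= normc y * (normc p ^+ k.+2)^-1.
  rewrite ler_pdivlMr //; have := pw _ _ (leq_trans kK (leqW (leqnSn k))).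
  have : normc y * ((normc y)^-1 * normc p ^+ K') <= normc y * 4^-1.
    by rewrite ler_wpM2l // ltW.
  rewrite mulrA divff ?gt_eqF // mul1r; nra.
nra.
Qed.

Section FiniteTriple.
Variables (p : R[i]).
Hypotheses (p1 : normc p < 1) (p0 : p != 0).

(** The factors are written [p * p ^+ k] so that this is literally the partial product of
    [qpoch p p]. *)
Definition qfact n : R[i] := \prod_(0 <= k < n) (1 - p * p ^+ k).

Lemma qfactS n : qfact n.+1 = qfact n * (1 - p ^+ n.+1).
Proof. by rewrite /qfact big_nat_recr //= exprS. Qed.

Lemma normc_pow_lt1 n : normc (p ^+ n.+1) < 1.
Proof. by rewrite normcX exprn_ilt1 ?normc_ge0. Qed.

Lemma pow_neq1 n : p ^+ n.+1 != 1.
Proof.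
by apply: contraTneq (normc_pow_lt1 n) => ->; rewrite Normc.normc1 ltxx.
Qed.

Lemma qfact_neq0 n : qfact n != 0.
Proof.
rewrite prodf_seq_neq0; apply/allP => k _.
by rewrite -exprS subr_eq0 eq_sym pow_neq1.
Qed.

Definition qbin M k := qfact M / (qfact k * qfact (M - k)).

Lemma qbin0 M : qbin M 0 = 1.
Proof. by rewrite /qbin subn0 [qfact 0]big_geq // mul1r divff ?qfact_neq0. Qed.

Lemma qbinn M : qbin M M = 1.
Proof. by rewrite /qbin subnn [qfact 0]big_geq // mulr1 divff ?qfact_neq0. Qed.

Lemma qbinS M k : (k < M)%N ->
  qbin M.+1 k.+1 = qbin M k.+1 + p ^+ (M - k) * qbin M k.
Proof.
move=> kM; rewrite /qbin subSS !qfactS.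
have -> : (M - k = (M - k.+1).+1)%N by lia.
rewrite !qfactS; have -> : p ^+ M.+1 = p ^+ (M - k.+1).+1 * p ^+ k.+1.
  by rewrite -exprD; congr (_ ^+ _); lia.
have := qfact_neq0 k; have := qfact_neq0 (M - k.+1); have := qfact_neq0 M.
have := pow_neq1 k; have := pow_neq1 (M - k.+1); rewrite -!(subr_eq0 _ 1).
move: (qfact _) (qfact _) (qfact _) (p ^+ _) (p ^+ _) => a b d x y hx hy ha hb hd.
field; rewrite ?hd ?hb /= ?andbT.
by rewrite -opprB oppr_eq0 hx -opprB oppr_eq0 hy.
Qed.

Lemma qbinomial M x : \prod_(0 <= k < M) (1 + x * p ^+ k) =
  \sum_(0 <= k < M.+1) p ^+ 'C(k, 2) * qbin M k * x ^+ k.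
Proof.
elim: M => [|M IH].
  by rewrite big_geq // big_nat1 qbin0 !expr0 !mulr1.
rewrite big_nat_recr //= IH mulrDr mulr1 mulr_suml.
rewrite [X in _ + X]big_nat_recr //= [X in X + _]big_nat_recl //=.
rewrite [RHS]big_nat_recl // [X in _ = _ + X]big_nat_recr //= !qbin0 !qbinn.
rewrite -!addrA; congr (_ + _); rewrite !addrA -big_split /=; congr (_ + _); last first.
  by rewrite binS bin1 exprD exprS; ring.
apply: eq_big_nat => k /andP[_ kM].
rewrite qbinS // binS bin1 !exprD.
have -> : p ^+ M = p ^+ (M - k) * p ^+ k by rewrite -exprD subnK // ltnW.
rewrite exprS; ring.
Qed.

End FiniteTriple.

End JacobiTriple.

Lemma big_nat_addn (T : Type) (idx : T) (op : Monoid.law idx) n m (F : nat -> T) :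
  \big[op/idx]_(0 <= k < n + m) F k =
  op (\big[op/idx]_(0 <= k < n) F k) (\big[op/idx]_(0 <= k < m) F (n + k)%N).
Proof.
rewrite (@big_cat_nat _ _ _ n) ?leq_addr //=; congr (op _ _).
rewrite -[X in \big[op/idx]_(X <= _ < _) _]addn0 -[X in index_iota _ X]addnC.
by rewrite addn0 -{1}[n]add0n big_addn addnK; apply: eq_bigr => k _; rewrite addnC.
Qed.

Section JacobiTriple2.
Variables (R : realType) (p : R[i]).
Hypotheses (p1 : normc p < 1) (p0 : p != 0).
Variable w : R[i].
Hypothesis w0 : w != 0.

Let th := theta_coef p w.

Lemma theta_coef_pow n k : p ^+ 'C(k, 2) * (- (w / p ^+ n)) ^+ k * th (- n%:Z) = th (k%:Z - n%:Z).
Proof.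
elim: k => [|k IH]; first by rewrite !expr0 !mul1r sub0r.
have -> : k.+1%:Z - n%:Z = k%:Z - n%:Z + 1 by lia.
rewrite /th theta_coefS // -/th -IH binS bin1 exprD exprS.
rewrite expfzDr // exprnN -exprnP; ring.
Qed.

(** So th (-n) compensates the constants pulled out of the first n factors in
    [finite_triple_product]. *)
Lemma prod_theta_coef n :
  \prod_(0 <= k < n) (- (w / p ^+ k.+1)) * th (- n%:Z) = 1.
Proof.
elim: n => [|n IH].
  by rewrite big_geq // mul1r /th /theta_coef !expr0z /= expr0 !mulr1.
rewrite big_nat_recr //= -mulrA -[RHS]IH; congr (_ * _).
have -> : - n%:Z = - n.+1%:Z + 1 by lia.
by rewrite /th theta_coefS // -exprnN exprnP; ring.
Qed.

Definition triple_coef n (j : int) : R[i] :=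
  if (- n%:Z <= j <= n%:Z) then th j * qbin p (n + n)%N (absz (n%:Z + j)) else 0.

(** The q-binomial theorem with 2n factors starting at -w p^-n. The last n factors are those in w;
    in the first n, read backwards, the constants -w / p^(k+1) are pulled out and the factors in p /
    w remain. Recentring the index at n gives the theta coefficients. *)
Lemma finite_triple_product n :
  \prod_(0 <= k < n) (1 - w * p ^+ k) * \prod_(0 <= k < n) (1 - p / w * p ^+ k) =
  \sum_(j <- zbox n.+1) triple_coef n j.
Proof.
set x := - (w / p ^+ n).
have hq := qbinomial p1 p0 (n + n)%N x.
have hA : \prod_(0 <= k < (n + n)%N) (1 + x * p ^+ k) =
   \prod_(0 <= k < n) (- (w / p ^+ k.+1)) *
   (\prod_(0 <= k < n) (1 - w * p ^+ k) * \prod_(0 <= k < n) (1 - p / w * p ^+ k)).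
  rewrite big_nat_addn /=.
  rewrite mulrCA mulrC; congr (_ * _).
    apply: eq_big_nat => k _; rewrite /x exprD; field; exact: expf_neq0.
  rewrite big_nat_rev /= -big_split /= add0n; apply: eq_big_nat => k /andP[_ kn].
  rewrite /x; have -> : (n = (n - k.+1) + k.+1)%N by rewrite subnK.
  by rewrite addnK exprD exprS; field; rewrite w0 p0 !expf_neq0.
have -> : \prod_(0 <= k < n) (1 - w * p ^+ k) *
    \prod_(0 <= k < n) (1 - p / w * p ^+ k) =
    \sum_(0 <= k < (n + n)%N.+1) th (k%:Z - n%:Z) * qbin p (n + n)%N k.
  rewrite -[LHS]mul1r -[X in X * _](prod_theta_coef n) mulrAC -hA hq mulr_suml.
  apply: eq_bigr => k _; rewrite -theta_coef_pow /x; ring.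
rewrite -addnS big_nat_addn /=.
rewrite -big_zbox big_split /= addrC; congr (_ + _).
  apply: eq_big_nat => k /andP[_ kn]; rewrite /triple_coef.
  have -> : (- n%:Z <= Posz k <= n%:Z) by lia.
  by congr (th _ * qbin _ _ _); lia.
(* [zbox n.+1] runs from -n-1 to n; the extra index -n-1 has coefficient 0. *)
rewrite [RHS]big_nat_recr //= [X in _ + X](_ : _ = 0); last first.
  by rewrite /triple_coef; case: ifP => //; rewrite NegzE; lia.
rewrite addr0 big_nat_rev; apply: eq_big_nat => k /andP[_ kn]; rewrite /triple_coef.
have -> : (- n%:Z <= Negz k <= n%:Z) by rewrite NegzE; lia.
by congr (th _ * qbin _ _ _); rewrite NegzE; lia.
Qed.

Lemma qfact_cvgc : cvgc (qfact p) (qpoch p p).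
Proof. exact: qpoch_cvgc. Qed.

Lemma qpochpp_neq0 : qpoch p p != 0.
Proof. by apply: qpoch_neq0 => // k; rewrite -exprS pow_neq1. Qed.

(** As n grows, the Gaussian binomial of 2n over n + j tends to 1 / (p;p) for each fixed j, and the
    third factor of [Theta] cancels this constant. *)
Theorem jacobi_triple_product : Theta p w = zsum th.
Proof.
have sth : zsummable th by exact: theta_coef_summable.
have cV := cvgcV qpochpp_neq0 qfact_cvgc.
have [U U0 hU] := cvgc_bounded qfact_cvgc.
have [V V0 hV] := cvgc_bounded cV.
have hl : cvgc (fun n => zsum (triple_coef n)) (qpoch w p * qpoch (p / w) p).
  apply: eq_cvgc (cvgcM (qpoch_cvgc w p1) (qpoch_cvgc (p / w) p1)) => n.
  rewrite finite_triple_product; apply/esym/zsum_supp => k.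
  rewrite mem_zbox /triple_coef; case: ifP => //; case: k => k; rewrite ?NegzE; lia.
have hr : cvgc (fun n => zsum (triple_coef n)) (zsum (fun j => (qpoch p p)^-1 * th j)).
  (* A Gaussian binomial is one [qfact] times two inverse ones, bounded by [U] and twice by [V]. *)
  apply: (@tannery_zsum _ _ _ (fun j => (U * V * V)%:C * th j)).
  - move=> n j; rewrite /triple_coef; case: ifP => _; last first.
      by rewrite Normc.normc0 normc_ge0.
    rewrite mulrC (Normc.normcM (qbin _ _ _)) (Normc.normcM (_%:C)).
    rewrite ler_wpM2r ?normc_ge0 // normc_real ?mulr_ge0 // /qbin invfM.
    rewrite (Normc.normcM (qfact _ _)) (Normc.normcM (_^-1)) -mulrA.
    apply: ler_pM; rewrite ?mulr_ge0 ?normc_ge0 // ?hU //.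
    by apply: ler_pM; rewrite ?normc_ge0 // ?hV.
  - exact: zsummableZ.
  (* Starting the sequence at |j| keeps j within the range where [triple_coef] is not the default
     0. *)
  - move=> j; apply/(cvgc_shift (absz j)).
    apply: (@eq_cvgc _ (fun n => qfact p (n + absz j + (n + absz j))%N *
      ((qfact p (absz ((n + absz j)%N%:Z + j)%R))^-1 *
       (qfact p (absz ((n + absz j)%N%:Z - j)%R))^-1) * th j)).
      move=> n; rewrite /triple_coef; case: ifP; last by lia.
      move=> _; rewrite mulrC /qbin invfM; congr (_ * (_ * (_ * (qfact p _)^-1))); lia.
    apply: cvgcM (cvgc_cst _).
    have sub (u : nat -> R[i]) l (g : nat -> nat) : cvgc u l -> (forall n, n <= g n)%N -> cvgc (u \o g) l.
      move=> [c1 c2] hg.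
      have gi : g n @[n --> \oo] --> \oo.
        by move=> A [N _ hN]; exists N => // n /= Nn; apply/hN/(leq_trans Nn)/hg.
      by split; [exact: cvg_comp gi c1|exact: cvg_comp gi c2].
    rewrite -[X in cvgc _ X](mulKf qpochpp_neq0) mulrCA.
    apply: cvgcM; last apply: cvgcM.
    + by apply: (sub _ _ (fun n => (n + absz j + (n + absz j))%N) qfact_cvgc) => n; lia.
    + by apply: (sub _ _ (fun n => (absz ((n + absz j)%N%:Z + j)%R)) cV) => n; lia.
    + by apply: (sub _ _ (fun n => (absz ((n + absz j)%N%:Z - j)%R)) cV) => n; lia.
have := cvgc_uniq hl hr; rewrite zsumZ // /Theta => ->.
by rewrite mulrAC mulVf ?qpochpp_neq0 ?mul1r.
Qed.

End JacobiTriple2.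

(** * Theta functions and roots of unity *)

Local Close Scope classical_set_scope.
Opaque epi cexp.

Section ThetaFunctions.
Variable R : realType.
Implicit Types (p w x y : R[i]).

Lemma Theta_mulp p w : normc p < 1 -> p != 0 -> w != 0 ->
  Theta p (p * w) = - w^-1 * Theta p w.
Proof.
move=> p1 p0 w0; rewrite /Theta (qpochS w p1) mulrC.
have -> : p * (p * w)^-1 = w^-1 by rewrite invfM mulVKf.
rewrite (qpochS w^-1 p1) [w^-1 * p]mulrC [p * w]mulrC.
by field.
Qed.

Lemma ThetaV p w : normc p < 1 -> p != 0 -> w != 0 ->
  Theta p w^-1 = - w^-1 * Theta p w.
Proof.
move=> p1 p0 w0; rewrite /Theta (qpochS w p1) (qpochS w^-1 p1) invrK.
by rewrite [w^-1 * p]mulrC [p * w]mulrC; field.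
Qed.

Lemma Theta_neq0 p w : normc p < 1 -> p != 0 -> w != 0 ->
  (forall k : int, w != p ^ k) -> Theta p w != 0.
Proof.
move=> p1 p0 w0 h.
have h1 : qpoch w p != 0.
  apply: (qpoch_neq0 p1) => k; apply: contraNneq (h (- k%:Z)) => hk.
  by rewrite -exprnN; apply/eqP/(mulIf (expf_neq0 k p0)); rewrite hk mulVf ?expf_neq0.
have h2 : qpoch (p / w) p != 0.
  apply: (qpoch_neq0 p1) => k; apply: contraNneq (h k.+1%:Z) => hk.
  rewrite -exprnP exprS; apply/eqP/(mulIf (invr_neq0 w0)).
  by rewrite divff // -hk mulrAC.
by rewrite /Theta (mulf_neq0 (mulf_neq0 h1 h2) (qpochpp_neq0 p1)).
Qed.

Lemma Theta1 p : normc p < 1 -> Theta p 1 = 0.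
Proof. by move=> p1; rewrite /Theta (qpochS 1 p1) subrr !mul0r. Qed.

Lemma Theta_p p : normc p < 1 -> p != 0 -> Theta p p = 0.
Proof. by move=> p1 p0; rewrite -[X in Theta _ X]mulr1 Theta_mulp ?oner_eq0 // Theta1 ?mulr0. Qed.

(** Theta functions of order M: the recursion is F (p w) = lam^-1 w^-M F w read on Laurent
    coefficients. In this form it is plain that M consecutive coefficients determine all others. *)
Definition thspace p (M : nat) (lam : R[i]) (F : R[i] -> R[i]) : Prop :=
  exists a : int -> R[i], [/\ forall w, w != 0 -> zsummable (fun n => a n * w ^ n),
    forall w, w != 0 -> F w = zsum (fun n => a n * w ^ n)
    & forall n, a (n + M%:Z) = lam * p ^ n * a n].

Lemma thspace_ext p M lam F G : (forall w, w != 0 -> F w = G w) ->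
  thspace p M lam F -> thspace p M lam G.
Proof. by move=> h [a [a1 a2 a3]]; exists a; split=> // w w0; rewrite -h // a2. Qed.

Lemma thspace_one p : thspace p 0 1 (fun=> 1).
Proof.
pose a (n : int) : R[i] := (n == 0)%:R; exists a.
have h w n : n \notin zbox 1 -> a n * w ^ n = 0.
  by rewrite mem_zbox /a; case: n => [[|n]|n] //=; rewrite ?mul0r.
split=> [w _|w w0|n].
- exists (\sum_(k <- zbox 1) normc (a k * w ^ k)) => s us.
  rewrite (bigID (mem (zbox 1))) /= [X in _ + X]big1 ?addr0; last first.
    by move=> n /h ->; rewrite Normc.normc0.
  rewrite -big_filter; apply: sum_subset; first by move=> k; exact: normc_ge0.
    exact: filter_uniq.
  by move=> k; rewrite mem_filter => /andP[].
- by rewrite (zsum_supp (h w)) -big_zbox big_nat1 /a /= mul0r addr0 mulr1.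
- rewrite addr0 /a; case: eqP => [->|]; last by rewrite !mulr0.
  by rewrite expr0z !mulr1.
Qed.

Lemma thspace_scale p M lam c F : thspace p M lam F -> thspace p M lam (fun w => c * F w).
Proof.
move=> [a [a1 a2 a3]]; exists (fun n => c * a n).
have e w : (fun n => c * a n * w ^ n) = (fun n => c * (a n * w ^ n)).
  by apply/funext => n; rewrite mulrA.
split=> [w w0|w w0|n]; rewrite ?e.
- exact/zsummableZ/a1.
- by rewrite zsumZ ?a2 //; exact: a1.
- by rewrite a3; ring.
Qed.

Lemma thspace_sum p M lam (I : Type) (r : seq I) (F : I -> R[i] -> R[i]) :
  (forall i, thspace p M lam (F i)) -> thspace p M lam (fun w => \sum_(i <- r) F i w).
Proof.
move=> h; have [a ha] := choice h.
exists (fun n => \sum_(i <- r) a i n).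
have e w : (fun n => (\sum_(i <- r) a i n) * w ^ n) = (fun n => \sum_(i <- r) a i n * w ^ n).
  by apply/funext => n; rewrite mulr_suml.
split=> [w w0|w w0|n]; rewrite ?e.
- by apply: (proj1 (zsum_sum _ _)) => i; have [] := ha i => h1 _ _; exact: h1.
- rewrite (proj2 (zsum_sum _ _)) => [|i]; last by have [] := ha i => h1 _ _; exact: h1.
  by apply: eq_bigr => i _; have [_ h2 _] := ha i; exact: h2.
- by rewrite mulr_sumr; apply: eq_bigr => i _; have [_ _ h3] := ha i; exact: h3.
Qed.

Lemma thspace_mulX p M lam F (k : int) : p != 0 -> thspace p M lam F ->
  thspace p M (lam * p ^ (- k)) (fun w => w ^ k * F w).
Proof.
move=> p0 [a [a1 a2 a3]]; exists (fun n => a (n - k)).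
have e w : w != 0 -> (fun n => a (n - k) * w ^ n) =
    (fun n => w ^ k * (a (n + - k) * w ^ (n + - k))).
  move=> w0; apply/funext => n.
  by rewrite -[in LHS](subrK k n) addrK expfzDr //; ring.
split=> [w w0|w w0|n]; rewrite ?e //.
- exact/zsummableZ/(@zsummable_shift _ (- k) (fun n => a n * w ^ n))/a1.
- rewrite zsumZ ?(@zsum_shift _ (- k) (fun n => a n * w ^ n)) ?a2 //; first exact: a1.
  exact/(@zsummable_shift _ (- k) (fun n => a n * w ^ n))/a1.
- by rewrite addrAC a3 expfzDr //; ring.
Qed.

Lemma zsummable_convolution (f g : int -> R[i]) m : zsummable f -> zsummable g ->
  zsummable (fun k => f k * g (m - k)).
Proof.
move=> sf [B hB]; apply: (@zsummable_le _ _ f B) => // [k|].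
  rewrite Normc.normcM mulrC ler_wpM2r ?normc_ge0 //.
  by have := hB [:: m - k] isT; rewrite big_seq1.
by have := hB [::] isT; rewrite big_nil.
Qed.

Lemma thspace_mulTheta p M lam F y : normc p < 1 -> p != 0 -> y != 0 ->
  thspace p M lam F ->
  thspace p M.+1 (lam * - y) (fun w => F w * Theta p (y * w)).
Proof.
move=> p1 p0 y0 [a [a1 a2 a3]].
pose b := theta_coef p y.
have hb w n : theta_coef p (y * w) n = b n * w ^ n.
  by rewrite /b /theta_coef expfzMl mulrA.
have sa : zsummable a.
  have := a1 1 (oner_neq0 _); congr zsummable.
  by apply/funext => n; rewrite exp1rz mulr1.
have sb : zsummable b by exact: theta_coef_summable.
pose c m := zsum (fun k => a k * b (m - k)).
have ce w m : w != 0 ->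
    zsum (fun k => (a k * w ^ k) * (theta_coef p (y * w) (m - k))) = c m * w ^ m.
  move=> w0; rewrite [RHS]mulrC -zsumZ; last exact: zsummable_convolution.
  apply: eq_zsum => k; rewrite hb.
  have -> : w ^ m = w ^ (m - k) * w ^ k by rewrite -expfzDr // subrK.
  ring.
exists c; split=> [w w0|w w0|n].
- have yw0 : y * w != 0 by rewrite mulf_neq0.
  have [h1 _] := cauchy_product (a1 w w0) (theta_coef_summable p1 p0 yw0).
  by move: h1; congr zsummable; apply/funext => m; rewrite ce.
- have yw0 : y * w != 0 by rewrite mulf_neq0.
  have [_ h2] := cauchy_product (a1 w w0) (theta_coef_summable p1 p0 yw0).
  rewrite a2 // jacobi_triple_product // -h2.
  by apply: eq_zsum => m; rewrite ce.
- rewrite /c -zsumZ; last exact: zsummable_convolution.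
  (* The shift by M + 1 is shared between the two sequences: M steps go to [a] and one step to [b],
     each through its own recursion. *)
  rewrite -(zsum_shift M%:Z (zsummable_convolution (n + M.+1%:Z) sa sb)).
  apply: eq_zsum => k; rewrite a3.
  have -> : n + M.+1%:Z - (k + M%:Z) = n - k + 1 by lia.
  have -> : p ^ n = p ^ (n - k) * p ^ k by rewrite -expfzDr // subrK.
  by rewrite /b theta_coefS //; ring.
Qed.

Lemma thspace_prod p (I : Type) (r : seq I) (y : I -> R[i]) : normc p < 1 -> p != 0 ->
  (forall i, y i != 0) ->
  thspace p (size r) (\prod_(i <- r) - y i) (fun w => \prod_(i <- r) Theta p (y i * w)).
Proof.
move=> p1 p0 y0; elim: r => [|i r IH].
  by rewrite big_nil; apply: thspace_ext (thspace_one p) => w _; rewrite big_nil.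
rewrite big_cons mulrC; apply: thspace_ext (thspace_mulTheta p1 p0 (y0 i) IH) => w _.
by rewrite big_cons mulrC.
Qed.

(** More functions than coefficients 0, ..., M - 1 leave a combination in which these M coefficients
    vanish; the recursion, run in both directions, then annihilates every coefficient. *)
Lemma thspace_dependent p M lam (I : finType) (F : I -> R[i] -> R[i]) :
  p != 0 -> lam != 0 -> (0 < M < #|I|)%N -> (forall i, thspace p M lam (F i)) ->
  exists c : I -> R[i], (exists i, c i != 0) /\
    forall w, w != 0 -> \sum_i c i * F i w = 0.
Proof.
move=> p0 lam0 /andP[M0 MI] h; have [a ha] := choice h.
pose A : 'M[R[i]]_(#|I|, M) := \matrix_(i, j) a (enum_val i) (j : nat)%:Z.
have /rowV0Pn[v /sub_kermxP vA v0] : kermx A != 0.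
  by rewrite kermx_eq0 -row_leq_rank -ltnNge (leq_ltn_trans (rank_leq_col A)).
exists (fun i => v 0 (enum_rank i)); split.
  have [j vj] : exists j, v 0 j != 0.
    by have /rV0Pn := v0.
  by exists (enum_val j); rewrite enum_valK.
pose b n := \sum_i v 0 (enum_rank i) * a i n.
have bS n : b (n + M%:Z) = lam * p ^ n * b n.
  rewrite /b mulr_sumr; apply: eq_bigr => i _; have [_ _ h3] := ha i; rewrite h3; ring.
have bj (j : 'I_M) : b (j : nat)%:Z = 0.
  have := congr1 (fun X : 'rV_M => X 0 j) vA; rewrite !mxE => h0; rewrite -[RHS]h0.
  rewrite /b (reindex_onto enum_val enum_rank) /=; last by move=> i _; exact: enum_rankK.
  apply: eq_big => [i|i _]; first by rewrite enum_valK eqxx.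
  by rewrite !mxE enum_valK.
have b0 n : b n = 0.
  have hq (q : nat) (j : 'I_M) : b (j%:Z + q%:Z * M%:Z) = 0 /\ b (j%:Z - q%:Z * M%:Z) = 0.
    elim: q => [|q [IH1 IH2]]; first by rewrite mul0r oppr0 !addr0 bj.
    split; first by rewrite -addn1 PoszD mulrDl mul1r addrA bS IH1 mulr0.
    apply/eqP; have : b (j%:Z - q.+1%:Z * M%:Z + M%:Z) = 0.
      by rewrite -IH2; congr b; lia.
    rewrite bS => /eqP; rewrite !mulf_eq0 (negPf lam0) expfz_eq0 (negPf p0) andbF.
    by [].
  have M0' : (M%:Z != 0) by rewrite -lt0n.
  have := divz_eq n M%:Z; have := ltz_mod n M0'; have := modz_ge0 n M0'.
  case: (n %% M)%Z => // r _ rM ->; have {}rM : (r < M)%N by move: rM; lia.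
  have := hq (absz (n %/ M)%Z) (Ordinal rM) => -[h1 h2].
  case: (leP 0 (n %/ M)%Z) => hs.
    by rewrite addrC -[(n %/ M)%Z]gez0_abs.
  rewrite addrC -[(n %/ M)%Z]opprK -[- (n %/ M)%Z]gez0_abs ?oppr_ge0 ?ltW //.
  by rewrite abszN mulNr.
move=> w w0.
have h1 i : zsummable (fun n => a i n * w ^ n) by have [h1 _ _] := ha i; exact: h1.
transitivity (\sum_i zsum (fun n => v 0 (enum_rank i) * (a i n * w ^ n))).
  apply: eq_bigr => i _; rewrite zsumZ //; congr (_ * _).
  by have [_ h2 _] := ha i; exact: h2.
rewrite -(proj2 (zsum_sum _ (fun i => zsummableZ _ (h1 i)))).
apply: zsum0 => n; transitivity (b n * w ^ n); last by rewrite b0 mul0r.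
rewrite mulr_suml.
by apply: eq_bigr => i _; rewrite mulrA.
Qed.

End ThetaFunctions.

Transparent cexp epi.

(** * Roots of unity and periodic sums *)

Section RootsOfUnity.
Variables (R : realType) (N : nat).
Hypothesis N0 : (0 < N)%N.

Let om : R[i] := omega R N.

Lemma natC_neq0 : (N%:R : R[i]) != 0.
Proof. by rewrite pnatr_eq0 -lt0n. Qed.

Lemma omegaE : om = epi (2 / N%:R).
Proof. by []. Qed.

Lemma omega_neq0 : om != 0.
Proof. exact: epi_neq0. Qed.

Lemma epi_omega (k : int) : epi (2 * k%:~R / N%:R) = om ^ k.
Proof. by rewrite /om /omega -epiMz; congr epi; ring. Qed.

Lemma omegaX_N : om ^+ N = 1.
Proof.
rewrite exprnP -epi_omega mulfK ?natC_neq0 //.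
by have := @epi_int2 R 1; rewrite mulr1.
Qed.

Lemma omegaX_neq1 k : (0 < k < N)%N -> om ^+ k != 1.
Proof.
case/andP=> k0 kN; rewrite exprnP -epi_omega.
set t : R := pi * (k%:R / N%:R).
have -> : (2 * (Posz k)%:~R / N%:R : R[i]) = (2 * (k%:R / N%:R))%:C.
  by rewrite !rmorphM fmorphV !rmorph_nat mulrA.
rewrite /epi /cexp; have -> : (0 +i* pi) * (2 * (k%:R / N%:R))%:C = 0 +i* (t *+ 2) :> R[i].
  by apply/eqP; rewrite eq_complex /= /t; apply/andP; split; apply/eqP; ring.
(* The real part of omega^k is cos (2 t) with t = pi k / N; if it were 1 then sin t = 0, impossible
   for 0 < t < pi. *)
rewrite /= expR0; apply/eqP => -[]; rewrite cos_mulr2n => h _.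
have : sin t = 0.
  have {}h : sin t ^+ 2 = 0 by have := cos2Dsin2 t; move: h; lra.
  by apply/eqP; rewrite -sqrf_eq0 h.
apply/eqP; rewrite gt_eqF // sin_gt0_pi //.
have kn : 0 < (k%:R / N%:R : R) < 1.
  by rewrite divr_gt0 ?ltr0n //= ltr_pdivrMr ?ltr0n // mul1r ltr_nat.
by rewrite /t; have := pi_gt0 R; nra.
Qed.

Lemma omega_prim : N.-primitive_root om.
Proof.
apply/andP; split=> //; apply/forallP => i; rewrite unity_rootE.
have := ltn_ord i; rewrite leq_eqVlt => /orP[/eqP e|h].
  by rewrite [X in _ ^+ X]e omegaX_N eqxx e eqxx.
by rewrite (negPf (omegaX_neq1 _)) ?h // (ltn_eqF h).
Qed.

Lemma prod_1sub_omega (u : R[i]) : \prod_(0 <= i < N) (1 - u * om ^+ i) = 1 - u ^+ N.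
Proof.
have [->|u0] := eqVneq u 0.
  rewrite big1 => [|i _]; last by rewrite mul0r subr0.
  by rewrite expr0n eqn0Ngt N0 subr0.
have := congr1 (fun q : {poly R[i]} => q.[u^-1]) (factor_Xn_sub_1 omega_prim).
rewrite horner_prod hornerD hornerN hornerXn hornerC => h.
transitivity (u ^+ N * (u^-1 ^+ N - 1)); last first.
  by rewrite mulrBr mulr1 -exprMn divff // expr1n.
have -> : u ^+ N = \prod_(0 <= i < N) u by rewrite prodr_const_nat subn0.
rewrite -h -big_split /=.
by apply: eq_bigr => i _; rewrite hornerD hornerN hornerX hornerC mulrBr divff.
Qed.

Lemma omegaz_mod (k : int) : (N %| k)%Z -> om ^ k = 1.
Proof. by case/dvdzP => q ->; rewrite mulrC -exprz_exp -exprnP omegaX_N exp1rz. Qed.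

Lemma omegaz_eq1 (k : int) : (om ^ k == 1) = (N %| k)%Z.
Proof.
apply/eqP/idP; last exact: omegaz_mod.
rewrite {1}(divz_eq k N) expfzDr ?omega_neq0 // omegaz_mod ?dvdz_mull // mul1r.
have N0' : (N%:Z != 0) by rewrite -lt0n.
move=> h; apply/dvdz_mod0P; move: h.
have := ltz_mod k N0'; have := modz_ge0 k N0'.
case: (k %% N)%Z => // -[//|r] _ rN h.
by have := @omegaX_neq1 r.+1; rewrite [_ ^+ _]h eqxx /=; move: rN; lia.
Qed.

Lemma sum_omega (k : int) :
  \sum_(a < N) om ^ (a%:Z * k) = if (N %| k)%Z then N%:R else 0.
Proof.
case: ifP => hk.
  rewrite (eq_bigr (fun=> 1)) => [|a _]; last by rewrite omegaz_mod ?dvdz_mull.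
  by rewrite sumr_const card_ord.
have := subrX1 (om ^ k) N; rewrite exprnP exprz_exp mulrC -exprz_exp -[om ^ _]exprnP omegaX_N.
rewrite exp1rz subrr => /esym/eqP; rewrite mulf_eq0 subr_eq0 omegaz_eq1 hk /=.
move=> /eqP {2}<-; apply: eq_bigr => a _.
by rewrite exprnP exprz_exp mulrC.
Qed.

Definition per (f : int -> R[i]) := forall k, f (k + N%:Z) = f k.

Lemma perM f (q : int) k : per f -> f (k + q * N%:Z) = f k.
Proof.
move=> pf; have hn (m : nat) j : f (j + m%:Z * N%:Z) = f j.
  elim: m j => [|m IH] j; first by rewrite mul0r addr0.
  by rewrite -[RHS](IH j) -[RHS]pf -addn1 PoszD mulrDl mul1r addrA.
case: q => m; first exact: hn.
by rewrite -[LHS](hn m.+1) NegzE mulNr subrK.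
Qed.

Lemma per_sum_shift f (j : int) : per f ->
  \sum_(a < N) f (a%:Z + j) = \sum_(a < N) f a%:Z.
Proof.
have h1 g : per g -> \sum_(a < N) g (a%:Z + 1) = \sum_(a < N) g a%:Z.
  move=> pg; rewrite -!(big_mkord xpredT (fun a : nat => g a%:Z)).
  rewrite -(big_mkord xpredT (fun a : nat => g (a%:Z + 1))).
  have : g N%:Z = g 0 by rewrite -(pg 0) add0r.
  elim: N N0 => // n _ _ gn; rewrite big_nat_recr // big_nat_recl //= addrC.
  have e i : i%:Z + 1 = i.+1%:Z by rewrite -addn1 PoszD.
  by rewrite e gn; congr (_ + _); apply: eq_bigr => i _; rewrite e.
have hn (m : nat) g : per g -> \sum_(a < N) g (a%:Z + m%:Z) = \sum_(a < N) g a%:Z.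
  elim: m g => [|m IH] g pg; first by apply: eq_bigr => a _; rewrite addr0.
  rewrite -(IH g pg) -[RHS](h1 (fun k => g (k + m%:Z))); last first.
    by move=> k; rewrite -[RHS]pg addrAC.
  by apply: eq_bigr => a _; rewrite -addn1 PoszD addrAC addrA.
move=> pf; case: j => m; first exact: hn.
have pf' : per (fun k => f (k + Negz m)).
  by move=> k; rewrite -[RHS]pf addrAC.
by rewrite -(hn m.+1 _ pf'); apply: eq_bigr => a _; rewrite NegzE addrK.
Qed.

Lemma per_sum_opp f : per f -> \sum_(a < N) f (- a%:Z) = \sum_(a < N) f a%:Z.
Proof.
move=> pf; rewrite -(per_sum_shift 1 pf) (reindex_inj rev_ord_inj) /=.
apply: eq_bigr => a _; rewrite -(pf (- _)); congr f.
have := ltn_ord a; lia.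
Qed.

End RootsOfUnity.

(** * Finite Fourier duality of the theta quotients [Wt] *)

Opaque epi cexp.

(** The odd theta function in the additive variable, a constant multiple of vartheta[1/2, 1/2]; the
    factor [epi (- x)] makes it odd. *)
Definition thetaT (R : realType) (tau x : R[i]) : R[i] :=
  epi (- x) * Theta (epi (2 * tau)) (epi (2 * x)).

(** x lies outside the lattice Z + tau Z of zeros of [thetaT]. *)
Definition offlattice (R : realType) (tau x : R[i]) : Prop :=
  forall k : int, epi (2 * x) != epi (2 * tau) ^ k.

Definition tors (R : realType) (N : nat) (tau z : R[i]) (a b : int) : R[i] :=
  (z + a%:~R * tau + b%:~R) / N%:R.

(** The coefficients W of the R-matrix (see [WcoefE]) with integer indices. The exponential
    compensates the quasi-period of the theta quotient, so that they are periodic modulo N in a as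
    well as in b. *)
Definition Wt (R : realType) (N : nat) (tau : R[i]) (a b : int) (xi zeta : R[i]) : R[i] :=
  N%:R^-1 * epi (2 * a%:~R * xi / N%:R) *
  (thetaT tau (xi + tors N tau zeta a b) / thetaT tau (tors N tau zeta a b)).

Lemma thetaTE (R : realType) (tau x : R[i]) :
  thetaT tau x = epi (- x) * Theta (epi (2 * tau)) (epi (2 * x)).
Proof. by []. Qed.

Lemma torsE (R : realType) (N : nat) (tau z : R[i]) (a b : int) :
  tors N tau z a b = (z + a%:~R * tau + b%:~R) / N%:R.
Proof. by []. Qed.

Lemma WtE (R : realType) (N : nat) (tau : R[i]) (a b : int) (xi zeta : R[i]) :
  Wt N tau a b xi zeta = N%:R^-1 * epi (2 * a%:~R * xi / N%:R) *
  (thetaT tau (xi + tors N tau zeta a b) / thetaT tau (tors N tau zeta a b)).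
Proof. by []. Qed.

Section ThetaT.
Variables (R : realType) (tau : R[i]).
Let p : R[i] := epi (2 * tau).
Hypothesis p1 : normc p < 1.
Let p0 : p != 0 := epi_neq0 _.
Local Notation T := (thetaT tau).
Local Notation off := (offlattice tau).

Lemma expz_p_eq1 (k : int) : p ^ k = 1 -> k = 0.
Proof.
have h n : p ^+ n.+1 <> 1 by apply/eqP/pow_neq1.
by case: k => [[//|n] /h|n /eqP] //; rewrite invr_eq1 => /eqP/h.
Qed.

Lemma thetaTN x : T (- x) = - T x.
Proof.
rewrite /thetaT opprK mulrN !epiN ThetaV ?epi_neq0 //.
have -> : epi (2 * x) = epi x * epi x by rewrite -epiD -mulr2n mulr_natl.
by field; rewrite epi_neq0.
Qed.

Lemma thetaT0 : T 0 = 0.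
Proof. by rewrite /thetaT mulr0 epi0 Theta1 ?mulr0. Qed.

Lemma thetaTD1 x : T (x + 1) = - T x.
Proof.
rewrite /thetaT mulrDr epiD -[2 * 1](_ : 2 * 1%:~R = _) // epi_int2 mulr1.
by rewrite opprD epiD !epiN epi1 invrN1; ring.
Qed.

Lemma thetaTDtau x : T (x + tau) = - epi (- 2 * x - tau) * T x.
Proof.
rewrite /thetaT mulrDr [X in Theta _ X]epiD [X in Theta _ X]mulrC.
rewrite Theta_mulp ?epi_neq0 // opprD !epiD mulNr !epiN.
have -> : epi (2 * x) = epi x * epi x by rewrite -epiD -mulr2n mulr_natl.
by ring.
Qed.

Lemma thetaT_neq0 x : off x -> T x != 0.
Proof. by move=> h; rewrite mulf_neq0 ?epi_neq0 // Theta_neq0 ?epi_neq0. Qed.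

Lemma offlatticeD1 x : off x -> off (x + 1).
Proof.
by move=> h k; rewrite mulrDr epiD -[2 * 1](_ : 2 * 1%:~R = _) // epi_int2 mulr1.
Qed.

Lemma offlatticeDtau x : off x -> off (x + tau).
Proof.
move=> h k; rewrite mulrDr epiD; apply: contraNneq (h (k - 1)) => e.
apply/eqP/(mulIf p0); rewrite e.
by rewrite -{1}[k](subrK 1) expfzDr // expr1z.
Qed.

Lemma offlatticeN x : off x -> off (- x).
Proof.
move=> h k; rewrite mulrN epiN; apply: contraNneq (h (- k)) => e.
by rewrite -[epi _]invrK e -invr_expz.
Qed.

Variable N : nat.
Hypothesis N2 : (2 <= N)%N.
Let N0 : (0 < N)%N := ltnW N2.
Let NC : (N%:R : R[i]) != 0 := natC_neq0 R N0.
Let om : R[i] := omega R N.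
Local Notation eta := (tors N tau).
Local Notation W := (Wt N tau).

Lemma offlattice_eta z a b : off z -> off (eta z a b).
Proof.
move=> h k; apply: contraNneq (h (k * N%:Z - a)) => e.
have : epi (2 * eta z a b) ^+ N = (p ^ k) ^+ N by rewrite e.
rewrite -epiMn /tors exprnP exprz_exp.
have -> : N%:R * (2 * ((z + a%:~R * tau + b%:~R) / N%:R)) =
    2 * z + a%:~R * (2 * tau) + 2 * b%:~R :> R[i].
  by rewrite mulrCA [N%:R * _]mulrC mulfVK //; ring.
rewrite !epiD epi_int2 mulr1 epiMz => e1.
apply/eqP/(mulIf (expfz_neq0 a p0)).
by rewrite e1 -expfzDr // subrK.
Qed.

Lemma etaD1 z a b : eta (z + 1) a b = eta z a (b + 1).
Proof. by rewrite /tors intrD; congr (_ / _); ring. Qed.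

Lemma etaDtau z a b : eta (z + tau) a b = eta z (a + 1) b.
Proof. by rewrite /tors intrD; congr (_ / _); ring. Qed.

Lemma eta_perl z a b : eta z (a + N%:Z) b = eta z a b + tau.
Proof.
rewrite /tors intrD; apply: (mulIf NC); rewrite mulfVK // [RHS]mulrDl mulfVK //; ring.
Qed.

Lemma eta_perr z a b : eta z a (b + N%:Z) = eta z a b + 1.
Proof.
rewrite /tors intrD; apply: (mulIf NC); rewrite mulfVK // [RHS]mulrDl mulfVK //; ring.
Qed.

Lemma etaN z a b : eta (- z) (- a) (- b) = - eta z a b.
Proof. by rewrite /tors !intrN; ring. Qed.

Lemma Wt_perl a b xi zeta : W (a + N%:Z) b xi zeta = W a b xi zeta.
Proof.
rewrite /Wt eta_perl addrA !thetaTDtau !mulNr invrN (mulrN _ (_^-1)) opprK invfM intrD.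
have -> : 2 * (a%:~R + N%:Z%:~R) * xi / N%:R = 2 * a%:~R * xi / N%:R + 2 * xi :> R[i].
  by rewrite -[N%:Z%:~R]/(N%:R); field.
have -> : - (2 * (xi + eta zeta a b)) - tau = - (2 * xi) + (- (2 * eta zeta a b) - tau).
  by ring.
rewrite epiD [epi (- (2 * xi) + _)]epiD epiN.
set A := epi (2 * xi); set B := epi (- (2 * eta _ _ _) - _).
have A0 : A != 0 by exact: epi_neq0. have B0 : B != 0 by exact: epi_neq0.
move: (thetaT _ _) (thetaT _ _)^-1 => u v.
by field; rewrite ?A0 ?B0 ?NC.
Qed.

Lemma Wt_perr a b xi zeta : W a (b + N%:Z) xi zeta = W a b xi zeta.
Proof. by rewrite /Wt eta_perr addrA !thetaTD1 invrN mulrNN. Qed.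

Lemma Wt_opp a b xi zeta : W (- a) (- b) (- xi) (- zeta) = W a b xi zeta.
Proof.
rewrite /Wt etaN -opprD !thetaTN invrN mulrNN; congr (_ * epi _ * _).
by rewrite intrN; ring.
Qed.

Lemma Wt_xiD1 a b xi zeta : W a b (xi + 1) zeta = - om ^ a * W a b xi zeta.
Proof.
rewrite /Wt addrAC thetaTD1 -epi_omega mulrDr mulr1 mulrDl epiD /=; ring.
Qed.

Lemma Wt_xiDtau a b xi zeta : W a b (xi + tau) zeta =
  - epi (- (2 * xi) - 2 * zeta / N%:R - tau) * om ^ (- b) * W a b xi zeta.
Proof.
rewrite /Wt addrAC thetaTDtau mulNr -epi_omega mulrDr mulrDl epiD /=.
have -> : epi (- (2 * (xi + eta zeta a b)) - tau) =
    epi (- (2 * xi) - 2 * zeta / N%:R - tau) * epi (2 * (- b)%:~R / N%:R) *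
    epi (- (2 * a%:~R * tau / N%:R)) :> R[i].
  by rewrite -!epiD /tors intrN; congr epi; ring.
rewrite epiN; move: (thetaT tau (eta zeta a b))^-1 => v.
by field; rewrite ?epi_neq0 ?NC.
Qed.

Lemma Wt_xi0 a b zeta : off zeta -> W a b 0 zeta = N%:R^-1.
Proof.
move=> h; rewrite /Wt mulr0 mul0r epi0 mulr1 add0r divff ?mulr1 //.
exact/thetaT_neq0/offlattice_eta.
Qed.

Lemma Wt_zetaD1 a b xi zeta : W a b xi (zeta + 1) = W a (b + 1) xi zeta.
Proof. by rewrite /Wt etaD1. Qed.

Lemma Wt_zetaDtau a b xi zeta :
  W a b xi (zeta + tau) = epi (- (2 * xi / N%:R)) * W (a + 1) b xi zeta.
Proof.
rewrite /Wt etaDtau epiN.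
have -> : epi (2 * (a + 1)%:~R * xi / N%:R) =
    epi (2 * a%:~R * xi / N%:R) * epi (2 * xi / N%:R) :> R[i].
  by rewrite -epiD intrD; congr epi; ring.
move: (thetaT tau (eta zeta (a + 1) b))^-1 => v.
by field; rewrite ?epi_neq0 ?NC.
Qed.

End ThetaT.

Opaque qpoch limC.

Lemma cvgc_prod (R : realType) (I : Type) (s : seq I) (F : I -> nat -> R[i]) (G : I -> R[i]) :
  (forall i, cvgc (F i) (G i)) ->
  cvgc (fun n => \prod_(i <- s) F i n) (\prod_(i <- s) G i).
Proof.
move=> h; elim: s => [|i s IH].
  by rewrite big_nil; apply: eq_cvgc (cvgc_cst _) => n; rewrite big_nil.
by rewrite big_cons; apply: eq_cvgc (cvgcM (h i) IH) => n; rewrite big_cons.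
Qed.

Lemma cvgc_subseq (R : realType) (u : nat -> R[i]) l (g : nat -> nat) :
  cvgc u l -> (forall n, n <= g n)%N -> cvgc (u \o g) l.
Proof.
move=> [c1 c2] hg.
have gi : (g @ \oo --> \oo)%classic.
  by move=> A [M _ hM]; exists M => // n /= Mn; apply/hM/(leq_trans Mn)/hg.
by split; [exact: cvg_comp gi c1|exact: cvg_comp gi c2].
Qed.

Section Isogeny.
Variables (R : realType) (tau : R[i]).
Let p : R[i] := epi (2 * tau).
Hypothesis p1 : normc p < 1.
Let p0 : p != 0 := epi_neq0 _.
Variable N : nat.
Hypothesis N2 : (2 <= N)%N.
Let N0 : (0 < N)%N := ltnW N2.
Let NC : (N%:R : R[i]) != 0 := natC_neq0 R N0.
Let om : R[i] := omega R N.
Let s : R[i] := epi (2 * tau / N%:R).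
Local Notation eta := (tors N tau).

Lemma rootp : s ^+ N = p.
Proof. by rewrite /s -epiMn mulrC mulfVK. Qed.

Lemma epi_eta0 (a b : nat) : epi (2 * eta 0 a b) = s ^+ a * om ^+ b.
Proof.
rewrite -!epiMn -epiD /tors; congr epi; rewrite /omega add0r.
by rewrite -[a%:~R]/(a%:R) -[b%:~R]/(b%:R); field.
Qed.

(** Write the exponent of p as n N + i. The factor 1 - x^N p^(n N + i) is 1 minus the N-th power of
    x s^i p^n, where s^N = p, and it splits over the N-th roots of unity. *)
Lemma qpoch_isogeny x :
  qpoch (x ^+ N) p = \prod_(i < N) \prod_(j < N) qpoch (x * (s ^+ i * om ^+ j)) p.
Proof.
have h := @cvgc_subseq _ _ _ (fun n => n * N)%N (qpoch_cvgc (x ^+ N) p1)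
  (fun n => leq_pmulr n N0).
apply: cvgc_uniq h _.
apply: (@eq_cvgc _ (fun n => \prod_(i < N) \prod_(j < N)
    \prod_(0 <= m < n) (1 - x * (s ^+ i * om ^+ j) * p ^+ m))); last first.
  by do 2!apply: cvgc_prod => ?; exact: qpoch_cvgc.
elim=> [|n IH] /=.
  by rewrite mul0n big_geq // !big1 // => i _; rewrite big1 // => j _; rewrite big_geq.
rewrite mulSn addnC big_nat_addn /= -[X in _ = X * _]IH.
transitivity (\prod_(i < N) ((\prod_(j < N) \prod_(0 <= m < n) (1 - x * (s ^+ i * om ^+ j) * p ^+ m))
   * \prod_(j < N) (1 - (x * s ^+ i * p ^+ n) * om ^+ j))).
  apply: eq_bigr => i _; rewrite -big_split /=; apply: eq_bigr => j _.
  by rewrite big_nat_recr //=; congr (_ * (1 - _)); ring.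
rewrite big_split /=; congr (_ * _).
rewrite big_mkord; apply: eq_bigr => i _.
rewrite -(big_mkord xpredT (fun j => 1 - x * s ^+ i * p ^+ n * om ^+ j)) prod_1sub_omega //.
congr (1 - _); rewrite [(x * _ * _) ^+ N]exprMn [(x * _) ^+ N]exprMn.
rewrite [(s ^+ i) ^+ N]exprAC rootp -mulrA; congr (_ * _).
by rewrite -exprM -exprD addnC.
Qed.

(** Pull-back along multiplication by N: the zeros of u |-> Theta (u^N) are the N^2 torsion points.
    This turns theta functions of xi into theta functions of order N^2 in xi / N. *)
Lemma Theta_isogeny : exists2 kap : R[i], kap != 0 & forall u : R[i], u != 0 ->
  Theta p (u ^+ N) = kap * \prod_(b : 'I_N * 'I_N) Theta p (epi (2 * eta 0 b.1 b.2) * u).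
Proof.
set Q := qpoch p p; have Q0 : Q != 0 by exact: qpochpp_neq0.
exists (Q / \prod_(i < N) \prod_(j < N) Q).
  rewrite mulf_neq0 // invr_eq0; apply/prodf_neq0 => i _; exact/prodf_neq0.
move=> u u0.
have -> : \prod_(b : 'I_N * 'I_N) Theta p (epi (2 * eta 0 b.1 b.2) * u) =
   \prod_(i < N) \prod_(j < N) Theta p (u * (s ^+ i * om ^+ j)).
  by rewrite pair_bigA /=; apply: eq_bigr => b _; rewrite epi_eta0 mulrC.
have om0 : om != 0 by exact: omega_neq0.
have s0 : s != 0 by exact: epi_neq0.
have e2 : qpoch (p / u ^+ N) p =
    \prod_(i < N) \prod_(j < N) qpoch (p / (u * (s ^+ i * om ^+ j))) p.
  have -> : p / u ^+ N = (s * om / u) ^+ N.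
    by rewrite [(s * om / u) ^+ N]exprMn [(s * om) ^+ N]exprMn rootp omegaX_N // mulr1 exprVn.
  (* p / u^N is the N-th power of s om / u, which gives the numerators s^(i+1) om^(j+1); reversing
     both indices turns them into p / (s^i om^j). *)
  have prod_rev (F : 'I_N -> R[i]) : \prod_(j < N) F j = \prod_(j < N) F (rev_ord j).
    exact: (reindex_inj rev_ord_inj).
  rewrite qpoch_isogeny prod_rev; apply: eq_bigr => i _.
  rewrite [LHS]prod_rev.
  apply: eq_bigr => j _.
  apply: (f_equal (fun x => qpoch x p)).
  rewrite -[nat_of_ord (rev_ord i)]/(N - i.+1)%N -[nat_of_ord (rev_ord j)]/(N - j.+1)%N.
  have hs : s * s ^+ (N - i.+1) = p / s ^+ i.
    by apply: (mulIf (expf_neq0 i s0)); rewrite mulfVK ?expf_neq0 // -exprS -exprD -rootp;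
       congr (_ ^+ _); have := ltn_ord i; lia.
  have ho : om * om ^+ (N - j.+1) = (om ^+ j)^-1.
    apply: (mulIf (expf_neq0 j om0)); rewrite mulVf ?expf_neq0 // -exprS -exprD.
    by rewrite -(omegaX_N R N0); congr (_ ^+ _); have := ltn_ord j; lia.
  transitivity ((s * s ^+ (N - i.+1)) * (om * om ^+ (N - j.+1)) / u); first by ring.
  by rewrite hs ho !invfM; ring.
rewrite /Theta qpoch_isogeny e2 -/Q.
have big3 (f g h : 'I_N -> 'I_N -> R[i]) :
    \prod_(i < N) \prod_(j < N) (f i j * g i j * h i j) =
    (\prod_(i < N) \prod_(j < N) f i j) * (\prod_(i < N) \prod_(j < N) g i j) *
    (\prod_(i < N) \prod_(j < N) h i j).
  by rewrite -!big_split /=; apply: eq_bigr => i _; rewrite !big_split.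
rewrite big3.
set A := \prod_(i < N) \prod_(j < N) Q.
have A0 : A != 0 by apply/prodf_neq0 => i _; exact/prodf_neq0.
by field.
Qed.

End Isogeny.

Lemma dvdz_ord_sub (N : nat) (i j : 'I_N) :
  (N %| (i : nat)%:Z - (j : nat)%:Z)%Z = (i == j).
Proof.
apply/idP/eqP => [/dvdzP[q e]|->]; last by rewrite subrr dvdz0.
have hi := ltn_ord i; have hj := ltn_ord j; apply: val_inj => /=.
have q0 : q = 0 by nia.
by move: e; rewrite q0; lia.
Qed.

Lemma int_residue (N : nat) (N0 : (0 < N)%N) (a : int) :
  exists (c : 'I_N) (q : int), a = (c : nat)%:Z + q * N%:Z.
Proof.
have N0' : (N%:Z != 0) by rewrite -lt0n.
have := divz_eq a N%:Z; have := ltz_mod a N0'; have := modz_ge0 a N0'.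
case: (a %% N)%Z => // r _ rN e; have rN' : (r < N)%N by move: rN; lia.
by exists (Ordinal rN'), (a %/ N)%Z; rewrite addrC; exact: e.
Qed.

(** * Sums and symplectic Fourier transform over (Z/N)^2 *)

Section DoubleSums.
Variables (R : realType) (N : nat).
Hypothesis N2 : (2 <= N)%N.
Let N0 : (0 < N)%N := ltnW N2.
Let NC : (N%:R : R[i]) != 0 := natC_neq0 R N0.
Let om : R[i] := omega R N.

(** Functions on (Z/N)^2 are encoded as periodic functions of two integers, so that shifts and signs
    of indices are ordinary integer arithmetic. *)
Definition per2 (f : int -> int -> R[i]) :=
  (forall a b, f (a + N%:Z) b = f a b) /\ (forall a b, f a (b + N%:Z) = f a b).

Definition zsum2 (f : int -> int -> R[i]) : R[i] :=
  \sum_(b : 'I_N * 'I_N) f (b.1 : nat)%:Z (b.2 : nat)%:Z.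

Lemma zsum2E f : zsum2 f = \sum_(i < N) \sum_(j < N) f (i : nat)%:Z (j : nat)%:Z.
Proof. by rewrite pair_bigA. Qed.

Lemma eq_zsum2 f g : (forall a b, f a b = g a b) -> zsum2 f = zsum2 g.
Proof. by move=> h; apply: eq_bigr. Qed.

Lemma zsum2_shift f j k : per2 f -> zsum2 (fun a b => f (a + j) (b + k)) = zsum2 f.
Proof.
case=> p1 p2; rewrite !zsum2E.
rewrite (per_sum_shift N0 j (f := fun a => \sum_(i < N) f a (i%:Z + k))); last first.
  by move=> a; apply: eq_bigr => i _; rewrite p1.
by apply: eq_bigr => i _; rewrite (per_sum_shift N0 k (f := f i%:Z)).
Qed.

Lemma zsum2_opp f : per2 f -> zsum2 (fun a b => f (- a) (- b)) = zsum2 f.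
Proof.
case=> p1 p2; rewrite !zsum2E.
rewrite (per_sum_opp N0 (f := fun a => \sum_(i < N) f a (- i%:Z))); last first.
  by move=> a; apply: eq_bigr => i _; rewrite p1.
by apply: eq_bigr => i _; rewrite (per_sum_opp N0 (f := f i%:Z)).
Qed.

Lemma zsum2Zl c f : zsum2 (fun a b => c * f a b) = c * zsum2 f.
Proof. by rewrite /zsum2 mulr_sumr. Qed.

Lemma zsum2_exchange (F : int -> int -> int -> int -> R[i]) :
  zsum2 (fun a b => zsum2 (F a b)) = zsum2 (fun c d => zsum2 (fun a b => F a b c d)).
Proof. by rewrite /zsum2 exchange_big. Qed.

Lemma zsum2_omega (k l : int) : zsum2 (fun a b => om ^ (a * k + b * l)) =
  if (N %| k)%Z && (N %| l)%Z then (N * N)%:R else 0.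
Proof.
rewrite zsum2E (eq_bigr (fun i : 'I_N => om ^ (i%:Z * k) * \sum_(j < N) om ^ (j%:Z * l))).
  rewrite -mulr_suml !(sum_omega R N0).
  by case: (N %| k)%Z; case: (N %| l)%Z; rewrite /= ?mulr0 ?mul0r // natrM.
by move=> i _; rewrite mulr_sumr; apply: eq_bigr => j _; rewrite expfzDr ?omega_neq0.
Qed.

(** With the antisymmetric pairing the transform is its own inverse up to N^2, by orthogonality of
    characters. *)
Lemma zsum2_dft f c d (c0 : 'I_N) (d0 : 'I_N) : c = (c0 : nat)%:Z -> d = (d0 : nat)%:Z ->
  zsum2 (fun a b => om ^ (a * d - b * c) * zsum2 (fun i j => om ^ (i * b - j * a) * f i j)) =
  (N * N)%:R * f c d.
Proof.
move=> -> ->.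
transitivity (zsum2 (fun a b => zsum2 (fun i j =>
    om ^ (a * (d0 : nat)%:Z - b * (c0 : nat)%:Z) * (om ^ (i * b - j * a) * f i j)))).
  by apply: eq_zsum2 => a b; rewrite zsum2Zl.
rewrite zsum2_exchange /zsum2 (bigD1 (c0, d0)) //= [X in _ + X]big1 ?addr0.
  rewrite (eq_bigr (fun=> f c0 d0)) ?sumr_const ?card_prod ?card_ord ?mulr_natl //.
  move=> i _; rewrite mulrA -expfzDr ?omega_neq0 // (_ : _ + _ = 0) ?expr0z ?mul1r //; ring.
move=> [i j] /= hij.
transitivity (zsum2 (fun a b => f i j * om ^ (a * ((d0 : nat)%:Z - (j : nat)%:Z) + b * ((i : nat)%:Z - (c0 : nat)%:Z)))).
  apply: eq_bigr => b _; rewrite mulrA -expfzDr ?omega_neq0 // mulrC; congr (_ * om ^ _); ring.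
rewrite zsum2Zl zsum2_omega !dvdz_ord_sub; case: ifP => [/andP[/eqP ej /eqP ei]|]; last by rewrite mulr0.
by rewrite ej ei eqxx in hij.
Qed.

End DoubleSums.

Section Duality.
Variables (R : realType) (tau : R[i]).
Let p : R[i] := epi (2 * tau).
Hypothesis p1 : normc p < 1.
Let p0 : p != 0 := epi_neq0 _.
Variable N : nat.
Hypothesis N2 : (2 <= N)%N.
Let N0 : (0 < N)%N := ltnW N2.
Let NC : (N%:R : R[i]) != 0 := natC_neq0 R N0.
Let om : R[i] := omega R N.
Local Notation eta := (tors N tau).
Local Notation W := (Wt N tau).
Local Notation T := (thetaT tau).
Local Notation off := (offlattice tau).
Local Notation zsum2 := (@zsum2 R N).
Let B := ('I_N * 'I_N)%type.
Let rr (b : B) : R[i] := epi (2 * eta 0 b.1 b.2).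
Let z0 : B := (Ordinal N0, Ordinal N0).

(** At xi = 0 every coefficient is 1/N, and each period multiplies by a character of (a, b). These
    values are the equations that determine the coefficients of the linear relation in
    [sum_Wt_propto]. *)
Lemma Wt_lattice (zeta : R[i]) (m n : nat) : off zeta ->
  exists2 mu : R[i], mu != 0 & forall a b : int,
    W a b (m%:R + n%:R * tau) zeta = mu * om ^ (m%:Z * a - n%:Z * b).
Proof.
move=> oz; elim: m => [|m [mu mu0 IH]].
  elim: n => [|n [mu mu0 IH]].
    exists N%:R^-1; first by rewrite invr_eq0.
    by move=> a b; rewrite mul0r add0r Wt_xi0 // !mul0r subr0 expr0z mulr1.
  exists (- epi (- (2 * (0%:R + n%:R * tau)) - 2 * zeta / N%:R - tau) * mu).
    by rewrite mulf_neq0 // oppr_eq0 epi_neq0.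
  move=> a b; rewrite -natr1 mulrDl mul1r addrA Wt_xiDtau // IH.
  have -> : 0%:Z * a - n.+1%:Z * b = (- b) + (0%:Z * a - n%:Z * b) by lia.
  by rewrite [om ^ (- b + _)]expfzDr ?omega_neq0 //; ring.
exists (- mu); first by rewrite oppr_eq0.
move=> a b; rewrite -natr1 addrAC Wt_xiD1 // IH.
have -> : m.+1%:Z * a - n%:Z * b = a + (m%:Z * a - n%:Z * b) by lia.
by rewrite [om ^ (a + _)]expfzDr ?omega_neq0 //; ring.
Qed.

Lemma thspace_prodB (y : B -> R[i]) : (forall b, y b != 0) ->
  thspace p (N * N)%N (\prod_b - y b) (fun w => \prod_b Theta p (y b * w)).
Proof.
move=> y0; have := @thspace_prod _ p B (index_enum B) y p1 p0 y0.
have -> // : size (index_enum B) = (N * N)%N.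
by rewrite -[index_enum B]enumT -cardE card_prod !card_ord.
Qed.

(** Shifts of the N^2 theta factors of a function G: the factors of [Theta_isogeny], with the one
    vanishing at the origin replaced by one vanishing at -zeta. Up to constants and an exponential,
    G is T xi times W_00 (zeta, xi) as a function of xi / N, and it vanishes at every nontrivial
    torsion point. *)
Let yG zeta (b : B) : R[i] := if b == z0 then epi (2 * zeta) else rr b.

Lemma rr0 : rr z0 = 1.
Proof. by rewrite /rr /tors /= mul0r !addr0 mul0r mulr0 epi0. Qed.

Let lam zeta := epi (2 * zeta) * \prod_b - rr b.

Lemma prod_yG zeta (F : R[i] -> R[i]) :
  \prod_b F (yG zeta b) = F (epi (2 * zeta)) * \prod_(b | b != z0) F (rr b).
Proof.
rewrite (bigD1 z0) //= /yG eqxx; congr (_ * _); apply: eq_bigr => b /negPf.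
by move=> ->.
Qed.

Lemma thspace_G zeta :
  thspace p (N * N)%N (lam zeta) (fun w => \prod_b Theta p (yG zeta b * w)).
Proof.
have := @thspace_prodB (yG zeta); rewrite (prod_yG zeta (fun y => - y)) /lam.
have -> : \prod_b - rr b = - \prod_(b | b != z0) - rr b.
  by rewrite (bigD1 z0) //= rr0 mulN1r.
rewrite mulNr -mulrN; apply.
by move=> b; rewrite /yG; case: ifP => _; exact: epi_neq0.
Qed.

(** With xi = N x the prefactor of W becomes an integral power of w = e^{2 i pi x}, and the isogeny
    writes the theta function as N^2 factors. The multiplier [lam zeta] is then the same for all b,
    and the same as that of G. *)
Lemma thspace_W zeta (b : B) : off zeta -> exists G : R[i] -> R[i],
  thspace p (N * N)%N (lam zeta) G /\
  forall x, G (epi (2 * x)) = epi (N%:R * x) * W b.1 b.2 (N%:R * x) zeta.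
Proof.
move=> oz; have [kap kap0 hk] := Theta_isogeny p1 N2.
set h := eta zeta b.1 b.2.
pose c := N%:R^-1 * epi (- h) * kap / T h.
pose y b' := epi (2 * (h / N%:R)) * rr b'.
exists (fun w => c * (w ^ (b.1 : nat)%:Z * \prod_b' Theta p (y b' * w))); split.
  apply: thspace_scale; have := @thspace_prodB y.
  move=> /(_ (fun b' => mulf_neq0 (epi_neq0 _) (epi_neq0 _))).
  move=> /(thspace_mulX (b.1 : nat)%:Z p0).
  congr thspace; rewrite /lam.
  have -> : \prod_b' - y b' = epi (2 * (h / N%:R)) ^+ (N * N)%N * \prod_b' - rr b'.
    rewrite /y (eq_bigr (fun b' => epi (2 * (h / N%:R)) * - rr b')) => [|i _]; last by rewrite mulrN.
    by rewrite big_split /= prodr_const card_prod !card_ord.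
  rewrite mulrAC; congr (_ * _); rewrite -epiMn -epiMz -epiD.
  rewrite -[RHS]mulr1 -[X in _ = _ * X](epi_int2 _ (b.2 : nat)%:Z) -epiD; congr epi.
  rewrite natrM /h /tors.
  rewrite mulrNz -[(b.1 : nat)%:Z%:~R]/((b.1 : nat)%:R).
  by field.
move=> x.
have -> : epi (N%:R * x) * W b.1 b.2 (N%:R * x) zeta =
   N%:R^-1 * epi (- h) * (T h)^-1 * (epi (2 * x) ^ (b.1 : nat)%:Z *
   Theta p (epi (2 * (x + h / N%:R)) ^+ N)).
  rewrite /Wt -/h {1}/thetaT opprD [epi (- _ + _)]epiD epiN -epiMz.
  have -> : 2 * (b.1 : nat)%:Z%:~R * (N%:R * x) / N%:R = (b.1 : nat)%:Z%:~R * (2 * x) :> R[i].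
    by field.
  have -> : epi (2 * (N%:R * x + h)) = epi (2 * (x + h / N%:R)) ^+ N :> R[i].
    by rewrite -epiMn; congr epi; field.
  have := epi_neq0 (N%:R * x); move: (T h)^-1 (epi (- h)) => v u e0.
  by field; rewrite NC e0.
rewrite hk ?epi_neq0 // /c.
have -> : \prod_(b0 : 'I_N * 'I_N) Theta p (epi (2 * eta 0 b0.1 b0.2) * epi (2 * (x + h / N%:R))) =
  \prod_b' Theta p (y b' * epi (2 * x)).
  by apply: eq_bigr => b' _; rewrite /y mulrDr epiD; congr Theta; rewrite /rr; ring.
ring.
Qed.


(** Negation modulo N; the carry [e] decides whether a factor of G is evaluated at 1 or at p, both
    being zeros of Theta. *)
Lemma ord_opp (i : 'I_N) : exists (j : 'I_N) (e : bool),
  (j + i = e * N)%N /\ (j == Ordinal N0 -> i == Ordinal N0).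
Proof.
have [i0|i0] := posnP i.
  by exists (Ordinal N0), false; split=> [|_]; [rewrite /= i0|apply/eqP/val_inj].
have h : (N - i < N)%N by have := ltn_ord i; lia.
exists (Ordinal h), true; split; first by rewrite /=; have := ltn_ord i; lia.
by move/eqP/(congr1 val)/eqP; rewrite /= subn_eq0 leqNgt ltn_ord.
Qed.

Lemma vanish_G zeta (a : B) : a != z0 ->
  \prod_b Theta p (yG zeta b * epi (2 * (((a.1 : nat)%:R + (a.2 : nat)%:R * tau) / N%:R))) = 0.
Proof.
case: a => a1 a2 /= a0.
have [b1 [e1 [h1 k1]]] := ord_opp a2; have [b2 [e2 [h2 k2]]] := ord_opp a1.
have b0 : (b1, b2) != z0.
  apply: contraNneq a0 => -[/eqP/k1/eqP -> /eqP/k2/eqP ->]; exact: eqxx.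
rewrite (bigD1 (b1, b2)) //= /yG (negPf b0) /rr -epiD /tors /=.
set x := (X in epi X).
have -> : x = e1%:R * (2 * tau) + 2 * e2%:Z%:~R.
  have {}h1 : (b1 : nat)%:R + (a2 : nat)%:R = e1%:R * N%:R :> R[i] by rewrite -natrD h1 natrM.
  have {}h2 : (b2 : nat)%:R + (a1 : nat)%:R = e2%:R * N%:R :> R[i] by rewrite -natrD h2 natrM.
  rewrite /x -[(b1 : nat)%:Z%:~R]/((b1 : nat)%:R) -[(b2 : nat)%:Z%:~R]/((b2 : nat)%:R).
  rewrite -[e2%:Z%:~R]/(e2%:R); apply: (mulIf NC).
  transitivity (2 * (((b1 : nat)%:R + (a2 : nat)%:R) * tau + ((b2 : nat)%:R + (a1 : nat)%:R)) : R[i]).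
    by field.
  by rewrite h1 h2; ring.
rewrite epiD epi_int2 mulr1 epiMn; case: e1 {h1 x} => /=.
  by rewrite expr1 Theta_p ?mul0r.
by rewrite expr0 Theta1 ?mul0r.
Qed.

(** The N^2 functions W_b and G lie in a space of dimension at most N^2, so they satisfy a linear
    relation. At nontrivial torsion points G vanishes and the W_b become characters; hence the
    Fourier transform of the coefficients of the W_b is supported at the origin, and these
    coefficients are all equal. *)
Lemma sum_Wt_propto zeta : off zeta -> exists k : R[i], forall xi, off xi ->
  N%:R * T xi * W 0 0 zeta xi = k * zsum2 (fun a b => W a b xi zeta).
Proof.
move=> oz; have [kap kap0 hk] := Theta_isogeny p1 N2.
have [V hV] := choice (fun b : B => thspace_W b oz).
pose G w := \prod_b Theta p (yG zeta b * w).
have lam0 : lam zeta != 0.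
  rewrite mulf_neq0 ?epi_neq0 //; apply/prodf_neq0 => b _.
  by rewrite oppr_eq0 epi_neq0.

have [||c' [cne hc]] := @thspace_dependent _ p (N * N)%N (lam zeta) (B + 'I_1)%type
  (fun o => match o with inl b => V b | inr _ => G end) p0 lam0.
- by rewrite card_sum card_prod !card_ord addn1 ltnS leqnn andbT muln_gt0 N0.
- by case=> [b|_]; [exact: proj1 (hV b)|exact: thspace_G].
pose c b := c' (inl b); pose cG := c' (inr ord0).
have key x : \sum_(b : B) c b * (epi (N%:R * x) * W b.1 b.2 (N%:R * x) zeta) +
    cG * G (epi (2 * x)) = 0.
  rewrite -[RHS](hc _ (epi_neq0 (2 * x))) big_sumType /= big_ord1; congr (_ + _).
  by apply: eq_bigr => b _; rewrite (proj2 (hV b)).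
have S0 (a : B) : a != z0 ->
    \sum_(b : B) c b * om ^ ((a.1 : nat)%:Z * (b.1 : nat)%:Z - (a.2 : nat)%:Z * (b.2 : nat)%:Z) = 0.
  move=> a0; have [mu mu0 hmu] := @Wt_lattice zeta a.1 a.2 oz.
  have := key (((a.1 : nat)%:R + (a.2 : nat)%:R * tau) / N%:R).
  rewrite /G vanish_G // mulr0 addr0 [N%:R * _]mulrC mulfVK //.
  move=> h; apply: (mulfI (mulf_neq0 (epi_neq0 ((a.1 : nat)%:R + (a.2 : nat)%:R * tau)) mu0)).
  rewrite mulr0 -[RHS]h mulr_sumr; apply: eq_bigr => b _; rewrite hmu; ring.
pose c0 := (\sum_b c b) / (N * N)%:R.
have NN0 : (N * N)%:R != 0 :> R[i] by rewrite natrM mulf_neq0.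
pose ph (a b : B) : int := (a.1 : nat)%:Z * (b.1 : nat)%:Z - (a.2 : nat)%:Z * (b.2 : nat)%:Z.
have ph0 b : ph z0 b = 0 by rewrite /ph /z0 /= !mul0r subrr.
have orth b b' : \sum_a om ^ (ph a b - ph a b') = if b == b' then (N * N)%:R else 0.
  transitivity (zsum2 (fun i j => om ^ (i * ((b.1 : nat)%:Z - (b'.1 : nat)%:Z) +
      j * ((b'.2 : nat)%:Z - (b.2 : nat)%:Z)))).
    by apply: eq_bigr => a _; congr (om ^ _); rewrite /ph; ring.
  rewrite zsum2_omega // !dvdz_ord_sub //.
  by case: b b' => [b1 b2] [b1' b2'] /=; rewrite xpair_eqE [b2' == _]eq_sym.
(* Fourier inversion, in which only the term at [z0] survives by [S0]. *)
have cE b : c b = c0.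
  apply: (mulfI NN0); rewrite /c0 [RHS]mulrC mulfVK //.
  transitivity (\sum_a om ^ (- ph a b) * \sum_b' c b' * om ^ (ph a b')); last first.
    transitivity (om ^ (- ph z0 b) * \sum_b' c b' * om ^ (ph z0 b')).
      rewrite (bigD1 z0) //= [X in _ + X]big1 ?addr0 // => a a0.
      by rewrite S0 ?mulr0.
    rewrite ph0 oppr0 expr0z mul1r; apply: eq_bigr => b' _.
    by rewrite mulr1.
  transitivity (\sum_b' c b' * \sum_a om ^ (ph a b' - ph a b)).
    rewrite [RHS](bigD1 b) //= orth eqxx [X in _ + X]big1 ?addr0; first exact: mulrC.
    by move=> b' /negPf bb'; rewrite orth bb' mulr0.
  under eq_bigr do rewrite mulr_sumr.
  rewrite exchange_big /=; apply: eq_bigr => a _; rewrite mulr_sumr.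
  by apply: eq_bigr => b' _; rewrite expfzDr ?omega_neq0 //; ring.
have key2 x : c0 * epi (N%:R * x) * zsum2 (fun a b => W a b (N%:R * x) zeta) +
    cG * G (epi (2 * x)) = 0.
  rewrite -[RHS](key x) /zsum2 mulr_sumr; congr (_ + _).
  by apply: eq_bigr => b _; rewrite cE; ring.
(* Otherwise the relation at x = 0, where the W_b sum to N, forces [c0] = 0 and the relation is
   trivial. *)
have cG0 : cG != 0.
  apply/eqP => cG0; have c00 : c0 = 0.
    have := key2 0; rewrite cG0 mul0r addr0 mulr0 epi0 mulr1 => /eqP.
    rewrite mulf_eq0 => /orP[/eqP//|]; rewrite /zsum2.
    rewrite (eq_bigr (fun=> N%:R^-1)) => [|b _]; last by rewrite Wt_xi0.
    rewrite sumr_const card_prod !card_ord -[_ *+ _]mulr_natl natrM mulfK // => /eqP h.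
    by move: NC; rewrite h eqxx.
  case: cne => -[b|j] /eqP; first by rewrite -/(c b) cE c00.
  by rewrite (ord1 j) -/cG cG0.
exists (- (kap * epi (- zeta) * c0 / cG)) => xi ox.
set x := xi / N%:R.
have xN : N%:R * x = xi by rewrite mulrC mulfVK.
have eta0 : eta xi 0 0 = x by rewrite /tors mul0r !addr0.
have := key2 x; rewrite xN => hG.
have Th0 : Theta p (epi (2 * x)) != 0.
  rewrite -eta0; have /(thetaT_neq0 p1) := offlattice_eta N2 0 0 ox.
  by rewrite mulf_eq0 negb_or => /andP[].
have GE : G (epi (2 * x)) = Theta p (epi (2 * zeta) * epi (2 * x)) *
    \prod_(b | b != z0) Theta p (rr b * epi (2 * x)).
  by rewrite /G (prod_yG zeta (fun y => Theta p (y * epi (2 * x)))).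
have TE : T xi = epi (- xi) * (kap * (Theta p (epi (2 * x)) *
    \prod_(b | b != z0) Theta p (rr b * epi (2 * x)))).
  rewrite /thetaT; have -> : epi (2 * xi) = epi (2 * x) ^+ N.
    by rewrite -epiMn; congr epi; rewrite mulrCA xN.
  rewrite hk ?epi_neq0 //; congr (_ * (_ * _)).
  by rewrite (bigD1 z0) //= -/(rr z0) rr0 mul1r.
have G2 : G (epi (2 * x)) = - (c0 * epi xi * zsum2 (fun a b => W a b xi zeta)) / cG.
  apply: (mulIf cG0); rewrite mulfVK // mulrC; apply/eqP.
  by rewrite -addr_eq0 addrC hG.
transitivity (epi (- xi) * kap * epi (- zeta) * G (epi (2 * x))).
  rewrite TE GE /Wt eta0 mulr0 !mul0r epi0 mulr1 /thetaT opprD mulrDr.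
  rewrite [epi (- zeta + _)]epiD [epi (2 * zeta + _)]epiD.
  have := epi_neq0 (- x).
  move: (epi (- x)) (\prod_(b | _) _) => e P e0.
  by field; rewrite NC Th0 e0.
rewrite G2 epiN; have := epi_neq0 xi; move: (epi xi) => e e0.
by field; rewrite e0 cG0.
Qed.

End Duality.

Opaque Wt thetaT tors omega Theta.

Section Duality2.
Variables (R : realType) (tau : R[i]).
Let p : R[i] := epi (2 * tau).
Hypothesis p1 : normc p < 1.
Let p0 : p != 0 := epi_neq0 _.
Variable N : nat.
Hypothesis N2 : (2 <= N)%N.
Let N0 : (0 < N)%N := ltnW N2.
Let NC : (N%:R : R[i]) != 0 := natC_neq0 R N0.
Let om : R[i] := omega R N.
Let om0 : om != 0 := omega_neq0 R N.
Local Notation eta := (tors N tau).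
Local Notation W := (Wt N tau).
Local Notation T := (thetaT tau).
Local Notation off := (offlattice tau).
Local Notation zsum2 := (@zsum2 R N).

Lemma per2_Wt xi zeta : per2 N (fun a b => W a b xi zeta).
Proof. by split=> a b; [exact: Wt_perl|exact: Wt_perr]. Qed.

Lemma omega_addN (x k : int) : om ^ (x + N%:Z * k) = om ^ x.
Proof. by rewrite expfzDr // [om ^ (N%:Z * k)]omegaz_mod ?mulr1 // dvdz_mulr. Qed.

Lemma per2_eq (f g : int -> int -> R[i]) : per2 N f -> per2 N g ->
  (forall c d : 'I_N, f (c : nat)%:Z (d : nat)%:Z = g (c : nat)%:Z (d : nat)%:Z) ->
  forall a b, f a b = g a b.
Proof.
move=> [f1 f2] [g1 g2] h a b.
have [c [q ->]] := int_residue N0 a; have [d [r ->]] := int_residue N0 b.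
by rewrite !(@perM _ N (fun a => _ a _)) // ?(@perM _ N (f _)) ?(@perM _ N (g _)) // => k.
Qed.

(** The case a = b = 0 is [sum_Wt_propto]. Moving xi by 1 or by tau raises b or a on the left and
    inserts the matching character on the right. Applying the transform twice at xi = zeta
    identifies k up to sign, which is enough for the sums below, quadratic in W. *)
Lemma Wt_dual zeta : off zeta -> exists k : R[i], k ^+ 2 = T zeta ^+ 2 /\
  forall a b xi, off xi -> N%:R * T xi * W a b zeta xi =
    k * zsum2 (fun i j => om ^ (i * b - j * a) * W i j xi zeta).
Proof.
move=> oz; have [k hk] := sum_Wt_propto p1 N2 oz.
have hn (a b : nat) xi : off xi -> N%:R * T xi * W a b zeta xi =
    k * zsum2 (fun i j => om ^ (i * b%:Z - j * a%:Z) * W i j xi zeta).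
  elim: a b xi => [|a IHa].
    elim=> [|b IHb] xi ox.
      rewrite hk //; congr (_ * _); apply: eq_zsum2 => i j.
      by rewrite !mulr0 subr0 expr0z mul1r.
    have := IHb _ (offlatticeD1 ox); rewrite thetaTD1 Wt_zetaD1 => h.
    apply: oppr_inj; rewrite -[b.+1]addn1 PoszD -mulNr -mulrN h -mulrN; congr (_ * _).
    rewrite /zsum2 -sumrN; apply: eq_bigr => i _; rewrite Wt_xiD1.
    have e (x : int) y : x * (b%:Z + 1) - y = x * b%:Z - y + x by ring.
    by rewrite e [om ^ (_ - _ + _)]expfzDr // -/om; ring.
  move=> b xi ox; have := IHa b _ (offlatticeDtau ox).
  rewrite (thetaTDtau p1) (Wt_zetaDtau _ N2) => h.
  pose m := - epi (- (2 * xi) - 2 * zeta / N%:R - tau).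
  have m0 : m != 0 by rewrite oppr_eq0 epi_neq0.
  apply: (mulfI m0); rewrite mulrCA [RHS]mulrCA -(zsum2Zl N m).
  have em : m = - epi (-2 * xi - tau) * epi (- (2 * zeta / N%:R)).
    by rewrite /m [RHS]mulNr -epiD; congr (- epi _); ring.
  rewrite {1}em; transitivity (N%:R * (- epi (-2 * xi - tau) * T xi) *
    (epi (- (2 * zeta / N%:R)) * W (a%:Z + 1) b zeta xi)).
    have -> : a%:Z + 1 = a.+1%:Z by lia.
    by ring.
  rewrite h; congr (_ * _); apply: eq_zsum2 => i j; rewrite (Wt_xiDtau p1 N2) -/om -/m.
  have -> : i * b%:Z - j * a.+1%:Z = i * b%:Z - j * a%:Z - j by lia.
  by rewrite [om ^ (_ - j)]expfzDr //; ring.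
have hk2 a b xi : off xi -> N%:R * T xi * W a b zeta xi =
    k * zsum2 (fun i j => om ^ (i * b - j * a) * W i j xi zeta).
  move=> ox; apply: (@per2_eq (fun a b => N%:R * T xi * W a b zeta xi)
    (fun a b => k * zsum2 (fun i j => om ^ (i * b - j * a) * W i j xi zeta))).
  - by have [h1 h2] := per2_Wt zeta xi; split=> c d; rewrite ?h1 ?h2.
  - split=> c d; congr (_ * _); apply: eq_zsum2 => i j; congr (_ * _).
      by rewrite -(omega_addN (i * d - j * c) (- j)); congr (om ^ _); ring.
    by rewrite -(omega_addN (i * d - j * c) i); congr (om ^ _); ring.
  - by move=> c d; exact: hn.
exists k; split=> //.

(* If d = 0 and d = 1 both gave zero, the two theta arguments would be lattice points differing by
   1/N, making omega a power of p; but omega has finite order and |p| < 1. *)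
have wne : exists d : 'I_N, W 0 (d : nat) zeta zeta != 0.
  have N1 : (1 < N)%N by [].
  have h1 (d : nat) : W 0 d zeta zeta = 0 -> exists l : int,
      epi (2 * (zeta + eta zeta 0 d)) = p ^ l.
    move=> h0; apply/not_existsP => h.
    have h2 : T (zeta + eta zeta 0 d) != 0 by apply: (thetaT_neq0 p1) => l; apply/eqP.
    have h3 := thetaT_neq0 p1 (offlattice_eta N2 0 d oz).
    have /eqP := mulf_neq0 (mulf_neq0 (invr_neq0 NC) (epi_neq0 (2 * 0%:~R * zeta / N%:R)))
      (mulf_neq0 h2 (invr_neq0 h3)).
    exact.
  have [/h1 [l hl]|w0] := eqVneq (W 0 0%N zeta zeta) 0; last by exists (Ordinal N0); exact: w0.
  have [/h1 [m hm]|w1] := eqVneq (W 0 1%N zeta zeta) 0; last by exists (Ordinal N1); exact: w1.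
  have e : om = p ^ (m - l).
    apply: (mulIf (expfz_neq0 l p0)); rewrite -expfzDr // subrK -hm -hl /om omegaE -epiD.
    by congr epi; rewrite !torsE !mul0r !addr0; field.
  have : om ^+ N = 1 by exact: omegaX_N.
  rewrite e exprnP exprz_exp => /(expz_p_eq1 p1) /eqP; rewrite mulf_eq0.
  case/orP => [/eqP h0|/eqP]; last by lia.
  by have := @omegaX_neq1 R N N0 1 N1; rewrite expr1 -/om e h0 expr0z eqxx.
have [d wd] := wne.
have := @zsum2_dft R N N2 (fun i j => W i j zeta zeta) _ _ (Ordinal N0) d erefl erefl.
rewrite /= => hd.
have NN0 : (N * N)%:R != 0 :> R[i] by rewrite natrM mulf_neq0.
apply: (mulIf wd); apply: (mulfI NN0).
transitivity (k * (k * ((N * N)%:R * W 0 d zeta zeta))); first by ring.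
rewrite -hd -(zsum2Zl N k).
transitivity (k * (N%:R * T zeta * zsum2 (fun a b => om ^ (a * (d : nat)%:Z - b * 0) * W a b zeta zeta))).
  congr (_ * _); rewrite -zsum2Zl; apply: eq_zsum2 => a b.
  rewrite mulrCA -hk2 //; ring.
rewrite mulrCA -hk2 // natrM; ring.
Qed.

(* Fourier inversion of [Wt_dual] *)
Lemma Wt_dual_inv zeta k : (forall a b xi, off xi -> N%:R * T xi * W a b zeta xi =
    k * zsum2 (fun i j => om ^ (i * b - j * a) * W i j xi zeta)) ->
  forall c d xi, off xi ->
  k * N%:R * W c d xi zeta = T xi * zsum2 (fun a b => om ^ (a * d - b * c) * W a b zeta xi).
Proof.
move=> hk c d xi ox; apply: (@per2_eq (fun c d => k * N%:R * W c d xi zeta)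
  (fun c d => T xi * zsum2 (fun a b => om ^ (a * d - b * c) * W a b zeta xi))).
- by have [h1 h2] := per2_Wt xi zeta; split=> a b; rewrite ?h1 ?h2.
- split=> a b; congr (_ * _); apply: eq_zsum2 => i j; congr (_ * _).
    by rewrite -(omega_addN (i * b - j * a) (- j)); congr (om ^ _); ring.
  by rewrite -(omega_addN (i * b - j * a) i); congr (om ^ _); ring.
move=> {}c {}d; apply: (mulfI NC).
transitivity (k * ((N * N)%:R * W (c : nat) (d : nat) xi zeta)); first by rewrite natrM; ring.
have := @zsum2_dft R N N2 (fun i j => W i j xi zeta) _ _ c d erefl erefl => <-.
rewrite -!zsum2Zl; apply: eq_zsum2 => a b.
by rewrite mulrCA -hk //; ring.
Qed.

Lemma tors_addN xi zeta a b : eta (xi + N%:R * zeta) a b = eta xi a b + zeta.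
Proof. by rewrite !torsE; field. Qed.

(** Expanding the second factor by duality and summing over a, b transforms the first one too. The
    sum becomes one of W_{i,j} (zeta, -xi') W_{-i,-j} (zeta, xi), whose theta quotients are
    reciprocal because [eta (xi + N zeta)] is [eta xi] moved by zeta ([tors_addN]). Only a character
    sum is left. *)
Lemma crossing_sum xi zeta c d : off zeta -> off xi -> off (xi + N%:R * zeta) ->
  zsum2 (fun a b => W a b xi zeta * W (a - c) (b - d) (- (xi + N%:R * zeta)) zeta) =
  if (N %| c)%Z && (N %| d)%Z then - (T xi * T (xi + N%:R * zeta)) / T zeta ^+ 2 else 0.
Proof.
move=> oz ox; set xi' := xi + _ => ox'; have [k [k2 hk]] := Wt_dual oz.
have Tz : T zeta != 0 by exact: thetaT_neq0.
have k0 : k != 0 by rewrite -sqrf_eq0 k2 expf_neq0.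
have hi := Wt_dual_inv hk.
apply: (mulfI (expf_neq0 2 k0)); apply: (mulfI NC).
transitivity (zsum2 (fun a b => zsum2 (fun i j => k * T (- xi') * W i j zeta (- xi') *
    om ^ (j * c - i * d) * (om ^ (a * - j - b * - i) * W a b xi zeta)))).
  rewrite -!zsum2Zl; apply: eq_zsum2 => a b.
  transitivity (k * W a b xi zeta * (k * N%:R * W (a - c) (b - d) (- xi') zeta)).
    by move: (W a b _ _) (W (a - c) _ _ _) => w1 w2; ring.
  rewrite hi; last exact: offlatticeN.
  rewrite -!zsum2Zl; apply: eq_zsum2 => i j.
  have -> : i * (b - d) - j * (a - c) = (j * c - i * d) + (a * - j - b * - i) by ring.
  by rewrite [om ^ (_ + _)]expfzDr //; ring.
rewrite zsum2_exchange.
transitivity (zsum2 (fun i j => N%:R * T (- xi') * T xi * N%:R^-1 ^+ 2 * om ^ (i * - d + j * c))).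
  apply: eq_zsum2 => i j; rewrite zsum2Zl.
  transitivity (T (- xi') * W i j zeta (- xi') * om ^ (j * c - i * d) *
    (k * zsum2 (fun a b => om ^ (a * - j - b * - i) * W a b xi zeta))); first by ring.
  rewrite -hk //.
  have -> : i * - d + j * c = j * c - i * d by ring.
  have h1 : T (eta xi (- i) (- j)) != 0 by exact/thetaT_neq0/offlattice_eta.
  have h2 : T (zeta + eta xi (- i) (- j)) != 0.
    by rewrite addrC -tors_addN; exact/thetaT_neq0/offlattice_eta.
  have -> : W i j zeta (- xi') = N%:R^-1 * (epi (2 * i%:~R * zeta / N%:R)) *
      (T (eta xi (- i) (- j)) / T (zeta + eta xi (- i) (- j))).
    rewrite !WtE; have -> : eta (- xi') i j = - (zeta + eta xi (- i) (- j)).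
      by rewrite -(opprK i) -(opprK j) etaN tors_addN !opprK addrC.
    by rewrite opprD addNKr -opprD !thetaTN // invrN mulrNN.
  have -> : W (- i) (- j) zeta xi = N%:R^-1 * (epi (2 * i%:~R * zeta / N%:R))^-1 *
      (T (zeta + eta xi (- i) (- j)) / T (eta xi (- i) (- j))).
    by rewrite !WtE -epiN; congr (_ * epi _ * _); rewrite mulrNz; ring.
  have := epi_neq0 (2 * i%:~R * zeta / N%:R); move: (epi _) => e e0.
  by field; rewrite NC h1 h2 e0.
rewrite zsum2Zl zsum2_omega // rpredN andbC k2 thetaTN //.
case: ifP => _; last by rewrite !mulr0.
by rewrite natrM; field; rewrite NC Tz.
Qed.

(** The coefficient of the (c, d) basis matrix in the product of the sums for R_12 (z) and R_21
    (z^-1). *)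
Definition unitarity_coef (c d : int) (xi zeta : R[i]) : R[i] :=
  zsum2 (fun a b => om ^ (a * d - b * c) * (W a b xi zeta * W (a - c) (b - d) (- xi) zeta)).

(** Both factors are traded by duality. The sign, which comes from the oddness of T, forces the
    coefficient to vanish at xi = zeta. *)
Lemma unitarity_coef_sym c d xi zeta : off zeta -> off xi ->
  T zeta ^+ 2 * unitarity_coef c d xi zeta = - T xi ^+ 2 * unitarity_coef c d zeta xi.
Proof.
move=> oz ox; have [k [k2 hk]] := Wt_dual oz.
have hi := Wt_dual_inv hk.
rewrite -k2; apply: (mulfI NC).
transitivity (zsum2 (fun a b => zsum2 (fun i j => k * T (- xi) * W i j zeta (- xi) *
    om ^ (j * c - i * d) * (om ^ (a * (d - j) - b * (c - i)) * W a b xi zeta)))).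
  rewrite /unitarity_coef -!zsum2Zl; apply: eq_zsum2 => a b.
  transitivity (k * W a b xi zeta * om ^ (a * d - b * c) *
    (k * N%:R * W (a - c) (b - d) (- xi) zeta)).
    by move: (W a b _ _) (W (a - c) _ _ _) (om ^ _) => w1 w2 w3; ring.
  rewrite hi; last exact: offlatticeN.
  rewrite -!zsum2Zl; apply: eq_zsum2 => i j.
  have e : (a * d - b * c) + (i * (b - d) - j * (a - c)) =
      (j * c - i * d) + (a * (d - j) - b * (c - i)) by ring.
  have {}e : om ^ (a * d - b * c) * om ^ (i * (b - d) - j * (a - c)) =
      om ^ (j * c - i * d) * om ^ (a * (d - j) - b * (c - i)).
    by rewrite -!(expfzDr _ _ om0) e.
  transitivity (k * T (- xi) * W a b xi zeta * W i j zeta (- xi) *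
    (om ^ (a * d - b * c) * om ^ (i * (b - d) - j * (a - c)))); first by ring.
  by rewrite e; ring.
rewrite zsum2_exchange.
transitivity (zsum2 (fun i j => - N%:R * T xi ^+ 2 * (om ^ (j * c - i * d) *
   (W (c - i) (d - j) zeta xi * W i j zeta (- xi))))).
  apply: eq_zsum2 => i j; rewrite zsum2Zl.
  transitivity (T (- xi) * W i j zeta (- xi) * om ^ (j * c - i * d) *
    (k * zsum2 (fun a b => om ^ (a * (d - j) - b * (c - i)) * W a b xi zeta))); first by ring.
  by rewrite -hk // thetaTN //; ring.
rewrite zsum2Zl; transitivity (- N%:R * T xi ^+ 2 * unitarity_coef c d zeta xi).
  congr (_ * _).
  have [h1 h2] := per2_Wt zeta xi; have [h3 h4] := per2_Wt zeta (- xi).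
  pose f (i j : int) := om ^ (j * c - i * d) * (W (c - i) (d - j) zeta xi * W i j zeta (- xi)).
  have pf : per2 N f.
    split=> i j; rewrite /f.
      have -> : j * c - (i + N%:Z) * d = (j * c - i * d) + N%:Z * - d by ring.
      have e : c - (i + N%:Z) + N%:Z = c - i by ring.
      by rewrite omega_addN h3 -(h1 (c - (i + N%:Z))) e.
    have -> : (j + N%:Z) * c - i * d = (j * c - i * d) + N%:Z * c by ring.
    have e : d - (j + N%:Z) + N%:Z = d - j by ring.
    by rewrite omega_addN h4 -(h2 _ (d - (j + N%:Z))) e.
  rewrite -[LHS](zsum2_shift N2 c d pf).
  have pf' : per2 N (fun a b => f (a + c) (b + d)).
    case: pf => q1 q2; split=> a b; first by rewrite -[RHS]q1 addrAC.
    by rewrite -[RHS]q2 addrAC.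
  rewrite -(zsum2_opp N2 pf'); apply: eq_zsum2 => a b; rewrite /f.
  have -> : W (- a + c) (- b + d) zeta (- xi) = W (a - c) (b - d) (- zeta) xi.
    rewrite -(Wt_opp p1 N (- a + c) (- b + d) zeta (- xi)) opprK.
    have -> : - (- a + c) = a - c by ring.
    by have -> : - (- b + d) = b - d by ring.
  have -> : c - (- a + c) = a by ring.
  have -> : d - (- b + d) = b by ring.
  by have -> : (- b + d) * c - (- a + c) * d = a * d - b * c by ring.
by ring.
Qed.

(** The multiplier depends on the sum of the two shifts and not on u, so products with different u
    share one space of order two. *)
Lemma thetaT_pair_space (r : R[i]) u : exists G : R[i] -> R[i],
  thspace p 2 (epi (2 * r)) G /\
  forall x, T (x + u) * T (x + r - u) = epi (- (2 * x) - r) * G (epi (2 * x)).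
Proof.
exists (fun w => \prod_(y <- [:: epi (2 * u); epi (2 * (r - u))]) Theta p (y * w)); split.
  have := @thspace_prod _ p bool [:: true; false]
    (fun b => if b then epi (2 * u) else epi (2 * (r - u))) p1 p0.
  have h (b : bool) : (if b then epi (2 * u) else epi (2 * (r - u))) != 0 :> R[i].
    by case: b; exact: epi_neq0.
  move=> /(_ h); rewrite !big_cons big_nil mulr1 mulrNN -epiD.
  have -> : 2 * u + 2 * (r - u) = 2 * r by ring.
  by apply: thspace_ext => w _; rewrite !big_cons !big_nil.
move=> x; rewrite !big_cons big_nil mulr1 !thetaTE.
have -> : epi (- (2 * x) - r) = epi (- (x + u)) * epi (- (x + r - u)).
  by rewrite -epiD; congr epi; ring.
have -> : epi (2 * u) * epi (2 * x) = epi (2 * (x + u)).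
  by rewrite -epiD; congr epi; ring.
have -> : epi (2 * (r - u)) * epi (2 * x) = epi (2 * (x + r - u)).
  by rewrite -epiD; congr epi; ring.
by ring.
Qed.

(** No N-torsion translate of this point is on the lattice: the N-th power of the corresponding
    exponential is -p^a, which is not an integral power of p. *)
Let x0 : R[i] := 1 / (2 * N%:R).

Lemma off_x0 c d : off x0 /\ T (x0 + eta 0 c d) != 0.
Proof.
have N2C : (2 * N%:R : R[i]) != 0 by rewrite mulf_neq0 // pnatr_eq0.
have m1 : (-1 : R[i]) != 1 by rewrite eq_sym -subr_eq0 opprK -(natrD _ 1 1) pnatr_eq0.
have main (a b : int) : off (x0 + eta 0 a b).
  move=> k; apply/eqP => h.
  have h2 : epi (2 * (x0 + eta 0 a b)) ^+ N = - p ^ a.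
    rewrite -epiMn; have -> : N%:R * (2 * (x0 + eta 0 a b)) =
        1 + a%:~R * (2 * tau) + 2 * b%:~R :> R[i] by rewrite /x0 !torsE; field.
    by rewrite !epiD epi_int2 epi1 epiMz mulr1 mulN1r.
  rewrite h exprnP exprz_exp in h2.
  have h3 : p ^ (k * N%:Z - a) = -1.
    by apply: (mulIf (expfz_neq0 a p0)); rewrite -expfzDr // subrK h2 mulN1r.
  have h4 : p ^ (2 * (k * N%:Z - a)) = 1.
    by rewrite mulrC -exprz_exp h3 -exprnP sqrrN expr1n.
  have /(expz_p_eq1 p1)/eqP := h4; rewrite mulf_eq0 => /orP[//|/eqP h5].
  by move: h3 m1; rewrite h5 expr0z => <-; rewrite eqxx.
split; last exact/thetaT_neq0/main.
by have := main 0 0; rewrite !torsE !mul0r !addr0 mul0r addr0.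
Qed.

(* The functions of this shape span a two-dimensional space, in which those
   vanishing at [0] form a line. *)
Lemma thetaT_pairs_at0 (I : finType) (m u : I -> R[i]) c d u0 :
  let r := eta 0 c d in
  \sum_i m i * (T (u i) * T (r - u i)) = 0 -> T u0 != 0 -> T (r - u0) != 0 ->
  exists kap, forall x,
    \sum_i m i * (T (x + u i) * T (x + r - u i)) = kap * (T x * T (x + r)).
Proof.
move=> r F0 Tu0 Tru0.
have [V hV] := choice (fun i : I => thetaT_pair_space r (u i)).
have [G [hG1 hG2]] := thetaT_pair_space r 0; have [H [hH1 hH2]] := thetaT_pair_space r u0.
pose F w := \sum_i m i * V i w.
have hF : thspace p 2 (epi (2 * r)) F.
  by apply: thspace_sum => i; apply: thspace_scale; case: (hV i).
have Fx x : \sum_i m i * (T (x + u i) * T (x + r - u i)) =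
    epi (- (2 * x) - r) * F (epi (2 * x)).
  by rewrite /F mulr_sumr; apply: eq_bigr => i _; rewrite (proj2 (hV i)); ring.
have [||f [fne hf]] := @thspace_dependent _ p 2 (epi (2 * r)) 'I_3
  (fun i => if i == ord0 then F else if i == 1 then G else H) p0 (epi_neq0 _).
- by rewrite card_ord.
- by move=> i; case: ifP => _ //; case: ifP.
have key x : f 0 * (\sum_i m i * (T (x + u i) * T (x + r - u i))) +
    f 1 * (T x * T (x + r)) + f 2%:R * (T (x + u0) * T (x + r - u0)) = 0.
  have := hf _ (epi_neq0 (2 * x)); rewrite !big_ord_recl big_ord0 /= => h.
  have := hG2 x; rewrite addr0 subr0 => ->; rewrite Fx hH2.
  rewrite -[RHS](mulr0 (epi (- (2 * x) - r))) -[X in _ = _ * X]h.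
  have -> : lift ord0 ord0 = 1 :> 'I_3 by apply: val_inj.
  have -> : lift ord0 (lift ord0 ord0) = 2%:R :> 'I_3 by apply: val_inj.
  have -> : 0 = ord0 :> 'I_3 by apply: val_inj.
  by ring.
have f2 : f 2%:R = 0.
  have := key 0; rewrite thetaT0 // mul0r mulr0 addr0.
  have -> : \sum_i m i * (T (0 + u i) * T (0 + r - u i)) = 0.
    by rewrite -[RHS]F0; apply: eq_bigr => i _; rewrite !add0r.
  rewrite mulr0 !add0r => /eqP; rewrite mulf_eq0 (negPf (mulf_neq0 Tu0 Tru0)) orbF.
  by move/eqP.
have [ox0 Tx0] := off_x0 c d.
have f0 : f 0 != 0.
  apply/eqP => f0; have := key x0; rewrite f0 f2 !mul0r add0r addr0 => /eqP.
  rewrite mulf_eq0 (negPf (mulf_neq0 (thetaT_neq0 p1 ox0) Tx0)) orbF => /eqP f1.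
  case: fne => i /eqP; apply.
  case: i => [[|[|[|i]]] hi] //; [rewrite -f0|rewrite -f1|rewrite -f2];
    congr f; exact: val_inj.
exists (- f 1 / f 0) => x; apply: (mulfI f0); have := key x; rewrite f2 mul0r addr0.
by move/eqP; rewrite addr_eq0 => /eqP ->; field.
Qed.

End Duality2.

(** * Unitarity and scalar factors *)

Section Unitarity.
Variables (R : realType) (tau : R[i]).
Let p : R[i] := epi (2 * tau).
Hypothesis p1 : normc p < 1.
Variable N : nat.
Hypothesis N2 : (2 <= N)%N.
Let N0 : (0 < N)%N := ltnW N2.
Let NC : (N%:R : R[i]) != 0 := natC_neq0 R N0.
Let om : R[i] := omega R N.
Let om0 : om != 0 := omega_neq0 R N.
Local Notation eta := (tors N tau).
Local Notation W := (Wt N tau).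
Local Notation T := (thetaT tau).
Local Notation off := (offlattice tau).
Local Notation zsum2 := (@zsum2 R N).
Local Notation C := (unitarity_coef tau N).

Lemma unitarity_coef_diag c d zeta : off zeta -> C c d zeta zeta = 0.
Proof.
move=> oz; have := unitarity_coef_sym p1 N2 c d oz oz.
rewrite mulNr => /eqP; rewrite -addr_eq0 -mulr2n mulrn_eq0 /= mulf_eq0.
by rewrite (negPf (expf_neq0 2 (thetaT_neq0 p1 oz))) => /eqP.
Qed.

(* The factor depending on [xi] alone is split off from the products of thetas. *)
Lemma unitarity_coefE c d zeta : exists m : 'I_N * 'I_N -> R[i], forall xi,
  C c d xi zeta = epi (2 * c%:~R * xi / N%:R) *
    \sum_b m b * (T (xi + eta zeta b.1 b.2) * T (xi + eta 0 c d - eta zeta b.1 b.2)).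
Proof.
exists (fun b : 'I_N * 'I_N => - om ^ ((b.1 : nat)%:Z * d - (b.2 : nat)%:Z * c) * N%:R^-1 ^+ 2 /
  (T (eta zeta b.1 b.2) * T (eta zeta ((b.1 : nat)%:Z - c) ((b.2 : nat)%:Z - d)))).
move=> xi; rewrite /unitarity_coef /zsum2 mulr_sumr; apply: eq_bigr => b _.
rewrite !WtE; set h := eta zeta b.1 b.2; set h' := eta zeta (_ - c) _.
have -> : xi + eta 0 c d - h = - (- xi + h').
  by rewrite /h /h' !torsE !intrB; field.
rewrite (thetaTN p1) [(T h * T h')^-1]invfM.
have -> : epi (2 * c%:~R * xi / N%:R) = epi (2 * (b.1 : nat)%:Z%:~R * xi / N%:R) *
    epi (2 * ((b.1 : nat)%:Z - c)%:~R * - xi / N%:R).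
  by rewrite -epiD intrB; congr epi; ring.
move: (T h)^-1 (T h')^-1 => u u'; rewrite -/om; ring.
Qed.

Lemma unitarity_coef_at0 c d zeta : off zeta -> C c d 0 zeta =
  if (N %| c)%Z && (N %| d)%Z then 1 else 0.
Proof.
move=> oz; transitivity (zsum2 (fun a b => N%:R^-1 ^+ 2 * om ^ (a * d + b * - c))).
  apply: eq_zsum2 => a b; rewrite oppr0 !(Wt_xi0 p1 N2) // mulrN -/om; ring.
rewrite zsum2Zl (zsum2_omega _ N2) rpredN andbC.
by case: ifP => _; [rewrite natrM; field|rewrite mulr0].
Qed.

Lemma unitarity_coef_propto c d zeta : off zeta -> ~~ ((N %| c)%Z && (N %| d)%Z) ->
  exists kap, forall xi,
  C c d xi zeta = kap * (epi (2 * c%:~R * xi / N%:R) * (T xi * T (xi + eta 0 c d))).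
Proof.
move=> oz hcd; have [m hm] := unitarity_coefE c d zeta.
have h0 := unitarity_coef_at0 c d oz; rewrite (negPf hcd) hm mulr0 mul0r epi0 mul1r in h0.
have [||kap hk] := @thetaT_pairs_at0 R tau p1 N N2 _ m (fun b => eta zeta b.1 b.2) c d
  (eta zeta 0 0) _ (thetaT_neq0 p1 (offlattice_eta N2 _ _ oz)).
- by rewrite -[RHS]h0; apply: eq_bigr => b _; rewrite !add0r.
- have -> : eta 0 c d - eta zeta 0 0 = eta (- zeta) c d by rewrite !torsE; ring.
  exact/(thetaT_neq0 p1)/(offlattice_eta N2)/offlatticeN.
by exists kap => xi; rewrite hm hk; ring.
Qed.

(** The constant of [unitarity_coef_propto] is found to be 0 at xi = zeta. When zeta + eta 0 c d is
    itself a zero of T this evaluation says nothing; then the symmetry is used at the pair (x0,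
    zeta), where one side vanishes for this very reason. *)
Lemma unitarity_sum_neq0 c d xi zeta : off zeta -> ~~ ((N %| c)%Z && (N %| d)%Z) ->
  C c d xi zeta = 0.
Proof.
move=> oz hcd; have [kap hk] := unitarity_coef_propto oz hcd.
have Tz := thetaT_neq0 p1 oz.
suff k0 : kap = 0 by rewrite hk k0 mul0r.
have [Tr|Tr] := eqVneq (T (zeta + eta 0 c d)) 0; last first.
  have := hk zeta; rewrite unitarity_coef_diag // => /esym/eqP.
  rewrite mulf_eq0 => /orP[/eqP//|].
  by rewrite (negPf (mulf_neq0 (epi_neq0 _) (mulf_neq0 Tz Tr))).
pose x0 : R[i] := 1 / (2 * N%:R).
have [ox0 Tx0] := off_x0 p1 N2 c d.
have [kap' hk'] := unitarity_coef_propto ox0 hcd.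
have := unitarity_coef_sym p1 N2 c d oz ox0; rewrite hk hk' Tr !mulr0 => /eqP.
rewrite mulf_eq0 (negPf (expf_neq0 2 Tz)) /= mulf_eq0 => /orP[/eqP//|].
by rewrite (negPf (mulf_neq0 (epi_neq0 _) (mulf_neq0 (thetaT_neq0 p1 ox0) Tx0))).
Qed.

(** The difference of the two sides, times T zeta ^ 2, lies in the same space of order two; it
    vanishes at 0, hence is a multiple of T^2, and vanishes at zeta. The product of thetas is
    entered as one more pair, indexed by the summand ['I_1]. *)
Lemma unitarity_sum0 xi zeta : off zeta ->
  C 0 0 xi zeta = T (zeta + xi) * T (zeta - xi) / T zeta ^+ 2.
Proof.
move=> oz; have [m hm] := unitarity_coefE 0 0 zeta.
have Tz := thetaT_neq0 p1 oz; have Tz2 := expf_neq0 2 Tz.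
have eta00 : eta 0 0 0 = 0 by rewrite !torsE mul0r !addr0 mul0r.
pose m' (o : 'I_N * 'I_N + 'I_1) := match o with inl b => T zeta ^+ 2 * m b | inr _ => 1 end.
pose u (o : 'I_N * 'I_N + 'I_1) := match o with inl b => eta zeta b.1 b.2 | inr _ => zeta end.
have hF x : \sum_o m' o * (T (x + u o) * T (x + eta 0 0 0 - u o)) =
    T zeta ^+ 2 * C 0 0 x zeta - T (zeta + x) * T (zeta - x).
  rewrite big_sumType /= big_ord1 mul1r hm mulr0 !mul0r epi0 mul1r mulr_sumr.
  congr (_ + _); first by apply: eq_bigr => b _; rewrite -mulrA.
  by rewrite eta00 addr0 -[x - zeta]opprB (thetaTN p1) [x + zeta]addrC mulrN.
have [||kap hk] := @thetaT_pairs_at0 R tau p1 N N2 _ m' u 0 0 zeta _ Tz.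
- transitivity (\sum_o m' o * (T (0 + u o) * T (0 + eta 0 0 0 - u o))).
    by apply: eq_bigr => o _; rewrite !add0r.
  by rewrite hF unitarity_coef_at0 // !dvdz0 /= addr0 subr0; ring.
- by rewrite eta00 sub0r (thetaTN p1) oppr_eq0.
have key x : T zeta ^+ 2 * C 0 0 x zeta - T (zeta + x) * T (zeta - x) = kap * (T x * T x).
  by rewrite -hF hk eta00 addr0.
have k0 : kap = 0.
  have := key zeta; rewrite unitarity_coef_diag // subrr thetaT0 // !mulr0 subrr => /esym/eqP.
  by rewrite mulf_eq0 (negPf (mulf_neq0 Tz Tz)) orbF => /eqP.
have := key xi; rewrite k0 mul0r => /eqP; rewrite subr_eq0 => /eqP <-.
by rewrite mulrC mulKf.
Qed.

End Unitarity.

Transparent Theta.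

Lemma zsum_theta_shift (R : realType) (p w K : R[i]) : normc p < 1 -> p != 0 -> w != 0 ->
  zsum (fun m => K * theta_coef p w (m + 1)) = K * Theta p w.
Proof.
move=> p1 p0 w0; have s := theta_coef_summable p1 p0 w0.
rewrite zsumZ; last exact: zsummable_shift.
by rewrite (zsum_shift 1 s) jacobi_triple_product.
Qed.

(** * From the given series and products to theta functions *)

Section Vartheta.
Variables (R : realType) (tau : R[i]).
Let p : R[i] := epi (2 * tau).
Hypothesis p1 : normc p < 1.
Let p0 : p != 0 := epi_neq0 _.

Lemma theta_coef_epi (y : R[i]) (n : int) :
  theta_coef p (epi (2 * y)) n =
  epi (n%:~R + n%:~R * (n%:~R - 1) * tau + 2 * n%:~R * y).
Proof.
have e1 : (-1 : R[i]) ^ n = epi n%:~R by rewrite -[n%:~R]mulr1 epiMz epi1.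
rewrite /theta_coef e1 -epiMn -epiMz -!epiD.
congr epi; have /(congr1 (fun k : int => k%:~R : R[i])) := tri2 n.
rewrite !intrM intrB -[(tri n)%:Z%:~R]/((tri n)%:R) => h.
rewrite [(tri n)%:R * _]mulrA h; ring.
Qed.

(** A termwise comparison with the triple product series. From (m + 1/2)^2 = m (m + 1) + 1/4, the
    m-th term of vartheta matches the theta coefficient at m + 1. *)
Lemma varthetaE (a1 a2 x : R[i]) :
  vartheta (1 / 2 + a1) (1 / 2 + a2) x tau =
  epi (tau / 4 - 1 / 2) * epi (a1 ^+ 2 * tau + a1 + 2 * a1 * a2) *
  epi (2 * a1 * x) * thetaT tau (x + a1 * tau + a2).
Proof.
set y := x + a1 * tau + a2.
rewrite thetaTE mulrA -(zsum_theta_shift _ p1 p0 (epi_neq0 (2 * y))).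
rewrite /vartheta; apply: eq_zsum => m.
rewrite theta_coef_epi -!epiD.
have epiE (x' : R[i]) : epi x' = cexp ((0 +i* pi) * x') by [].
rewrite epiE; congr cexp; rewrite /y intrD; by field.
Qed.

End Vartheta.

Section Scalars.
Variables (R : realType) (N : nat) (zeta tau : R[i]).
Hypothesis N0 : (0 < N)%N.
Let NC : (N%:R : R[i]) != 0 := natC_neq0 R N0.
Let q : R[i] := epi zeta.
Let p : R[i] := epi (2 * tau).
Let b : R[i] := epi (2 * (N%:R * zeta)).
Hypothesis q1 : normc q < 1.
Hypothesis p1 : normc p < 1.
Let p0 : p != 0 := epi_neq0 _.
Let b0 : b != 0 := epi_neq0 _.

Lemma bE : q ^+ N.*2 = b.
Proof. by rewrite /q /b -epiMn -muln2 natrM; congr epi; ring. Qed.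

Lemma b1 : normc b < 1.
Proof.
rewrite -bE normcX exprn_ilt1 ?normc_ge0 //.
by rewrite double_eq0 -lt0n.
Qed.

(** x lies outside Z + zeta Z + tau Z, where all zeros and poles of the scalars below are
    located. *)
Definition generic2 (x : R[i]) : Prop :=
  forall j k : int, epi (2 * (x + j%:~R * zeta + k%:~R * tau)) != 1.

Lemma generic2D x (j k m : int) : generic2 x ->
  generic2 (x + j%:~R * zeta + k%:~R * tau + m%:~R).
Proof.
move=> h j' k'; have := h (j + j') (k + k').
have -> : 2 * (x + j%:~R * zeta + k%:~R * tau + m%:~R + j'%:~R * zeta + k'%:~R * tau) =
  2 * (x + (j + j')%:~R * zeta + (k + k')%:~R * tau) + 2 * m%:~R by rewrite !intrD; ring.
by rewrite epiD epi_int2 mulr1.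
Qed.

Lemma generic2N x : generic2 x -> generic2 (- x).
Proof.
move=> h j k; have := h (- j) (- k).
have -> : 2 * (- x + j%:~R * zeta + k%:~R * tau) =
  - (2 * (x + (- j)%:~R * zeta + (- k)%:~R * tau)) by rewrite !mulrNz; ring.
by rewrite epiN invr_eq1.
Qed.

Definition P2 (x : R[i]) := qpoch2 (epi (2 * x)) p b.
Definition Pb (x : R[i]) := qpoch (epi (2 * x)) b.
Definition Pp (x : R[i]) := qpoch (epi (2 * x)) p.
Definition Thb (x : R[i]) := Theta b (epi (2 * x)).

Lemma P2_tau x : P2 x = Pb x * P2 (x + tau).
Proof. by rewrite /P2 (qpoch2S _ p1 b1) mulrDr epiD. Qed.

Lemma P2_zeta x : P2 x = Pp x * P2 (x + N%:R * zeta).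
Proof. by rewrite /P2 qpoch2C (qpoch2S _ b1 p1) qpoch2C mulrDr epiD. Qed.

Lemma ThbE x : Thb x = Pb x * Pb (N%:R * zeta - x) * Pb (N%:R * zeta).
Proof.
transitivity (Pb x * qpoch (b / epi (2 * x)) b * Pb (N%:R * zeta)).
  by rewrite /Thb /Pb /Theta.
rewrite {2}/Pb; have -> // : b / epi (2 * x) = epi (2 * (N%:R * zeta - x)).
by rewrite -epiN -epiD; congr epi; ring.
Qed.

Lemma ThpE x : Theta p (epi (2 * x)) = Pp x * Pp (tau - x) * Pp tau.
Proof.
transitivity (Pp x * qpoch (p / epi (2 * x)) p * Pp tau).
  by rewrite /Pp /Theta.
rewrite {2}/Pp; have -> // : p / epi (2 * x) = epi (2 * (tau - x)).
by rewrite -epiN -epiD; congr epi; ring.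
Qed.

Lemma ThbD x : Thb (x + N%:R * zeta) = - epi (- (2 * x)) * Thb x.
Proof.
by rewrite /Thb mulrDr epiD mulrC (Theta_mulp b1 b0) ?epi_neq0 // epiN.
Qed.

Lemma Thb_int x (m : int) : Thb (x + m%:~R) = Thb x.
Proof. by rewrite /Thb mulrDr epiD epi_int2 mulr1. Qed.

Lemma P2_neq0 x : generic2 x -> P2 x != 0.
Proof.
move=> h; apply: (qpoch2_neq0 p1 b1) => k l; have := h (N * l)%N k.
congr (_ != _); rewrite -!epiMn -!epiD; congr epi.
by rewrite -[(N * l)%N%:~R]/((N * l)%N%:R) natrM -[k%:~R]/(k%:R); ring.
Qed.

Lemma Pb_neq0 x : generic2 x -> Pb x != 0.
Proof.
move=> h; apply: (qpoch_neq0 b1) => l; have := h (N * l)%N 0.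
congr (_ != _); rewrite -!epiMn -!epiD; congr epi.
by rewrite -[(N * l)%N%:~R]/((N * l)%N%:R) natrM; ring.
Qed.

Lemma Thb_neq0 x : generic2 x -> Thb x != 0.
Proof.
move=> h; apply: (Theta_neq0 b1 b0 (epi_neq0 _)) => l; apply: contraNneq (h (- (N%:Z * l)) 0).
move=> e; have -> : 2 * (x + (- (N%:Z * l))%:~R * zeta + 0%:~R * tau) =
   2 * x - l%:~R * (2 * (N%:R * zeta)).
  by rewrite mulrNz intrM -[N%:Z%:~R]/(N%:R); ring.
by rewrite epiD e -epiMz -epiD subrr epi0.
Qed.

Lemma generic2_off x : generic2 x -> offlattice tau x.
Proof.
move=> h k; apply: contraNneq (h 0 (- k)) => e.
have -> : 2 * (x + 0%:~R * zeta + (- k)%:~R * tau) = 2 * x - k%:~R * (2 * tau).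
  by rewrite mulrNz; ring.
by rewrite epiD e -epiMz -epiD subrr epi0.
Qed.

Definition kap (x : R[i]) : R[i] :=
  (P2 (N%:R * zeta - x) * P2 (zeta + x) * P2 (tau - x) * P2 (tau + (N%:R - 1) * zeta + x)) /
  (P2 (N%:R * zeta + x) * P2 (zeta - x) * P2 (tau + x) * P2 (tau + (N%:R - 1) * zeta - x)).

Lemma kappa_invE x : kappa_inv N q p (epi x ^+ 2) = kap x.
Proof.
rewrite /kappa_inv bE -epiMn -!epiN.
have eq2 : q ^+ 2 = epi (2 * zeta) by rewrite -epiMn.
have eq3 : p * q ^+ (N.*2 - 2) = epi (2 * (tau + (N%:R - 1) * zeta)).
  rewrite -epiMn -epiD; congr epi; rewrite natrB; last by rewrite -[2%N]/(1.*2) leq_double.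
  by rewrite -muln2 natrM; ring.
rewrite eq2 eq3 -!epiD /kap /P2 -/p -/b.
by rewrite !mulrDr !mulrN.
Qed.

Lemma generic2_shift (x y : R[i]) (j k m : int) : generic2 x ->
  y = x + j%:~R * zeta + k%:~R * tau + m%:~R -> generic2 y.
Proof. by move=> h ->; exact: generic2D. Qed.

Lemma P2_shift_tau (x y : R[i]) : y = x + tau -> P2 x = Pb x * P2 y.
Proof. by move=> ->; exact: P2_tau. Qed.

Lemma P2_shift_zeta (x y : R[i]) : y = x + N%:R * zeta -> P2 x = Pp x * P2 y.
Proof. by move=> ->; exact: P2_zeta. Qed.

Lemma kap_neq0 x : generic2 x -> kap x != 0.
Proof.
move=> h; have h' := generic2N h.
have g1 : P2 (N%:R * zeta - x) != 0.
  by apply: P2_neq0; apply: (generic2_shift (j := N) (k := 0) (m := 0) h'); rewrite -[N%:~R]/(N%:R); ring.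
have g2 : P2 (zeta + x) != 0.
  by apply: P2_neq0; apply: (generic2_shift (j := 1) (k := 0) (m := 0) h); ring.
have g3 : P2 (tau - x) != 0.
  by apply: P2_neq0; apply: (generic2_shift (j := 0) (k := 1) (m := 0) h'); ring.
have g4 : P2 (tau + (N%:R - 1) * zeta + x) != 0.
  apply: P2_neq0; apply: (generic2_shift (j := N%:Z - 1) (k := 1) (m := 0) h).
  by rewrite intrB -[N%:~R]/(N%:R); ring.
have d1 : P2 (N%:R * zeta + x) != 0.
  by apply: P2_neq0; apply: (generic2_shift (j := N) (k := 0) (m := 0) h); rewrite -[N%:~R]/(N%:R); ring.
have d2 : P2 (zeta - x) != 0.
  by apply: P2_neq0; apply: (generic2_shift (j := 1) (k := 0) (m := 0) h'); ring.
have d3 : P2 (tau + x) != 0.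
  by apply: P2_neq0; apply: (generic2_shift (j := 0) (k := 1) (m := 0) h); ring.
have d4 : P2 (tau + (N%:R - 1) * zeta - x) != 0.
  apply: P2_neq0; apply: (generic2_shift (j := N%:Z - 1) (k := 1) (m := 0) h').
  by rewrite intrB -[N%:~R]/(N%:R); ring.
exact: mulf_neq0 (mulf_neq0 (mulf_neq0 (mulf_neq0 g1 g2) g3) g4)
  (invr_neq0 (mulf_neq0 (mulf_neq0 (mulf_neq0 d1 d2) d3) d4)).
Qed.

(** Each of the eight double products is moved by tau at the cost of one single product of base
    q^{2N}; these recombine into theta functions. *)
Lemma kap_tau x : generic2 x -> kap (x + tau) =
  kap x * (Thb (x + tau) * Thb (- x) / (Thb (zeta + x) * Thb (zeta - (x + tau)))).
Proof.
move=> h; have h' := generic2N h.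
rewrite /kap !ThbE.
have -> : P2 (N%:R * zeta - (x + tau)) = Pb (N%:R * zeta - (x + tau)) * P2 (N%:R * zeta - x).
  by apply: P2_shift_tau; ring.
have -> : P2 (zeta + x) = Pb (zeta + x) * P2 (zeta + (x + tau)).
  by apply: P2_shift_tau; ring.
have -> : tau - (x + tau) = - x by ring.
have -> : P2 (- x) = Pb (- x) * P2 (tau - x) by apply: P2_shift_tau; ring.
have e4 : P2 (tau + (N%:R - 1) * zeta + x) =
    Pb (N%:R * zeta - (zeta - (x + tau))) * P2 (tau + (N%:R - 1) * zeta + (x + tau)).
  have -> : tau + (N%:R - 1) * zeta + x = N%:R * zeta - (zeta - (x + tau)) by ring.
  by apply: P2_shift_tau; ring.
have e5 : P2 (N%:R * zeta + x) = Pb (N%:R * zeta - - x) * P2 (N%:R * zeta + (x + tau)).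
  by rewrite opprK; apply: P2_shift_tau; ring.
have e6 : P2 (zeta - (x + tau)) = Pb (zeta - (x + tau)) * P2 (zeta - x).
  by apply: P2_shift_tau; ring.
have e7 : P2 (tau + x) = Pb (x + tau) * P2 (tau + (x + tau)).
  by rewrite [tau + x]addrC; apply: P2_shift_tau; ring.
have e8 : P2 (tau + (N%:R - 1) * zeta - (x + tau)) =
    Pb (N%:R * zeta - (zeta + x)) * P2 (tau + (N%:R - 1) * zeta - x).
  have -> : tau + (N%:R - 1) * zeta - (x + tau) = N%:R * zeta - (zeta + x) by ring.
  by apply: P2_shift_tau; ring.
rewrite e4 e5 e6 e7 e8.
have hN : P2 (N%:R * zeta + x) != 0.
  by apply: P2_neq0; apply: (generic2_shift (j := N) (k := 0) (m := 0) h); rewrite -[N%:~R]/(N%:R); ring.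
have hz : P2 (tau + x) != 0.
  by apply: P2_neq0; apply: (generic2_shift (j := 0) (k := 1) (m := 0) h); ring.
rewrite e5 mulf_eq0 negb_or in hN; rewrite e7 mulf_eq0 negb_or in hz.
case/andP: hN => n1 n2; case/andP: hz => n3 n4.
have n5 : P2 (zeta - x) != 0.
  by apply: P2_neq0; apply: (generic2_shift (j := 1) (k := 0) (m := 0) h'); ring.
have n6 : P2 (tau + (N%:R - 1) * zeta - x) != 0.
  apply: P2_neq0; apply: (generic2_shift (j := N%:Z - 1) (k := 1) (m := 0) h').
  by rewrite intrB -[N%:~R]/(N%:R); ring.
have n7 : Pb (zeta - (x + tau)) != 0.
  by apply: Pb_neq0; apply: (generic2_shift (j := 1) (k := -1) (m := 0) h'); ring.
have n8 : Pb (N%:R * zeta - (zeta + x)) != 0.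
  apply: Pb_neq0; apply: (generic2_shift (j := N%:Z - 1) (k := 0) (m := 0) h').
  by rewrite intrB -[N%:~R]/(N%:R); ring.
have n9 : Pb (zeta + x) != 0.
  by apply: Pb_neq0; apply: (generic2_shift (j := 1) (k := 0) (m := 0) h); ring.
have n10 : Pb (N%:R * zeta - (zeta - (x + tau))) != 0.
  apply: Pb_neq0; apply: (generic2_shift (j := N%:Z - 1) (k := 1) (m := 0) h).
  by rewrite intrB -[N%:~R]/(N%:R); ring.
have n11 : Pb (N%:R * zeta) != 0.
  rewrite /Pb -/b; apply: (qpochpp_neq0 b1).
move: n1 n2 n3 n4 n5 n6 n7 n8 n9 n10 n11.
move: (Pb (N%:R * zeta - - x)) (P2 (N%:R * zeta + (x + tau))) (Pb (x + tau))
  (P2 (tau + (x + tau))) (P2 (zeta - x)) (P2 (tau + (N%:R - 1) * zeta - x))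
  (Pb (zeta - (x + tau))) (Pb (N%:R * zeta - (zeta + x))) (Pb (zeta + x))
  (Pb (N%:R * zeta - (zeta - (x + tau)))) (Pb (N%:R * zeta))
  (P2 (N%:R * zeta - x)) (Pb (N%:R * zeta - (x + tau))) (P2 (zeta + (x + tau)))
  (P2 (tau - x)) (Pb (- x)) (P2 (tau + (N%:R - 1) * zeta + (x + tau))).
move=> a1 a2 a3 a4 a5 a6 a7 a8 a9 a10 a11 a12 a13 a14 a15 a16 a17 *.
by field; do ?[apply/andP; split]; assumption.
Qed.

(** The analogue of [kap_tau] with the two bases exchanged, which the symmetry of the double product
    allows; the theta functions now have nome p. *)
Lemma kap_zeta x : generic2 x -> kap (x + N%:R * zeta) =
  kap x * (Theta p (epi (2 * - x)) * Theta p (epi (2 * (x + N%:R * zeta))) /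
    (Theta p (epi (2 * (zeta + x))) * Theta p (epi (2 * (zeta - (x + N%:R * zeta)))))).
Proof.
move=> h; have h' := generic2N h.
rewrite /kap !ThpE.
have -> : N%:R * zeta - (x + N%:R * zeta) = - x by ring.
have -> : P2 (- x) = Pp (- x) * P2 (N%:R * zeta - x) by apply: P2_shift_zeta; ring.
have -> : P2 (zeta + x) = Pp (zeta + x) * P2 (zeta + (x + N%:R * zeta)).
  by apply: P2_shift_zeta; ring.
have -> : P2 (tau - (x + N%:R * zeta)) = Pp (tau - (x + N%:R * zeta)) * P2 (tau - x).
  by apply: P2_shift_zeta; ring.
have e4 : P2 (tau + (N%:R - 1) * zeta + x) =
    Pp (tau - (zeta - (x + N%:R * zeta))) * P2 (tau + (N%:R - 1) * zeta + (x + N%:R * zeta)).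
  have -> : tau + (N%:R - 1) * zeta + x = tau - (zeta - (x + N%:R * zeta)) by ring.
  by apply: P2_shift_zeta; ring.
have e5 : P2 (N%:R * zeta + x) = Pp (x + N%:R * zeta) * P2 (N%:R * zeta + (x + N%:R * zeta)).
  by rewrite [N%:R * zeta + x]addrC; apply: P2_shift_zeta; ring.
have e6 : P2 (zeta - (x + N%:R * zeta)) = Pp (zeta - (x + N%:R * zeta)) * P2 (zeta - x).
  by apply: P2_shift_zeta; ring.
have e7 : P2 (tau + x) = Pp (tau - - x) * P2 (tau + (x + N%:R * zeta)).
  by rewrite opprK; apply: P2_shift_zeta; ring.
have e8 : P2 (tau + (N%:R - 1) * zeta - (x + N%:R * zeta)) =
    Pp (tau - (zeta + x)) * P2 (tau + (N%:R - 1) * zeta - x).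
  have -> : tau + (N%:R - 1) * zeta - (x + N%:R * zeta) = tau - (zeta + x) by ring.
  by apply: P2_shift_zeta; ring.
rewrite e4 e5 e6 e7 e8.
have hN : P2 (N%:R * zeta + x) != 0.
  by apply: P2_neq0; apply: (generic2_shift (j := N) (k := 0) (m := 0) h); rewrite -[N%:~R]/(N%:R); ring.
have hz : P2 (tau + x) != 0.
  by apply: P2_neq0; apply: (generic2_shift (j := 0) (k := 1) (m := 0) h); ring.
rewrite e5 mulf_eq0 negb_or in hN; rewrite e7 mulf_eq0 negb_or in hz.
case/andP: hN => n1 n2; case/andP: hz => n3 n4.
have n5 : P2 (zeta - x) != 0.
  by apply: P2_neq0; apply: (generic2_shift (j := 1) (k := 0) (m := 0) h'); ring.
have n6 : P2 (tau + (N%:R - 1) * zeta - x) != 0.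
  apply: P2_neq0; apply: (generic2_shift (j := N%:Z - 1) (k := 1) (m := 0) h').
  by rewrite intrB -[N%:~R]/(N%:R); ring.
have hT (y : R[i]) : generic2 y -> Pp y * Pp (tau - y) * Pp tau != 0.
  by move=> gy; rewrite -ThpE; apply: (Theta_neq0 p1 p0 (epi_neq0 _)); exact: generic2_off.
have g1 : generic2 (zeta + x) by apply: (generic2_shift (j := 1) (k := 0) (m := 0) h); ring.
have g2 : generic2 (zeta - (x + N%:R * zeta)).
  apply: (generic2_shift (j := 1 - N%:Z) (k := 0) (m := 0) h').
  by rewrite intrB -[N%:~R]/(N%:R); ring.
have := hT _ g1; have := hT _ g2; rewrite !mulf_eq0 !negb_or.
move=> /andP[/andP[n7 n8] n9] /andP[/andP[n10 n11] _].
move: n1 n2 n3 n4 n5 n6 n7 n8 n9 n10 n11.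
move: (Pp (x + N%:R * zeta)) (P2 (N%:R * zeta + (x + N%:R * zeta))) (Pp (tau - - x))
  (P2 (tau + (x + N%:R * zeta))) (P2 (zeta - x)) (P2 (tau + (N%:R - 1) * zeta - x))
  (Pp (zeta - (x + N%:R * zeta))) (Pp (tau - (zeta + x))) (Pp (zeta + x))
  (Pp (tau - (zeta - (x + N%:R * zeta)))) (Pp tau)
  (P2 (N%:R * zeta - x)) (Pp (tau - (x + N%:R * zeta))) (P2 (zeta + (x + N%:R * zeta)))
  (P2 (tau - x)) (Pp (- x)) (P2 (tau + (N%:R - 1) * zeta + (x + N%:R * zeta))).
move=> a1 a2 a3 a4 a5 a6 a7 a8 a9 a10 a11 a12 a13 a14 a15 a16 a17 *.
by field; do ?[apply/andP; split]; assumption.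
Qed.

(* The scalar by which [Rhat] multiplies the sum over [Z_N^2]. *)
Definition rho (x : R[i]) : R[i] :=
  tauN N zeta (zeta / 2 - x) *
  (epi ((2 / N%:R - 2) * x) * kappa_inv N (epi zeta) (epi (2 * tau)) (epi x ^+ 2) *
   (vartheta (1 / 2) (1 / 2) zeta tau / vartheta (1 / 2) (1 / 2) (x + zeta) tau)).

Lemma rhoE x : rho x = epi (zeta / N%:R - zeta) * (Thb (zeta - x) / Thb x) * kap x *
  (thetaT tau zeta / thetaT tau (x + zeta)).
Proof.
have vE (y : R[i]) : vartheta (1 / 2) (1 / 2) y tau = epi (tau / 4 - 1 / 2) * thetaT tau y.
  have := varthetaE p1 0 0 y; rewrite addr0 !(mulr0, mul0r, addr0, expr0n) epi0.
  by move=> ->; ring.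
rewrite /rho kappa_invE !vE /tauN -/q bE.
have -> : q * epi (zeta / 2 - x) ^+ 2 = epi (2 * (zeta - x)).
  by rewrite -epiMn -epiD; congr epi; field.
have -> : q * epi (zeta / 2 - x) ^- 2 = epi (2 * x).
  by rewrite -epiMn -epiN -epiD; congr epi; field.
rewrite -/(Thb (zeta - x)) -/(Thb x).
have cancel (e a d : R[i]) : e != 0 -> e * a / (e * d) = a / d.
  by move=> e0; rewrite -mulf_div divff // mul1r.
rewrite (cancel _ _ _ (epi_neq0 _)).
have -> : epi (zeta / N%:R - zeta) =
    epi ((2 / N%:R - 2) * (zeta / 2 - x)) * epi ((2 / N%:R - 2) * x).
  by rewrite -epiD; congr epi; field.
by move: (_ / _) (_ / _) (kap x) => u v w; ring.
Qed.

Lemma rho_neq0 x : thetaT tau zeta != 0 -> generic2 x -> rho x != 0.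
Proof.
move=> Tz h; rewrite rhoE.
have g1 : generic2 (zeta - x).
  by apply: (generic2_shift (j := 1) (k := 0) (m := 0) (generic2N h)); ring.
have g2 : generic2 (x + zeta) by apply: (generic2_shift (j := 1) (k := 0) (m := 0) h); ring.
have t1 := Thb_neq0 g1; have t2 := invr_neq0 (Thb_neq0 h).
have t3 := invr_neq0 (thetaT_neq0 p1 (generic2_off g2)).
exact: mulf_neq0 (mulf_neq0 (mulf_neq0 (epi_neq0 _) (mulf_neq0 t1 t2)) (kap_neq0 h))
  (mulf_neq0 Tz t3).
Qed.

Definition Lam (x : R[i]) : R[i] := epi (2 * zeta - 2 * zeta / N%:R) *
  (Thb x * Thb (- x)) / (Thb (zeta + x) * Thb (zeta - x)).

(** The factor tau_N of Rhat cancels the thetas at x + tau produced by kappa, and the thetas of nome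
    p contribute exponentials only. What remains is [Lam], in which tau does not occur. *)
Lemma rho_quasiperiod x : generic2 x ->
  rho (x + tau + 1) * epi (- (2 * x) - 2 * zeta / N%:R - tau) = Lam x * rho x.
Proof.
move=> h; have h' := generic2N h.
have kap1 y : kap (y + 1) = kap y.
  have P1 z : P2 (z + 1) = P2 z by rewrite /P2 mulrDr epiD (epi_int2 _ 1) mulr1.
  have P1' z : P2 (z - 1) = P2 z by rewrite -[in RHS](subrK 1 z) P1.
  by rewrite /kap !addrA !opprD !addrA !P1 !P1'.
have th1 y : Thb (y + 1) = Thb y := Thb_int y 1.
have th1' y : Thb (y - 1) = Thb y by rewrite -[in RHS](subrK 1 y) th1.
rewrite !rhoE kap1 kap_tau // th1.
have -> : zeta - (x + tau + 1) = zeta - (x + tau) - 1 by ring.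
rewrite th1'.
have -> : x + tau + 1 + zeta = x + zeta + tau + 1 by ring.
have -> : thetaT tau (x + zeta + tau + 1) = epi (-2 * (x + zeta) - tau) * thetaT tau (x + zeta).
  rewrite thetaTD1 (thetaTDtau p1).
  by move: (epi _) (thetaT tau (x + zeta)) => e t; ring.
have -> : epi (- (2 * x) - 2 * zeta / N%:R - tau) =
    epi (-2 * (x + zeta) - tau) * epi (2 * zeta - 2 * zeta / N%:R).
  by rewrite -epiD; congr epi; ring.
have n1 : Thb (x + tau) != 0.
  by apply: Thb_neq0; apply: (generic2_shift (j := 0) (k := 1) (m := 0) h); ring.
have n2 : Thb (zeta - (x + tau)) != 0.
  by apply: Thb_neq0; apply: (generic2_shift (j := 1) (k := -1) (m := 0) h'); ring.
have n3 : Thb (zeta + x) != 0.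
  by apply: Thb_neq0; apply: (generic2_shift (j := 1) (k := 0) (m := 0) h); ring.
have n4 : Thb (zeta - x) != 0.
  by apply: Thb_neq0; apply: (generic2_shift (j := 1) (k := 0) (m := 0) h'); ring.
have n5 : Thb x != 0 by exact: Thb_neq0.
have n6 : thetaT tau (x + zeta) != 0.
  apply: (thetaT_neq0 p1); apply: generic2_off.
  by apply: (generic2_shift (j := 1) (k := 0) (m := 0) h); ring.
have n7 := epi_neq0 (-2 * (x + zeta) - tau).
rewrite /Lam; move: n1 n2 n3 n4 n5 n6 n7.
move: (Thb (x + tau)) (Thb (zeta - (x + tau))) (Thb (zeta + x)) (Thb (zeta - x)) (Thb x)
  (thetaT tau (x + zeta)) (epi (-2 * (x + zeta) - tau)) (kap x) (Thb (- x))
  (thetaT tau zeta) (epi (zeta / N%:R - zeta)) (epi (2 * zeta - 2 * zeta / N%:R)).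
move=> a1 a2 a3 a4 a5 a6 a7 a8 a9 a10 a11 a12 *.
by field; do ?[apply/andP; split]; assumption.
Qed.

(** Reconciles the constants of [crossing_sum] and [unitarity_sum0], so that the crossing relation
    holds for the normalized matrix without a scalar. *)
Lemma rho_crossing x : generic2 x -> let y := x + N%:R * zeta in
  rho x * - (thetaT tau x * thetaT tau y) =
  rho y * (thetaT tau (zeta + y) * thetaT tau (zeta - y)).
Proof.
move=> h y; have h' := generic2N h.
have hy : generic2 y.
  by apply: (generic2_shift (j := N) (k := 0) (m := 0) h); rewrite -[N%:~R]/(N%:R) /y; ring.
rewrite !rhoE kap_zeta // -/y.
have -> : Thb (zeta - x) = - epi (- (2 * (zeta - y))) * Thb (zeta - y).
  by rewrite -ThbD; congr Thb; rewrite /y; ring.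
have -> : Thb y = - epi (- (2 * x)) * Thb x by rewrite -ThbD.
rewrite [y + zeta]addrC [x + zeta]addrC.
have -> : - (thetaT tau x * thetaT tau y) = thetaT tau (- x) * thetaT tau y.
  by rewrite (thetaTN p1); ring.
have Ty : thetaT tau (zeta + y) != 0.
  apply: (thetaT_neq0 p1); apply: generic2_off.
  by apply: (generic2_shift (j := 1) (k := 0) (m := 0) hy); ring.
have T3 : Theta p (epi (2 * (zeta + x))) != 0.
  apply: (Theta_neq0 p1 p0 (epi_neq0 _)); apply: generic2_off.
  by apply: (generic2_shift (j := 1) (k := 0) (m := 0) h); ring.
have T4 : Theta p (epi (2 * (zeta - y))) != 0.
  apply: (Theta_neq0 p1 p0 (epi_neq0 _)); apply: generic2_off.
  by apply: (generic2_shift (j := 1) (k := 0) (m := 0) (generic2N hy)); ring.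
have n5 : Thb x != 0 by exact: Thb_neq0.
rewrite [thetaT tau (- x)]thetaTE [thetaT tau y]thetaTE.
rewrite [thetaT tau (zeta - y)]thetaTE [thetaT tau (zeta + x)]thetaTE -/p.
have eE : epi (- (2 * (zeta - y))) = epi (- (zeta + x)) * epi (- (zeta - y)) /
    (epi (- (2 * x)) * epi (- - x) * epi (- y)).
  by rewrite -!epiD -epiN -!epiD; congr epi; rewrite /y; ring.
rewrite eE.
have m1 := epi_neq0 (- (zeta + x)); have m2 := epi_neq0 (- (2 * x)).
have m3 := epi_neq0 (- - x); have m4 := epi_neq0 (- y).
move: Ty T3 T4 n5 m1 m2 m3 m4.
move: (Theta p (epi (2 * (zeta + x)))) (Theta p (epi (2 * (zeta - y))))
  (Theta p (epi (2 * - x))) (Theta p (epi (2 * y)))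
  (thetaT tau (zeta + y)) (thetaT tau zeta) (kap x) (Thb x) (Thb (zeta - y))
  (epi (zeta / N%:R - zeta)) (epi (- (zeta + x))) (epi (- (zeta - y)))
  (epi (- (2 * x))) (epi (- - x)) (epi (- y)).
move=> a1 a2 a3 a4 a5 a6 a7 a8 a9 a10 a11 a12 a13 a14 a15 *.
by field; do ?[apply/andP; split]; assumption.
Qed.
End Scalars.

Lemma WcoefE (R : realType) (N a1 a2 : nat) (xi zeta tau : R[i]) : (0 < N)%N ->
  normc (epi (2 * tau)) < 1 ->
  Wcoef N a1 a2 xi zeta tau = Wt N tau a1 a2 xi zeta.
Proof.
move=> N0 p1; have NC := natC_neq0 R N0.
rewrite /Wcoef !varthetaE // WtE torsE.
set k1 := epi (tau / 4 - _); set k2 := epi (_ + _ + _).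
have -> : epi (2 * (a1%:R / N%:R) * (xi + zeta / N%:R)) =
    epi (2 * a1%:~R * xi / N%:R) * epi (2 * (a1%:R / N%:R) * (zeta / N%:R)).
  by rewrite -epiD; congr epi; rewrite -[a1%:~R]/(a1%:R); ring.
have e1 : (zeta + a1%:~R * tau + a2%:~R) / N%:R =
    zeta / N%:R + a1%:R / N%:R * tau + a2%:R / N%:R.
  by rewrite -[a1%:~R]/(a1%:R) -[a2%:~R]/(a2%:R); ring.
rewrite e1 !addrA.
have cancel (k e f t s : R[i]) : k != 0 -> e != 0 -> k * (f * e) * t / (k * e * s) = f * (t / s).
  by move=> k0 e0; rewrite invfM; move: s^-1 => s'; field; rewrite k0 e0.
have k0 : k1 * k2 != 0 by apply: mulf_neq0; exact: epi_neq0.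
by rewrite (cancel _ _ _ _ _ k0 (epi_neq0 _)); exact: mulrA.
Qed.

Section Generic.
Variables (R : realType) (zeta tau c : R[i]).

(** The additive form of [generic_ratio]. Using c zeta instead of the starred tau as third generator
    makes it specialize to [generic2] for both nomes. *)
Definition generic3 (x : R[i]) : Prop := forall j k l : int,
  epi (2 * (x + j%:~R * zeta + k%:~R * tau + l%:~R * (c * zeta))) != 1.

Lemma generic_ratioP x : generic_ratio zeta tau c x <-> generic3 x.
Proof.
have e j k l : epi (2 * (x + j%:~R * zeta + k%:~R * tau + l%:~R * (c * zeta))) * 
   (epi zeta ^ (2 * - j) * epi (2 * tau) ^ (- k - l) * epi (2 * taustar zeta tau c) ^ l) =
   epi x ^+ 2.
  rewrite -!epiMz -epiMn -!epiD; congr epi.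
  by rewrite /taustar intrM intrB !mulrNz; ring.
split=> h j k l.
  by apply/eqP => e1; apply: (h (- j) (- k - l) l); rewrite -(e j k l) e1 mul1r.
move=> e1; have /negP := h (- j) (- k - l) l; apply; apply/eqP.
have := e (- j) (- k - l) l; rewrite e1 opprK.
have -> : - (- k - l) - l = k by ring.
by rewrite -[RHS]mul1r; apply: mulIf; rewrite !mulf_neq0 ?expfz_neq0 ?epi_neq0.
Qed.

Lemma generic3_shift (x y : R[i]) (j k l m : int) : generic3 x ->
  y = x + j%:~R * zeta + k%:~R * tau + l%:~R * (c * zeta) + m%:~R -> generic3 y.
Proof.
move=> h -> j' k' l'; have := h (j + j') (k + k') (l + l').
suff -> : 2 * (x + j%:~R * zeta + k%:~R * tau + l%:~R * (c * zeta) + m%:~R +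
    j'%:~R * zeta + k'%:~R * tau + l'%:~R * (c * zeta)) =
  2 * (x + (j + j')%:~R * zeta + (k + k')%:~R * tau + (l + l')%:~R * (c * zeta)) + 2 * m%:~R.
  by rewrite epiD epi_int2 mulr1.
by rewrite !intrD; ring.
Qed.

Lemma generic3N x : generic3 x -> generic3 (- x).
Proof.
move=> h j k l; have := h (- j) (- k) (- l).
suff -> : 2 * (- x + j%:~R * zeta + k%:~R * tau + l%:~R * (c * zeta)) =
  - (2 * (x + (- j)%:~R * zeta + (- k)%:~R * tau + (- l)%:~R * (c * zeta))).
  by rewrite epiN invr_eq1.
by rewrite !mulrNz; ring.
Qed.

Lemma generic3_2 x : generic3 x -> generic2 zeta tau x.
Proof.
move=> h j k; have := h j k 0; congr (epi _ != 1); ring.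
Qed.

Lemma generic3_2star x : generic3 x -> generic2 zeta (taustar zeta tau c) x.
Proof.
move=> h j k; have := h j k (- k); congr (epi _ != 1).
by rewrite /taustar mulrNz; ring.
Qed.

Lemma normc_lt1 (x : R[i]) : `|x| < 1 -> normc x < 1.
Proof. by case: x => a b /=; rewrite -[1 in X in X -> _]/(1%:C) ltcR. Qed.

Hypothesis adm : admissible zeta tau c.

Lemma admissible_q1 : normc (epi zeta) < 1.
Proof. by case: adm => /normc_lt1. Qed.

Lemma admissible_p1 : normc (epi (2 * tau)) < 1.
Proof. by case: adm => _ /normc_lt1. Qed.

Lemma admissible_ps1 : normc (epi (2 * taustar zeta tau c)) < 1.
Proof. by case: adm => _ _ /normc_lt1. Qed.

Lemma admissible_off : offlattice tau zeta.
Proof. by case: adm => _ _ _ h k; apply/eqP; have [+ _] := h k; rewrite -epiMn. Qed.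

Lemma admissible_off_star : offlattice (taustar zeta tau c) zeta.
Proof. by case: adm => _ _ _ h k; apply/eqP; have [_] := h k; rewrite -epiMn. Qed.

End Generic.

(** * Heisenberg matrices and the R-matrix *)

Lemma zsum2_single (R : realType) (N : nat) (N2 : (2 <= N)%N) (f : int -> int -> R[i]) :
  (forall a b, ~~ ((N %| a)%Z && (N %| b)%Z) -> f a b = 0) -> zsum2 N f = f 0 0.
Proof.
move=> h; have N0 := ltnW N2; rewrite /zsum2 (bigD1 (Ordinal N0, Ordinal N0)) //= big1 ?addr0 //.
move=> [i j] ne; apply: h; apply: contra ne => /= /andP[hi hj].
have := dvdz_ord_sub i (Ordinal N0); have := dvdz_ord_sub j (Ordinal N0).
by rewrite /= !subr0 hi hj -pair_eqE /= => <- <-.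
Qed.

Lemma dvdzB_mull (N a q : int) : (N %| a - q * N)%Z = (N %| a)%Z.
Proof. by apply: rpredBr; apply: dvdz_mull. Qed.

Section Heisenberg.
Variables (R : realType) (N : nat).
Hypothesis N2 : (2 <= N)%N.
Let N0 : (0 < N)%N := ltnW N2.
Let om : R[i] := omega R N.
Let om0 : om != 0 := omega_neq0 R N.
Variable g12 : 'M[R[i]]_N.
Hypothesis hg : is_sqrt_g g12.

Let s (i : 'I_N) : R[i] := g12 i i.

Lemma sqrt_gE i j : g12 i j = s i *+ (i == j).
Proof.
have [/is_diag_mxP h _] := hg; have [->|ij] := eqVneq i j; first by [].
by rewrite h // (inj_eq val_inj).
Qed.

Lemma sqrt_g_sqr i : s i * s i = om ^+ i.+1.
Proof.
have [_ /matrixP/(_ i i)] := hg; rewrite !mxE eqxx mulr1n => <-.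
rewrite (bigD1 i) //= big1 ?addr0 // => j ji.
by rewrite sqrt_gE eq_sym (negPf ji) mulr0n mul0r.
Qed.

Lemma sqrt_g_neq0 i : s i != 0.
Proof.
have : s i * s i != 0 by rewrite sqrt_g_sqr expf_neq0.
by rewrite mulf_eq0 negb_or => /andP[].
Qed.

(* [Jmx a b] is the conjugate of [g^b h^a] by [g12], with [a], [b] taken modulo N *)
Definition Jmx (a b : int) : 'M[R[i]]_N := \matrix_(i, j)
  (s i / s j * om ^ (b * (i.+1)%:Z) *+ (N %| (j : nat)%:Z - (i : nat)%:Z - a)%Z).

(** The inverse of [Jmx a b]; the scalar undoes the cocycle of [JmxM]. *)
Definition Kmx (a b : int) : 'M[R[i]]_N := om ^ (a * b) *: Jmx (- a) (- b).

Lemma Jmx_perl a b : Jmx (a + N%:Z) b = Jmx a b.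
Proof.
apply/matrixP=> i j; rewrite !mxE; congr (_ *+ nat_of_bool _).
have -> : (j : nat)%:Z - (i : nat)%:Z - (a + N%:Z) = (j : nat)%:Z - (i : nat)%:Z - a - 1 * N%:Z.
  by ring.
by rewrite dvdzB_mull.
Qed.

Lemma Jmx_perr a b : Jmx a (b + N%:Z) = Jmx a b.
Proof.
apply/matrixP=> i j; rewrite !mxE mulrDl; congr (_ * _ *+ _).
exact: omega_addN.
Qed.

Lemma JmxM a b a' b' : Jmx a b *m Jmx a' b' = om ^ (a * b') *: Jmx (a + a') (b + b').
Proof.
apply/matrixP=> i j; rewrite !mxE.
have [k [q ek]] := int_residue N0 ((i : nat)%:Z + a).
rewrite (bigD1 k) //= big1 ?addr0 => [|l lk]; last first.
  rewrite !mxE; have -> : (l : nat)%:Z - (i : nat)%:Z - a = (l : nat)%:Z - (k : nat)%:Z - q * N%:Z.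
    by lia.
  rewrite dvdzB_mull dvdz_ord_sub (negPf lk) mulr0n mul0r //.
rewrite !mxE.
have -> : (N %| (k : nat)%:Z - (i : nat)%:Z - a)%Z.
  have -> : (k : nat)%:Z - (i : nat)%:Z - a = - q * N%:Z by lia.
  by rewrite dvdz_mull.
have -> : (N %| (j : nat)%:Z - (k : nat)%:Z - a')%Z =
  (N %| (j : nat)%:Z - (i : nat)%:Z - (a + a'))%Z.
  have -> : (j : nat)%:Z - (i : nat)%:Z - (a + a') =
     (j : nat)%:Z - (k : nat)%:Z - a' - q * N%:Z by lia.
  by rewrite dvdzB_mull.
rewrite mulr1n; case: (N %| _)%Z; rewrite ?mulr0n ?mulr0 // !mulr1n.
have -> : b' * (k.+1)%:Z = b' * (i.+1)%:Z + a * b' + N%:Z * (- (b' * q)).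
  have -> : (k.+1)%:Z = (i.+1)%:Z + a - q * N%:Z by lia.
  by ring.
rewrite omega_addN // mulrDl !expfzDr //.
have := sqrt_g_neq0 k; move: (s k) (s i) (s j)^-1 => x y z x0.
by field.
Qed.

Lemma Jmx00 : Jmx 0 0 = 1%:M.
Proof.
apply/matrixP=> i j; rewrite !mxE subr0 dvdz_ord_sub [j == i]eq_sym mul0r mulr1.
by case: eqVneq => [->|] //; rewrite ?mulr0n // divff ?sqrt_g_neq0.
Qed.

Lemma KmxM a b a' b' : Kmx a b *m Kmx a' b' = om ^ (- (b * a')) *: Kmx (a + a') (b + b').
Proof.
rewrite /Kmx -scalemxAl -scalemxAr JmxM !scalerA -!expfzDr //.
congr (om ^ _ *: Jmx _ _); ring.
Qed.

Lemma JmxK a b : Jmx a b *m Kmx a b = 1%:M.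
Proof.
rewrite /Kmx -scalemxAr JmxM scalerA -expfzDr // !subrr Jmx00 mulrN subrr.
by rewrite expr0z scale1r.
Qed.

Lemma Jmx_unit a b : Jmx a b \in unitmx.
Proof. by have [] := mulmx1_unit (JmxK a b). Qed.

Lemma Kmx_perl a b : Kmx (a + N%:Z) b = Kmx a b.
Proof.
rewrite /Kmx -[Jmx (- a) _]Jmx_perl; have -> : - a = - (a + N%:Z) + N%:Z by ring.
rewrite Jmx_perl; congr (_ *: _); first by rewrite mulrDl omega_addN.
by rewrite Jmx_perl.
Qed.

Lemma Kmx_perr a b : Kmx a (b + N%:Z) = Kmx a b.
Proof.
rewrite /Kmx -[Jmx _ (- b)]Jmx_perr; have -> : - b + N%:Z = - (b + N%:Z) + N%:Z + N%:Z by ring.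
by rewrite !Jmx_perr mulrDr [a * N%:Z]mulrC omega_addN.
Qed.

Lemma Kmx00 : Kmx 0 0 = 1%:M.
Proof. by have := JmxK 0 0; rewrite Jmx00 mul1mx. Qed.

End Heisenberg.

Lemma tensmx11 (S : pzRingType) (m : nat) : (1%:M : 'M[S]_m) *t (1%:M : 'M[S]_m) = 1%:M.
Proof.
apply/matrixP=> i j; case: (mxtens_indexP i) => i1 i2; case: (mxtens_indexP j) => j1 j2.
rewrite tensmxE !mxE (can_eq (@mxtens_indexK m m)) xpair_eqE.
by case: (i1 == j1); case: (i2 == j2); rewrite /= ?mulr1n ?mulr0n ?mulr1 ?mulr0 ?mul0r.
Qed.

Section HeisenbergR.
Variables (R : realType) (N : nat).
Hypothesis N2 : (2 <= N)%N.
Let om : R[i] := omega R N.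
Let om0 : om != 0 := omega_neq0 R N.
Variable g12 : 'M[R[i]]_N.
Hypothesis hg : is_sqrt_g g12.
Local Notation J := (Jmx g12).
Local Notation K := (Kmx g12).

Lemma sqrt_g_mulV : g12 *m diag_mx (\row_i (g12 i i)^-1) = 1%:M.
Proof.
apply/matrixP=> i j; rewrite mul_mx_diag !mxE (sqrt_gE hg i j).
case: (altP (i =P j)) => [->|_]; last by rewrite !mulr0n mul0r.
by rewrite divff // (sqrt_g_neq0 hg).
Qed.

Lemma sqrt_g_unit : g12 \in unitmx.
Proof. by have [] := mulmx1_unit sqrt_g_mulV. Qed.

Lemma sqrt_g_inv : invmx g12 = diag_mx (\row_i (g12 i i)^-1).
Proof. by rewrite -[RHS](mulKmx sqrt_g_unit) sqrt_g_mulV mulmx1. Qed.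

Lemma conj_sqrt_gE (X : 'M[R[i]]_N) i j :
  (g12 *m X *m invmx g12) i j = g12 i i / g12 j j * X i j.
Proof.
rewrite sqrt_g_inv mul_mx_diag !mxE (bigD1 i) //= big1 ?addr0; last first.
  by move=> k ki; rewrite (sqrt_gE hg) eq_sym (negPf ki) mul0r.
by rewrite mulrAC.
Qed.

Lemma Jmx_h : J 1 0 = g12 *m hmx R N *m invmx g12.
Proof.
apply/matrixP=> i j; rewrite conj_sqrt_gE !mxE mul0r expr0z mulr1 -mulr_natr.
congr (_ * (nat_of_bool _)%:R); rewrite eq_sym -addrA -opprD.
have -> : (i : nat)%:Z + 1 = i.+1 by lia.
by rewrite -eqz_mod_dvd !modz_nat.
Qed.

Lemma Jmx_g : J 0 1 = g12 *m gmx R N *m invmx g12.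
Proof.
apply/matrixP=> i j; rewrite conj_sqrt_gE !mxE subr0 dvdz_ord_sub mul1r [j == i]eq_sym.
by rewrite mulrnAr.
Qed.

Lemma Jmx_Xh k : J k%:Z 0 = J 1 0 ^+ k.
Proof.
elim: k => [|k IH]; first by rewrite Jmx00.
by rewrite exprS -IH -[RHS]/(_ *m _) JmxM // mulr0 scale1r addr0.
Qed.

Lemma Jmx_Xg k : J 0 k%:Z = J 0 1 ^+ k.
Proof.
elim: k => [|k IH]; first by rewrite Jmx00.
by rewrite exprS -IH -[RHS]/(_ *m _) JmxM // mul0r scale1r addr0.
Qed.

Lemma conjX (X : 'M[R[i]]_N) k : g12 *m X ^+ k *m invmx g12 = (g12 *m X *m invmx g12) ^+ k.
Proof.
elim: k => [|k IH].
  by rewrite !expr0 -[1]/(1%:M) mulmx1 mulmxV // sqrt_g_unit.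
rewrite !exprS -IH -![X * _]/(X *m _) -[RHS]/(_ *m _).
by rewrite !mulmxA mulmxKV // sqrt_g_unit.
Qed.

Lemma Jmx_Imx (a b : nat) : J a b = g12 *m Imx R N a b *m invmx g12.
Proof.
have -> : J a b = J 0 b *m J a 0 by rewrite JmxM // mul0r scale1r addr0 add0r.
rewrite Jmx_Xh Jmx_Xg Jmx_h Jmx_g -!conjX /Imx !mulmxA.
by rewrite mulmxKV ?sqrt_g_unit.
Qed.

Lemma Kmx_Imx (a b : nat) : K a b = g12 *m invmx (Imx R N a b) *m invmx g12.
Proof.
have gu := sqrt_g_unit; have Ju := Jmx_unit N2 hg a b.
have := JmxK N2 hg a b; have := Ju.
rewrite !Jmx_Imx; move: (Imx R N a b) => I0; rewrite !unitmx_mul unitmx_inv gu andbT.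
move=> /= Iu e; have gIu : g12 *m I0 *m invmx g12 \in unitmx.
  by rewrite !unitmx_mul unitmx_inv gu Iu.
have e' : g12 *m I0 *m invmx g12 *m (g12 *m invmx I0 *m invmx g12) = 1%:M.
  by rewrite !mulmxA mulmxKV // mulmxK // mulmxV.
by rewrite -[RHS](mulKmx gIu) e' -e mulKmx.
Qed.

Lemma amx_Jmx : amx g12 = om *: J 1 1.
Proof.
have [_ gg] := hg.
have -> : amx g12 = J 1 0 *m J 0 1.
  by rewrite Jmx_h Jmx_g -gg !mulmxA mulmxKV ?sqrt_g_unit // mulmxK ?sqrt_g_unit.
by rewrite JmxM // addr0 add0r.
Qed.

Lemma amx_unit : amx g12 \in unitmx.
Proof.
rewrite amx_Jmx; have := Jmx_unit N2 hg 1 1.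
by move=> h; rewrite unitmxZ // unitfE.
Qed.

Lemma amx_Jmx_comm a b : amx g12 *m J a b = om ^ (b - a) *: (J a b *m amx g12).
Proof.
rewrite amx_Jmx -scalemxAl -scalemxAr !(JmxM N2 hg) !scalerA.
have e : om * omega R N ^ (1 * b) = om ^ (b - a) * om * omega R N ^ (a * 1).
  rewrite mul1r mulr1 -/om; have -> : om ^ b = om ^ (b - a) * om ^ a.
    by rewrite -(expfzDr _ _ om0) subrK.
  by move: (om ^ (b - a)) (om ^ a) => x y; rewrite mulrA [om * x]mulrC.
by rewrite e [1 + a]addrC [1 + b]addrC.
Qed.

Definition Emx (a b : int) : 'M[R[i]]_(N * N) := J a b *t K a b.

Lemma EmxE a b i j k l :
  Emx a b (mxtens_index (i, k)) (mxtens_index (j, l)) = J a b i j * K a b k l.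
Proof. exact: tensmxE. Qed.

Lemma Emx_per i j : per2 N (fun a b => Emx a b i j).
Proof. by split=> a b; rewrite /Emx ?Jmx_perl ?Jmx_perr ?(Kmx_perl N2) ?(Kmx_perr N2). Qed.

Lemma tensmx_scale (m n r s : nat) (x y : R[i]) (X : 'M[R[i]]_(m, n)) (Y : 'M[R[i]]_(r, s)) :
  (x *: X) *t (y *: Y) = (x * y) *: (X *t Y).
Proof. by apply/matrixP=> i j; rewrite !mxE mulrACA. Qed.

Lemma EmxM a b c d : Emx a b *m Emx c d = om ^ (a * d - b * c) *: Emx (a + c) (b + d).
Proof.
by rewrite /Emx tensmx_mul (JmxM N2 hg) (KmxM N2 hg) tensmx_scale -(expfzDr _ _ om0).
Qed.

Lemma Emx00 : Emx 0 0 = 1%:M.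
Proof. by rewrite /Emx (Jmx00 hg) (Kmx00 N2 hg) tensmx11. Qed.

Definition Smx (f : int -> int -> R[i]) : 'M[R[i]]_(N * N) :=
  \sum_(a : 'I_N * 'I_N) f (a.1 : nat)%:Z (a.2 : nat)%:Z *: Emx (a.1 : nat)%:Z (a.2 : nat)%:Z.

Lemma SmxE f i j : Smx f i j = zsum2 N (fun a b => f a b * Emx a b i j).
Proof. by rewrite /Smx summxE; apply: eq_bigr => a _; rewrite mxE. Qed.

Lemma RhatE (zeta tau xi : R[i]) : normc (epi (2 * tau)) < 1 ->
  Rhat g12 zeta tau xi = rho N zeta tau xi *: Smx (fun a b => Wt N tau a b xi zeta).
Proof.
move=> p1; rewrite /Rhat /Rmx /Rtilde -scalemxAr -scalemxAl scalerA.
congr (_ *: _); rewrite pair_bigA /= mulmx_sumr mulmx_suml.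
apply: eq_bigr => a _; rewrite WcoefE ?(ltnW N2) // -scalemxAr -scalemxAl; congr (_ *: _).
by rewrite !tensmx_mul /Emx -Jmx_Imx -Kmx_Imx.
Qed.

(** The cocycles of the two tensor factors combine into the symplectic one, so coefficients multiply
    by twisted convolution, as in [unitarity_coef]. *)
Lemma SmxM f g : per2 N f -> per2 N g -> Smx f *m Smx g =
  Smx (fun c d => zsum2 N (fun a b => om ^ (a * d - b * c) * (f a b * g (c - a) (d - b)))).
Proof.
move=> pf pg; apply/matrixP=> i j; rewrite SmxE /Smx.
transitivity (zsum2 N (fun a b => zsum2 N (fun c d =>
    om ^ (a * d - b * c) * (f a b * g c d) * Emx (a + c) (b + d) i j))).
  rewrite mulmx_suml summxE; apply: eq_bigr => a _.
  rewrite mulmx_sumr summxE; apply: eq_bigr => c _.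
  by rewrite -scalemxAl -scalemxAr EmxM !mxE; ring.
transitivity (zsum2 N (fun a b => zsum2 N (fun c d =>
    om ^ (a * d - b * c) * (f a b * g (c - a) (d - b)) * Emx c d i j))).
  apply: eq_zsum2 => a b.
  rewrite -[RHS](zsum2_shift N2 a b); last first.
    have [g1 g2] := pg; have [e1 e2] := Emx_per i j.
    split=> c d.
      rewrite e1 -addrA [N%:Z - a]addrC addrA g1 -(omega_addN R N2 (a * d - b * c) (- b)).
      by congr (om ^ _ * _ * _); ring.
    rewrite e2 -addrA [N%:Z - b]addrC addrA g2 -(omega_addN R N2 (a * d - b * c) a).
    by congr (om ^ _ * _ * _); ring.
  apply: eq_zsum2 => c d; rewrite !addrK ![_ + a]addrC ![_ + b]addrC.
  by congr (om ^ _ * _ * _); ring.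
rewrite zsum2_exchange; apply: eq_zsum2 => c d.
by rewrite mulrC -zsum2Zl; apply: eq_zsum2 => a b; rewrite mulrC.
Qed.

(** Contracted in this way, the matrices of the first space multiply in the order opposite to those
    of the second. Their cocycles cancel and an untwisted convolution remains, the one evaluated by
    [crossing_sum]. *)
Lemma Smx_cross f g j j' k l : per2 N f -> per2 N g ->
  \sum_i \sum_m Smx f (mxtens_index (i, k)) (mxtens_index (j, m)) *
                Smx g (mxtens_index (j', m)) (mxtens_index (i, l)) =
  zsum2 N (fun c d => zsum2 N (fun a b => f a b * g (c - a) (d - b)) * (J c d j' j * K c d k l)).
Proof.
move=> pf pg.
transitivity (zsum2 N (fun a b => zsum2 N (fun c d =>
    f a b * g c d * (J (a + c) (b + d) j' j * K (a + c) (b + d) k l)))).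
  transitivity (\sum_i \sum_m zsum2 N (fun a b => zsum2 N (fun c d =>
     f a b * g c d * ((J c d j' i * J a b i j) * (K a b k m * K c d m l))))).
    apply: eq_bigr => i _; apply: eq_bigr => m _.
    rewrite !SmxE mulr_suml; apply: eq_bigr => a _.
    rewrite mulr_sumr; apply: eq_bigr => c _.
    by rewrite !EmxE; ring.
  have ex F : \sum_i \sum_m zsum2 N (fun a b => zsum2 N (fun c d => F i m a b c d)) =
     zsum2 N (fun a b => zsum2 N (fun c d => \sum_(i < N) \sum_(m < N) (F i m a b c d : R[i]))).
    rewrite pair_bigA exchange_big; apply: eq_bigr => a _.
    rewrite exchange_big; apply: eq_bigr => c _.
    by rewrite -(pair_bigA _ (fun i m => F i m _ _ _ _)).
  rewrite ex; apply: eq_zsum2 => a b; apply: eq_zsum2 => c d.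
  have := congr1 (fun X : 'M_N => X j' j) (JmxM N2 hg c d a b).
  have := congr1 (fun X : 'M_N => X k l) (KmxM N2 hg a b c d).
  rewrite !mxE [c + a]addrC [d + b]addrC => eK eJ.
  transitivity (f a b * g c d * ((\sum_i J c d j' i * J a b i j) * (\sum_m K a b k m * K c d m l))).
    rewrite mulr_suml !mulr_sumr; apply: eq_bigr => i _.
    by rewrite mulr_sumr mulr_sumr.
  rewrite eJ eK.
  have e : omega R N ^ (c * b) * omega R N ^ (- (b * c)) = 1.
    by rewrite -(expfzDr _ _ om0) mulrC subrr expr0z.
  move: e; move: (omega R N ^ (c * b)) (omega R N ^ (- (b * c))) => u v e.
  by rewrite [u * _ * _]mulrACA e mul1r.
transitivity (zsum2 N (fun a b => zsum2 N (fun c d =>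
    f a b * g (c - a) (d - b) * (J c d j' j * K c d k l)))).
  apply: eq_zsum2 => a b.
  rewrite -[RHS](zsum2_shift N2 a b); last first.
    have [g1 g2] := pg.
    split=> c d.
      by rewrite Jmx_perl (Kmx_perl N2) -addrA [N%:Z - a]addrC addrA g1.
    by rewrite (Jmx_perr N2) (Kmx_perr N2) -addrA [N%:Z - b]addrC addrA g2.
  by apply: eq_zsum2 => c d; rewrite !addrK [_ + a]addrC [_ + b]addrC.
rewrite zsum2_exchange; apply: eq_zsum2 => c d.
by rewrite [RHS]mulrC -zsum2Zl; apply: eq_zsum2 => a b; rewrite mulrC.
Qed.

(** The character coming from conjugation by the matrix a is the one that W acquires under xi |-> xi
    + tau + 1. *)
Lemma amx_Smx f : (amx g12 *t 1%:M) *m Smx (fun a b => om ^ (a - b) * f a b) =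
  Smx f *m (amx g12 *t 1%:M).
Proof.
rewrite /Smx mulmx_sumr mulmx_suml; apply: eq_bigr => a _.
rewrite -scalemxAr -scalemxAl /Emx !tensmx_mul mul1mx mulmx1 amx_Jmx_comm.
rewrite -[X in _ *t X]scale1r tensmx_scale scalerA mulr1; congr (_ *: _).
  rewrite mulrAC -(expfzDr _ _ om0) addrC subrKA subrr expr0z mul1r //.
Qed.

End HeisenbergR.

Opaque Theta rho Lam.

(** * Inverse, quasi-periodicity and crossing of the normalized R-matrix *)

Section RhatProperties.
Variables (R : realType) (N : nat).
Hypothesis N2 : (2 <= N)%N.
Let N0 : (0 < N)%N := ltnW N2.
Let NC : (N%:R : R[i]) != 0 := natC_neq0 R N0.
Let om : R[i] := omega R N.
Let om0 : om != 0 := omega_neq0 R N.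
Variable g12 : 'M[R[i]]_N.
Hypothesis hg : is_sqrt_g g12.
Variables (zeta tau : R[i]).
Hypothesis q1 : normc (epi zeta) < 1.
Hypothesis p1 : normc (epi (2 * tau)) < 1.
Hypothesis oz : offlattice tau zeta.
Local Notation T := (thetaT tau).
Local Notation Rh := (Rhat g12 zeta tau).
Local Notation W x := (fun a b => Wt N tau a b x zeta).

(** The coefficients of R_21 (z^-1): exchanging the two spaces replaces the index (a, b) by (-a,
    -b). *)
Let Wi (x : R[i]) (a b : int) : R[i] := Wt N tau (- a) (- b) (- x) zeta.

Let Wi_per x : per2 N (Wi x).
Proof.
have [h1 h2] := per2_Wt p1 N2 (- x) zeta.
split=> a b; rewrite /Wi.
  by rewrite -h1; have -> : - (a + N%:Z) + N%:Z = - a by ring.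
by rewrite -h2; have -> : - (b + N%:Z) + N%:Z = - b by ring.
Qed.

Let WiB x a b c d : Wi x (c - a) (d - b) = Wt N tau (a - c) (b - d) (- x) zeta.
Proof. by rewrite /Wi !opprB. Qed.

Let Cx x := T (zeta + x) * T (zeta - x) / T zeta ^+ 2.

Let Tz : T zeta != 0 := thetaT_neq0 p1 oz.

Let Cx_neq0 x : generic2 zeta tau x -> Cx x != 0.
Proof.
move=> h; have Tz2 := invr_neq0 (expf_neq0 2 Tz).
have T1 : T (zeta + x) != 0.
  apply: (thetaT_neq0 p1); apply: (@generic2_off _ zeta).
  by apply: (generic2_shift (j := 1) (k := 0) (m := 0) h); ring.
have T2 : T (zeta - x) != 0.
  apply: (thetaT_neq0 p1); apply: (@generic2_off _ zeta).
  by apply: (generic2_shift (j := 1) (k := 0) (m := 0) (generic2N h)); ring.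
exact: mulf_neq0 (mulf_neq0 T1 T2) Tz2.
Qed.

Definition Rinv (x : R[i]) : 'M[R[i]]_(N * N) :=
  (rho N zeta tau x * Cx x)^-1 *: Smx g12 (Wi x).

Lemma Smx_inv x : Smx g12 (W x) *m Smx g12 (Wi x) = (Cx x)%:M.
Proof.
rewrite (SmxM N2 hg (per2_Wt p1 N2 x zeta) (Wi_per x)).
apply/matrixP=> i j; rewrite SmxE.
transitivity (zsum2 N (fun c d => unitarity_coef tau N c d x zeta * Emx g12 c d i j)).
  have hc c d : zsum2 N (fun a b => omega R N ^ (a * d - b * c) *
      (Wt N tau a b x zeta * Wi x (c - a) (d - b))) = unitarity_coef tau N c d x zeta.
    by apply: eq_zsum2 => a b; rewrite WiB.
  by apply: eq_zsum2 => c d; rewrite hc.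
rewrite (zsum2_single N2) => [|c d cd]; last first.
  by rewrite (unitarity_sum_neq0 p1 N2 x oz cd) mul0r.
by rewrite (unitarity_sum0 p1 N2 x oz) (Emx00 N2 hg) !mxE mulr_natr.
Qed.

Lemma Rhat_mulV x : generic2 zeta tau x -> Rh x *m Rinv x = 1%:M.
Proof.
move=> h; rewrite (RhatE N2 hg zeta x p1) /Rinv -scalemxAl -scalemxAr scalerA Smx_inv.
have r0 := rho_neq0 N0 q1 p1 Tz h; have c0 := Cx_neq0 h.
rewrite scale_scalar_mx; congr (_%:M); move: r0 c0.
by move: (rho _ _ _ _) (Cx x) => u v u0 v0; field; rewrite u0 v0.
Qed.

Lemma Rhat_mulVl x : generic2 zeta tau x -> Rinv x *m Rh x = 1%:M.
Proof. by move=> /Rhat_mulV/mulmx1C. Qed.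

Lemma Rhat_quasiperiod x : generic2 zeta tau x ->
  (amx g12 *t 1%:M) *m Rh (x + tau + 1) = Lam N zeta x *: (Rh x *m (amx g12 *t 1%:M)).
Proof.
move=> h; rewrite !(RhatE N2 hg zeta _ p1) -scalemxAl -scalemxAr scalerA.
set e := epi (- (2 * x) - 2 * zeta / N%:R - tau).
have -> : Smx g12 (W (x + tau + 1)) = e *: Smx g12 (fun a b => om ^ (a - b) * Wt N tau a b x zeta).
  rewrite /Smx scaler_sumr; apply: eq_bigr => a _; rewrite scalerA; congr (_ *: _).
  rewrite Wt_xiD1 (Wt_xiDtau p1 N2) -/e -/om (expfzDr _ _ om0).
  by move: (om ^ _) (om ^ _) (Wt _ _ _ _ _ _) => u v w; ring.
rewrite -scalemxAr scalerA (amx_Smx N2 hg) (rho_quasiperiod N0 q1 p1 h).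
by [].
Qed.

(** In entries, the product of the t_1-transposes of Rhat (x) and of the inverse of Rhat (y) is the
    identity; this is the form consumed by the partial trace. *)
Lemma Rhat_crossing x j j' k l : generic2 zeta tau x -> let y := x + N%:R * zeta in
  \sum_i \sum_m Rh x (mxtens_index (i, k)) (mxtens_index (j, m)) *
                Rinv y (mxtens_index (j', m)) (mxtens_index (i, l)) =
  ((j' == j) && (k == l))%:R.
Proof.
move=> h y.
have hy : generic2 zeta tau y.
  by apply: (generic2_shift (j := N) (k := 0) (m := 0) h); rewrite -[N%:~R]/(N%:R) /y; ring.
set r := rho N zeta tau x; set r' := (rho N zeta tau y * Cx y)^-1.
transitivity (r * r' * \sum_i \sum_m
   Smx g12 (W x) (mxtens_index (i, k)) (mxtens_index (j, m)) *
   Smx g12 (Wi y) (mxtens_index (j', m)) (mxtens_index (i, l))).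
  have scE (t : R[i]) (X : 'M[R[i]]_(N * N)) s s' : (t *: X) s s' = t * X s s' by rewrite mxE.
  have eR s s' : Rh x s s' = r * Smx g12 (W x) s s'.
    by rewrite (RhatE N2 hg zeta x p1) scE.
  have eI s s' : Rinv y s s' = r' * Smx g12 (Wi y) s s' by rewrite /Rinv scE.
  rewrite mulr_sumr; apply: eq_bigr => i _; rewrite mulr_sumr; apply: eq_bigr => m _.
  rewrite eR eI; exact: mulrACA.
rewrite (Smx_cross N2 hg _ _ _ _ (per2_Wt p1 N2 x zeta) (Wi_per y)).
set D := - (T x * T y) / T zeta ^+ 2.
have hD c d : zsum2 N (fun a b => Wt N tau a b x zeta * Wi y (c - a) (d - b)) =
    if (N %| c)%Z && (N %| d)%Z then D else 0.
  rewrite -(crossing_sum p1 N2 c d oz (generic2_off h) (generic2_off hy)).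
  by apply: eq_zsum2 => a b; rewrite WiB.
rewrite (zsum2_single N2) => [|c d cd]; last by rewrite hD (negPf cd) mul0r.
rewrite hD !dvdz0 /= (Jmx00 hg) (Kmx00 N2 hg) !mxE -natrM mulnb mulrA.
suff -> : r * r' * D = 1 by rewrite mul1r.
have r0 := rho_neq0 N0 q1 p1 Tz hy; have c0 := Cx_neq0 hy.
have := rho_crossing N0 q1 p1 h; rewrite -/y -/r /D /r' => e.
have c1 : T (zeta + y) * T (zeta - y) != 0.
  by apply: contraNneq c0 => e0; rewrite /Cx e0 mul0r.
rewrite mulrA [r * _ * _]mulrAC e /Cx; move: r0 c1 (expf_neq0 2 Tz).
move: (rho N zeta tau y) (T (zeta + y) * T (zeta - y)) (T zeta ^+ 2) => u v w *.
by field; do ?[apply/andP; split]; assumption.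
Qed.

End RhatProperties.

(** * The exchange relation *)

Section Legs.
Variables (R : realType) (A : algType R[i]) (N : nat).
Local Notation S := (scal_mx A).
Local Notation "X ._1" := (X *t (1%:M : 'M[A]_N)) (at level 2, format "X ._1").
Local Notation "X ._2" := ((1%:M : 'M[A]_N) *t X) (at level 2, format "X ._2").

Lemma sum_mxtens (V : nmodType) (f : 'I_(N * N) -> V) :
  \sum_k f k = \sum_(i < N) \sum_(j < N) f (mxtens_index (i, j)).
Proof.
rewrite pair_bigA (reindex (@mxtens_index N N)) /=; first by apply: eq_bigr => -[].
by exists (@mxtens_unindex N N) => x _; [exact: mxtens_indexK|exact: mxtens_unindexK].
Qed.

Lemma scal_mxE m (X : 'M[R[i]]_m) i j : S X i j = (X i j)%:A.
Proof. by rewrite mxE. Qed.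

Lemma scal_mxM m (X Y : 'M[R[i]]_m) : S (X *m Y) = S X *m S Y.
Proof. exact: map_mxM. Qed.

Lemma scal_mx1 m : S (1%:M : 'M[R[i]]_m) = 1%:M.
Proof. exact: map_mx1. Qed.

Lemma mul_scal_scalarE m (x : R[i]) (X : 'M[A]_m) i j : (X *m S x%:M) i j = x *: X i j.
Proof.
rewrite mxE (bigD1 j) //= big1 ?addr0 => [|k kj].
  by rewrite scal_mxE mxE eqxx mulr1n mulr_algr.
by rewrite scal_mxE mxE (negPf kj) mulr0n scale0r mulr0.
Qed.

Lemma scal_scalar_comm m (x : R[i]) (X : 'M[A]_m) : S x%:M *m X = X *m S x%:M.
Proof.
apply/matrixP=> i j; rewrite mul_scal_scalarE mxE (bigD1 i) //= big1 ?addr0 => [|k ki].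
  by rewrite scal_mxE mxE eqxx mulr1n mulr_algl.
by rewrite scal_mxE mxE eq_sym (negPf ki) mulr0n scale0r mul0r.
Qed.

Lemma mul_leg1E (X : 'M[A]_(N * N)) (Z : 'M[A]_N) i k j l :
  (X *m Z._1) (mxtens_index (i, k)) (mxtens_index (j, l)) =
  \sum_m X (mxtens_index (i, k)) (mxtens_index (m, l)) * Z m j.
Proof.
rewrite mxE sum_mxtens; apply: eq_bigr => m _.
rewrite (bigD1 l) //= big1 ?addr0 => [|n nl].
  by rewrite tensmxE mxE eqxx mulr1.
by rewrite tensmxE [_%:M _ _]mxE (negPf nl) mulr0 mulr0.
Qed.

Lemma mul_leg2E (X : 'M[A]_(N * N)) (Z : 'M[A]_N) i k j l :
  (X *m Z._2) (mxtens_index (i, k)) (mxtens_index (j, l)) =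
  \sum_m X (mxtens_index (i, k)) (mxtens_index (j, m)) * Z m l.
Proof.
rewrite mxE sum_mxtens (bigD1 j) //= [X in _ + X]big1 ?addr0 => [|n nj].
  by apply: eq_bigr => m _; rewrite tensmxE mxE eqxx mul1r.
by rewrite big1 // => m _; rewrite tensmxE [_%:M _ _]mxE (negPf nj) mul0r mulr0.
Qed.

Lemma leg1M (X Y : 'M[A]_N) : (X *m Y)._1 = X._1 *m Y._1.
Proof.
apply/matrixP=> a b; case: (mxtens_indexP a) => i k; case: (mxtens_indexP b) => j l.
rewrite mul_leg1E tensmxE mxE mulr_suml; apply: eq_bigr => m _.
by rewrite tensmxE mxE; case: (k == l); rewrite ?mulr1 // !mulr0 mul0r.
Qed.

Lemma leg21E (L Z : 'M[A]_N) i k j l :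
  (L._2 *m Z._1) (mxtens_index (i, k)) (mxtens_index (j, l)) = L k l * Z i j.
Proof.
rewrite mul_leg1E (bigD1 i) //= big1 ?addr0 => [|m mi].
  by rewrite tensmxE mxE eqxx mul1r.
by rewrite tensmxE mxE eq_sym (negPf mi) mul0r mul0r.
Qed.

Lemma leg12E (L Z : 'M[A]_N) i k j l :
  (Z._1 *m L._2) (mxtens_index (i, k)) (mxtens_index (j, l)) = Z i j * L k l.
Proof.
rewrite mul_leg2E (bigD1 k) //= big1 ?addr0 => [|m mk].
  by rewrite tensmxE mxE eqxx mulr1.
by rewrite tensmxE mxE eq_sym (negPf mk) mulr0 mul0r.
Qed.

Lemma scal_leg1 (X : 'M[R[i]]_N) : S (X *t 1%:M) = (S X)._1.
Proof. by rewrite /scal_mx map_mxT map_mx1. Qed.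

Lemma scal_leg1_comm (X : 'M[R[i]]_N) (L : 'M[A]_N) : (S X)._1 *m L._2 = L._2 *m (S X)._1.
Proof.
apply/matrixP=> a b; case: (mxtens_indexP a) => i k; case: (mxtens_indexP b) => j l.
by rewrite leg12E leg21E scal_mxE mulr_algl mulr_algr.
Qed.

Lemma ptrace_leg21 (L Z : 'M[A]_N) k l :
  \sum_i (L._2 *m Z._1) (mxtens_index (i, k)) (mxtens_index (i, l)) = L k l * \tr Z.
Proof. by rewrite /mxtrace mulr_sumr; apply: eq_bigr => i _; rewrite leg21E. Qed.

(** The trace over A is not cyclic, but the entries of X and Y are scalars and can be brought
    together around Z. The hypothesis then removes them, leaving Z to the left of L. *)
Lemma ptrace_crossing (x : R[i]) (X Y : 'M[R[i]]_(N * N)) (L Z : 'M[A]_N) k l :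
  (forall j j' k l, \sum_i \sum_m X (mxtens_index (i, k)) (mxtens_index (j, m)) *
     Y (mxtens_index (j', m)) (mxtens_index (i, l)) = x *+ ((j' == j) && (k == l))) ->
  \sum_i (S X *m Z._1 *m (S Y *m L._2)) (mxtens_index (i, k)) (mxtens_index (i, l)) =
  x *: (\tr Z * L k l).
Proof.
move=> h.
pose G i m j j' l' := X (mxtens_index (i, k)) (mxtens_index (j, m)) *
     Y (mxtens_index (j', m)) (mxtens_index (i, l')).
have hG j j' l' : \sum_i \sum_m G i m j j' l' = x *+ ((j' == j) && (k == l')) := h _ _ _ _.
transitivity (\sum_i \sum_j' \sum_m \sum_j \sum_l' G i m j j' l' *: (Z j j' * L l' l)).
  apply: eq_bigr => i _; rewrite mxE sum_mxtens.
  apply: eq_bigr => j' _; apply: eq_bigr => m _.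
  rewrite mul_leg1E mul_leg2E mulr_suml; apply: eq_bigr => j _.
  rewrite mulr_sumr; apply: eq_bigr => l' _.
  by rewrite !scal_mxE !mulr_algl -scalerAl -scalerAr scalerA.
(* The sums over i and m, the contracted indices of the crossing relation, are moved innermost. *)
transitivity (\sum_j \sum_j' \sum_l' (\sum_i \sum_m G i m j j' l') *: (Z j j' * L l' l)).
  under eq_bigr do under eq_bigr do rewrite exchange_big.
  under eq_bigr do rewrite exchange_big.
  rewrite exchange_big; apply: eq_bigr => j _.
  rewrite exchange_big; apply: eq_bigr => j' _.
  under eq_bigr do rewrite exchange_big.
  rewrite exchange_big; apply: eq_bigr => l' _.
  by rewrite scaler_suml; apply: eq_bigr => i _; rewrite scaler_suml.
clearbody G; rewrite /mxtrace mulr_suml scaler_sumr; apply: eq_bigr => j _.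
rewrite (bigD1 j) //= [X in _ + X]big1 ?addr0 => [|j' jj']; last first.
  by rewrite big1 // => l' _; rewrite hG (negPf jj') scale0r.
rewrite (bigD1 k) //= [X in _ + X]big1 ?addr0 => [|l' lk]; first by rewrite hG !eqxx.
by rewrite hG eqxx eq_sym (negPf lk) scale0r.
Qed.

(** Intended values: [b] = a^-n; [R0], [Rh], [Rx] are Rhat at y, y + c zeta, y - N zeta, and [Rs] is
    Rhat^* at y + c zeta; [Rh1], [Rs1] are Rhat, Rhat^* at y + tau + 1; [R0i], [Rsi] are inverses;
    [l1], [l2] are [Lam] at y and at y + c zeta. *)
Variables (am b : 'M[R[i]]_N) (R0 R0i Rh Rx Rs Rsi Rh1 Rs1 : 'M[R[i]]_(N * N)).
Variables (l1 l2 mu : R[i]).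
Hypothesis am_unit : am \in unitmx.
Hypothesis l1_neq0 : l1 != 0.
Hypothesis l2_neq0 : l2 != 0.
Hypothesis mu_neq0 : mu != 0.
Hypothesis R0K : R0i *m R0 = 1%:M.
Hypothesis RsK : Rs *m Rsi = 1%:M.
Hypothesis qp1 : (am *t 1%:M) *m Rh1 = l1 *: (R0 *m (am *t 1%:M)).
Hypothesis qp2 : (am *t 1%:M) *m Rs1 = l2 *: (Rs *m (am *t 1%:M)).
Hypothesis qpb : (b *t 1%:M) *m Rh = mu *: (Rx *m (b *t 1%:M)).
Hypothesis crossing : forall j j' k l,
  \sum_i \sum_m Rx (mxtens_index (i, k)) (mxtens_index (j, m)) *
     R0i (mxtens_index (j', m)) (mxtens_index (i, l)) = ((j' == j) && (k == l))%:R.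
Variables (P M' Mi L : 'M[A]_N).
Let M := S am *m M' *m S (invmx am).
Hypothesis MK : M *m Mi = 1%:M.
Hypothesis KM : Mi *m M = 1%:M.
Hypothesis RLLh : S Rh *m P._1 *m L._2 = L._2 *m P._1 *m S Rs.
Hypothesis RLL1 : S Rh1 *m M'._1 *m L._2 = L._2 *m M'._1 *m S Rs1.

(** Conjugation by the matrix a undoes the shift of z by -p^{1/2} in both R-matrices, each with its
    own quasi-period. *)
Lemma RLL_twisted : S (l1 *: R0) *m M._1 *m L._2 = L._2 *m M._1 *m S (l2 *: Rs).
Proof.
have e1 : am *t 1%:M *m (invmx am *t 1%:M) = 1%:M :> 'M[R[i]]_(N * N).
  by rewrite tensmx_mul mulmxV // mulmx1 tensmx11.
have e2 := mulmx1C e1.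
have r1 : l1 *: R0 = (am *t 1%:M) *m Rh1 *m (invmx am *t 1%:M).
  by rewrite qp1 -scalemxAl -mulmxA e1 mulmx1.
have r2 : l2 *: Rs = (am *t 1%:M) *m Rs1 *m (invmx am *t 1%:M).
  by rewrite qp2 -scalemxAl -mulmxA e1 mulmx1.
have s2 : (S (invmx am))._1 *m (S am)._1 = 1%:M.
  by rewrite -leg1M -scal_mxM mulVmx // scal_mx1 tensmx11.
rewrite r1 r2 /M !leg1M !scal_mxM !scal_leg1 -!mulmxA.
have s3 (Y : 'M[A]_(N * N)) : (S (invmx am))._1 *m ((S am)._1 *m Y) = Y.
  by rewrite mulmxA s2 mul1mx.
rewrite !s3 scal_leg1_comm !mulmxA -scal_leg1_comm.
rewrite -!mulmxA; congr (_ *m _); rewrite !mulmxA.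
by rewrite RLL1.
Qed.

Lemma exchange_trace k l :
  \tr (S b *m P *m Mi) * L k l = (l1 / (l2 * mu)) *: (L k l * \tr (S b *m P *m Mi)).
Proof.
have M1 : M._1 *m Mi._1 = 1%:M by rewrite -leg1M MK tensmx11.
have M2 : Mi._1 *m M._1 = 1%:M by rewrite -leg1M KM tensmx11.
(* Both RLL relations express this matrix; equating the two expressions eliminates R^* and gives
   [e1]. *)
pose X := L._2 *m S (l2^-1 *: Rsi).
have X1 : S (l1 *: R0) *m M._1 *m X = L._2 *m M._1.
  rewrite /X mulmxA RLL_twisted -[_ *m S _ *m S _]mulmxA -scal_mxM -scalemxAl -scalemxAr scalerA RsK.
  by rewrite divff // scale1r scal_mx1 mulmx1.
have X2 : X = Mi._1 *m S (l1^-1 *: R0i) *m (L._2 *m M._1).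
  rewrite -X1 !mulmxA -[Mi._1 *m _ *m _]mulmxA -scal_mxM -scalemxAl -scalemxAr scalerA R0K.
  by rewrite mulVf // scale1r scal_mx1 mulmx1 M2 mul1mx.
have X3 : S Rh *m P._1 *m X = L._2 *m P._1 *m S (l2^-1)%:M.
  rewrite /X mulmxA RLLh -[_ *m S _ *m S _]mulmxA -scal_mxM -scalemxAr RsK.
  by rewrite scalemx1.
have e1 : L._2 *m P._1 *m Mi._1 *m S (l2^-1)%:M =
    S Rh *m P._1 *m Mi._1 *m (S (l1^-1 *: R0i) *m L._2).
  rewrite -[_ *m Mi._1 *m S _]mulmxA -scal_scalar_comm [LHS]mulmxA -X3 X2 -!mulmxA M1 mulmx1.
  by rewrite !mulmxA.
set Z := S b *m P *m Mi.
(* Multiplying by b in the first space commutes past L_2 and turns [Rh] into [mu *: Rx], whose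
   argument is the one crossing needs. *)
have e2 : L._2 *m Z._1 *m S (l2^-1)%:M =
    S (mu *: Rx) *m Z._1 *m (S (l1^-1 *: R0i) *m L._2).
  transitivity ((S b)._1 *m (L._2 *m P._1 *m Mi._1 *m S (l2^-1)%:M)).
    by rewrite /Z !leg1M !mulmxA scal_leg1_comm.
  rewrite e1 !mulmxA -scal_leg1 -scal_mxM qpb scalemxAl scal_mxM scal_leg1.
  by rewrite /Z !leg1M !mulmxA.
have e3 := ptrace_crossing (X := mu *: Rx) (Y := l1^-1 *: R0i) (x := mu / l1) L Z k l.
have : l2^-1 *: (L k l * \tr Z) = (mu / l1) *: (\tr Z * L k l).
  rewrite -e3 => [|j j' k' l'].
    rewrite -e2 -ptrace_leg21 scaler_sumr; apply: eq_bigr => i _.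
    by rewrite mul_scal_scalarE.
  rewrite -mulr_natr -crossing mulr_sumr; apply: eq_bigr => i _.
  by rewrite mulr_sumr; apply: eq_bigr => m _; rewrite !mxE mulrACA.
move/(congr1 (fun y => (l1 / mu) *: y)); rewrite !scalerA.
have -> : l1 / mu * (mu / l1) = 1 by field; rewrite l1_neq0 mu_neq0.
by rewrite scale1r => <-; congr (_ *: _); rewrite invfM mulrA mulrAC.
Qed.

End Legs.

Transparent Lam.
Opaque Rhat Rinv.

(** * Quasi-period factors along the surface *)

Section LamProperties.
Variables (R : realType) (N : nat) (zeta tau : R[i]).
Hypothesis N0 : (0 < N)%N.
Let NC : (N%:R : R[i]) != 0 := natC_neq0 R N0.
Hypothesis q1 : normc (epi zeta) < 1.
Local Notation Lm := (Lam N zeta).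
Local Notation th := (Thb N zeta).

Lemma LamE x : Lm x = epi (2 * zeta - 2 * zeta / N%:R) *
  (th x * th (- x)) / (th (zeta + x) * th (zeta - x)).
Proof. by []. Qed.

Lemma Lam_neq0 x : generic2 zeta tau x -> Lm x != 0.
Proof.
move=> h; have h' := generic2N h.
have t1 : th (zeta + x) != 0.
  by apply: (@Thb_neq0 _ _ _ tau N0 q1); apply: (generic2_shift (j := 1) (k := 0) (m := 0) h); ring.
have t2 : th (zeta - x) != 0.
  by apply: (@Thb_neq0 _ _ _ tau N0 q1); apply: (generic2_shift (j := 1) (k := 0) (m := 0) h'); ring.
have t3 := @Thb_neq0 _ _ _ tau N0 q1 _ h; have t4 := @Thb_neq0 _ _ _ tau N0 q1 _ h'.
exact: mulf_neq0 (mulf_neq0 (epi_neq0 _) (mulf_neq0 t3 t4)) (invr_neq0 (mulf_neq0 t1 t2)).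
Qed.

Lemma Lam_int x (m : int) : Lm (x + m%:~R) = Lm x.
Proof.
have e1 : - (x + m%:~R) = - x + (- m)%:~R by rewrite mulrNz opprD.
have e2 : zeta + (x + m%:~R) = zeta + x + m%:~R by ring.
have e3 : zeta - (x + m%:~R) = zeta - x + (- m)%:~R by rewrite mulrNz; ring.
by rewrite !LamE e3 e2 e1 !Thb_int.
Qed.

(** The exponentials from the four theta functions cancel. Hence scalars collected at y - N zeta can
    be compared with those at y. *)
Lemma Lam_qN x : generic2 zeta tau x -> Lm (x + N%:R * zeta) = Lm x.
Proof.
move=> h; set y := x + _.
have D := ThbD N0 q1.
have e1 : th (- x) = - epi (- (2 * - y)) * th (- y) by rewrite -D; congr Thb; rewrite /y; ring.
have e2 : th (zeta + y) = - epi (- (2 * (zeta + x))) * th (zeta + x).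
  by rewrite -D; congr Thb; rewrite /y; ring.
have e3 : th (zeta - x) = - epi (- (2 * (zeta - y))) * th (zeta - y).
  by rewrite -D; congr Thb; rewrite /y; ring.
have e4 : th y = - epi (- (2 * x)) * th x by rewrite -D.
rewrite !LamE e1 e2 e3 e4.
have hy : generic2 zeta tau y.
  by apply: (generic2_shift (j := N) (k := 0) (m := 0) h); rewrite -[N%:~R]/(N%:R) /y; ring.
have t1 : th (zeta + x) != 0.
  by apply: (@Thb_neq0 _ _ _ tau N0 q1); apply: (generic2_shift (j := 1) (k := 0) (m := 0) h); ring.
have t2 : th (zeta - y) != 0.
  apply: (@Thb_neq0 _ _ _ tau N0 q1).
  by apply: (generic2_shift (j := 1) (k := 0) (m := 0) (generic2N hy)); ring.
have e : epi (- (2 * x)) * epi (- (2 * (zeta - y))) =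
    epi (- (2 * (zeta + x))) * epi (- (2 * - y)).
  by rewrite -!epiD; congr epi; ring.
have n1 := epi_neq0 (- (2 * (zeta + x))); have n2 := epi_neq0 (- (2 * (zeta - y))).
have e5 : epi (- (2 * x)) =
    epi (- (2 * (zeta + x))) * epi (- (2 * - y)) / epi (- (2 * (zeta - y))).
  by rewrite -e mulfK.
rewrite e5; move: t1 t2 n1 n2.
move: (th (zeta + x)) (th (zeta - y)) (th x) (th (- y)) (epi (- (2 * (zeta + x))))
  (epi (- (2 * - y))) (epi (- (2 * (zeta - y)))) (epi (2 * zeta - _)).
move=> a1 a2 a3 a4 a5 a6 a7 a8 *.
by field; do ?[apply/andP; split]; assumption.
Qed.

End LamProperties.

Lemma intertwine_inv (F : fieldType) (n : nat) (U V X Y : 'M[F]_n) (l : F) :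
  U *m V = 1%:M -> U *m X = l *: (Y *m U) -> l != 0 -> V *m Y = l^-1 *: (X *m V).
Proof.
move=> UV e l0; have VU := mulmx1C UV.
have -> : Y = l^-1 *: (U *m X *m V).
  by rewrite e -scalemxAl scalerA mulVf // scale1r -mulmxA UV mulmx1.
by rewrite -scalemxAr !mulmxA VU mul1mx.
Qed.

Section Iterate.
Variables (R : realType) (N : nat).
Hypothesis N2 : (2 <= N)%N.
Let N0 : (0 < N)%N := ltnW N2.
Variable g12 : 'M[R[i]]_N.
Hypothesis hg : is_sqrt_g g12.
Variables (zeta tau : R[i]).
Hypothesis q1 : normc (epi zeta) < 1.
Hypothesis p1 : normc (epi (2 * tau)) < 1.
Local Notation Rh := (Rhat g12 zeta tau).
Local Notation Lm := (Lam N zeta).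
Local Notation "X ._1" := (X *t (1%:M : 'M[R[i]]_N)) (at level 2, format "X ._1").

Let legXSr (X : 'M[R[i]]_N) m : (X ^+ m.+1)._1 = (X ^+ m)._1 *m X._1.
Proof. by rewrite tensmx_mul mulmx1 exprSr. Qed.

Let generic_shift x (m : int) : generic2 zeta tau x -> generic2 zeta tau (x + m%:~R * (tau + 1)).
Proof. by move=> h; apply: (generic2_shift (j := 0) (k := m) (m := m) h); ring. Qed.

Lemma Rhat_amxX x m : generic2 zeta tau x ->
  (amx g12 ^+ m)._1 *m Rh (x + m%:R * (tau + 1)) =
  \prod_(0 <= k < m) Lm (x + k%:R * tau) *: (Rh x *m (amx g12 ^+ m)._1).
Proof.
move=> h; elim: m => [|m IH].
  by rewrite big_geq // scale1r mul0r addr0 expr0 tensmx11 mul1mx mulmx1.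
rewrite legXSr -mulmxA.
have -> : x + m.+1%:R * (tau + 1) = x + m%:~R * (tau + 1) + tau + 1.
  by rewrite -natr1 -[m%:~R]/(m%:R); ring.
rewrite (Rhat_quasiperiod N2 hg q1 p1) //; last exact: generic_shift.
have -> : Lm (x + m%:~R * (tau + 1)) = Lm (x + m%:R * tau).
  have -> : x + m%:~R * (tau + 1) = x + m%:R * tau + m%:~R by rewrite -[m%:~R]/(m%:R); ring.
  by rewrite Lam_int.
rewrite -scalemxAr mulmxA IH -scalemxAl scalerA -mulmxA -legXSr mulrC.
by rewrite big_nat_recr.
Qed.

Lemma Rhat_amxVX x m : generic2 zeta tau x ->
  (invmx (amx g12) ^+ m)._1 *m Rh (x - m%:R * (tau + 1)) =
  (\prod_(1 <= k < m.+1) Lm (x - k%:R * tau))^-1 *: (Rh x *m (invmx (amx g12) ^+ m)._1).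
Proof.
move=> h; elim: m => [|m IH].
  by rewrite big_geq // invr1 scale1r mul0r subr0 expr0 tensmx11 mul1mx mulmx1.
set y := x - m.+1%:R * (tau + 1).
have gy : generic2 zeta tau y.
  have -> : y = x + (- m.+1%:Z)%:~R * (tau + 1) by rewrite mulrNz mulNr.
  exact: generic_shift.
have ly : Lm y = Lm (x - m.+1%:R * tau).
  have -> : x - m.+1%:R * tau = y + (m.+1%:Z)%:~R by rewrite -[_%:~R]/(m.+1%:R) /y; ring.
  by rewrite Lam_int.
have := Rhat_quasiperiod N2 hg q1 p1 gy.
have -> : y + tau + 1 = x - m%:R * (tau + 1) by rewrite /y -natr1; ring.
have au := amx_unit N2 hg.
have aV : (invmx (amx g12))._1 *m (amx g12)._1 = 1%:M by rewrite tensmx_mul (mulVmx au) mulmx1 tensmx11.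
have aV' := mulmx1C aV.
move=> e; have e' := intertwine_inv aV' e (Lam_neq0 N0 q1 gy).
have pE : (\prod_(1 <= k < m.+2) Lm (x - k%:R * tau))^-1 =
    (Lm y)^-1 * (\prod_(1 <= k < m.+1) Lm (x - k%:R * tau))^-1.
  rewrite ly; move: (fun k => Lm (x - k%:R * tau)) => f.
  by rewrite big_nat_recr // invfM mulrC.
rewrite legXSr -mulmxA e' -scalemxAr mulmxA IH -scalemxAl scalerA -mulmxA -legXSr.
by rewrite pE.
Qed.

End Iterate.

Section FN.
Variables (R : realType) (N : nat) (zeta tau : R[i]).
Local Notation Lm := (Lam N zeta).

Let ThE z w : epi (2 * z) = w -> Theta (epi zeta ^+ N.*2) w = Thb N zeta z.
Proof. by move=> <-; rewrite bE. Qed.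

(** The power of q in front is spread over the r factors, each of which then becomes a value of
    [Lam]. *)
Lemma F_N_pos (r : int) (x : R[i]) : 0 < r ->
  F_N N zeta tau r (epi x) = \prod_(0 <= k < `|r|%N) Lm (- x + (- k%:Z)%:~R * tau).
Proof.
move=> r0; rewrite /F_N r0.
have -> : epi (2 * r%:~R * (1 - 1 / N%:R) * zeta) =
   \prod_(0 <= k < `|r|%N) epi (2 * zeta - 2 * zeta / N%:R).
  rewrite prodr_const_nat subn0 -epiMn -[in LHS](gtz0_abs r0); congr epi.
  by rewrite -[_%:~R]/(`|r|%N%:R); ring.
rewrite -big_split; apply: eq_bigr => k _.
have -> : - x + (- k%:Z)%:~R * tau = - x - k%:R * tau by rewrite mulrNz mulNr.
set z := - x - _; rewrite LamE.
have e1 : epi (2 * z) = epi x ^- 2 * epi (2 * tau) ^- k.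
  by rewrite -!epiMn -!epiN -epiD; congr epi; rewrite /z; ring.
have e2 : epi (2 * - z) = epi x ^+ 2 * epi (2 * tau) ^+ k.
  by rewrite -!epiMn -epiD; congr epi; rewrite /z; ring.
have e3 : epi (2 * (zeta + z)) = epi x ^- 2 * epi zeta ^+ 2 * epi (2 * tau) ^- k.
  by rewrite -!epiMn -!epiN -!epiD; congr epi; rewrite /z; ring.
have e4 : epi (2 * (zeta - z)) = epi x ^+ 2 * epi zeta ^+ 2 * epi (2 * tau) ^+ k.
  by rewrite -!epiMn -!epiD; congr epi; rewrite /z; ring.
rewrite (ThE e1) (ThE e2) (ThE e3) (ThE e4); exact: mulrA.
Qed.

Lemma F_N_neg (r : int) (x : R[i]) : ~~ (0 < r) ->
  F_N N zeta tau r (epi x) = \prod_(1 <= k < `|r|%N.+1) (Lm (- x + k%:~R * tau))^-1.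
Proof.
move=> r0; rewrite /F_N (negPf r0).
have -> : epi (- 2 * (`|r|%N)%:R * (1 - 1 / N%:R) * zeta) =
   \prod_(1 <= k < `|r|%N.+1) epi (- (2 * zeta - 2 * zeta / N%:R)).
  by rewrite prodr_const_nat subSS subn0 -epiMn; congr epi; ring.
rewrite -big_split; apply: eq_bigr => k _.
rewrite -[k%:~R]/(k%:R); set z := - x + _; rewrite LamE.
have e1 : epi (2 * z) = epi x ^- 2 * epi (2 * tau) ^+ k.
  by rewrite -!epiMn -!epiN -epiD; congr epi; rewrite /z; ring.
have e2 : epi (2 * - z) = epi x ^+ 2 * epi (2 * tau) ^- k.
  by rewrite -!epiMn -!epiN -epiD; congr epi; rewrite /z; ring.
have e3 : epi (2 * (zeta + z)) = epi x ^- 2 * epi zeta ^+ 2 * epi (2 * tau) ^+ k.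
  by rewrite -!epiMn -!epiN -!epiD; congr epi; rewrite /z; ring.
have e4 : epi (2 * (zeta - z)) = epi x ^+ 2 * epi zeta ^+ 2 * epi (2 * tau) ^- k.
  by rewrite -!epiMn -!epiN -!epiD; congr epi; rewrite /z; ring.
have inv (e a d : R[i]) : (e * a / d)^-1 = e^-1 * (d / a) by rewrite -mulrA invfM invf_div.
by rewrite (ThE e1) (ThE e2) (ThE e3) (ThE e4) epiN inv.
Qed.

End FN.

(** The scalar l1 / (l2 mu) for n = m + 1: the end values f 0 and f (m+1) come from the two RLL
    relations, and they move the product of quasi-period factors from 1, ..., m + 1 to 0, ..., m. *)
Lemma prod_ratio_pos (F : fieldType) (f : nat -> F) m : (forall k, f k != 0) ->
  f 0%N / (f m.+1 * (\prod_(1 <= k < m.+2) f k)^-1) = \prod_(0 <= k < m.+1) f k.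
Proof.
move=> f0; have p0 : \prod_(1 <= k < m.+2) f k != 0.
  by elim/big_ind: _ => [|s t s0 t0|k _]; [exact: oner_neq0|exact: mulf_neq0|exact: f0].
rewrite invfM invrK mulrCA mulrC -big_ltn // big_nat_recr //= mulfK //.
Qed.

Lemma prod_ratio_neg (F : fieldType) (f : nat -> F) m : (forall k, f k != 0) ->
  f 0%N / (f m * \prod_(0 <= k < m) f k) = \prod_(1 <= k < m.+1) (f k)^-1.
Proof.
move=> f0; rewrite [f m * _]mulrC -big_nat_recr //= big_ltn // prodfV invfM mulrA divff //.
by rewrite mul1r.
Qed.

Section SurfaceShift.
Variables (R : realType) (N : nat).
Hypothesis N2 : (2 <= N)%N.
Let N0 : (0 < N)%N := ltnW N2.
Variable g12 : 'M[R[i]]_N.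
Hypothesis hg : is_sqrt_g g12.
Variables (zeta tau : R[i]).
Hypothesis q1 : normc (epi zeta) < 1.
Hypothesis p1 : normc (epi (2 * tau)) < 1.
Variable y : R[i].
Hypothesis gy : generic2 zeta tau y.
Let x : R[i] := y - N%:R * zeta.
Let f (k : int) : R[i] := Lam N zeta (y + k%:~R * tau).

Let f_neq0 k : f k != 0.
Proof.
apply: (Lam_neq0 (tau := tau) N0 q1).
by apply: (generic2_shift (j := 0) (k := k) (m := 0) gy); ring.
Qed.

Let gx : generic2 zeta tau x.
Proof.
apply: (generic2_shift (j := - N%:Z) (k := 0) (m := 0) gy).
by rewrite mulrNz -[N%:~R]/(N%:R) /x; ring.
Qed.

(** x and y differ by the period N zeta of [Lam], and integers are periods as well. *)
Let fx (k m : int) : Lam N zeta (x + k%:~R * tau + m%:~R) = f k.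
Proof.
rewrite Lam_int /f; set z := x + _.
have -> : y + k%:~R * tau = z + N%:R * zeta by rewrite /z /x; ring.
rewrite (Lam_qN (tau := tau) N0 q1) //.
by apply: (generic2_shift (j := 0) (k := k) (m := 0) gx); rewrite /z; ring.
Qed.

Let fxm (n : int) : Lam N zeta (x - n%:~R * (tau + 1)) = f (- n).
Proof. by rewrite -(fx (- n) (- n)) mulrNz; congr Lam; ring. Qed.

(** For n > 0 the argument moves down by n quasi-periods and a^-n is a power of the inverse of a, so
    mu is an inverse product of [Lam] values; for n < 0 it moves up and mu is a product. *)
Lemma Rhat_shift (n : int) : n != 0 -> exists2 mu : R[i], mu != 0 &
  (mxexpz (amx g12) (- n) *t 1%:M) *m Rhat g12 zeta tau (x - n%:~R * (tau + 1)) =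
    mu *: (Rhat g12 zeta tau x *m (mxexpz (amx g12) (- n) *t 1%:M)) /\
  Lam N zeta y / (Lam N zeta (x - n%:~R * (tau + 1)) * mu) = F_N N zeta tau n (epi (- y)).
Proof.
have f0 : Lam N zeta y = f 0 by rewrite /f mul0r addr0.
rewrite fxm f0; case: n => [[//|m]|m] _.
  pose h (k : nat) := f (- k%:Z).
  have h0 k : h k != 0 by exact: f_neq0.
  have pE : \prod_(1 <= k < m.+2) Lam N zeta (x - k%:R * tau) = \prod_(1 <= k < m.+2) h k.
    apply: eq_bigr => k _; rewrite /h -(fx _ 0) mulrNz; congr Lam.
    by rewrite -[k%:~R]/(k%:R); ring.
  exists (\prod_(1 <= k < m.+2) h k)^-1; last split.
  - apply: invr_neq0.
    by elim/big_ind: _ => [|s t s0 t0|k _]; [exact: oner_neq0|exact: mulf_neq0|exact: h0].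
  - by rewrite -pE; exact: (Rhat_amxVX N2 hg q1 p1 m.+1 gx).
  - have FE := @F_N_pos R N zeta tau m.+1 (- y) isT.
    rewrite FE opprK; exact: (prod_ratio_pos m h0).
pose h (k : nat) := f k%:Z.
have h0 k : h k != 0 by exact: f_neq0.
have pE : \prod_(0 <= k < m.+1) Lam N zeta (x + k%:R * tau) = \prod_(0 <= k < m.+1) h k.
  by apply: eq_bigr => k _; rewrite /h -(fx _ 0) addr0.
exists (\prod_(0 <= k < m.+1) h k); last split.
- by elim/big_ind: _ => [|s t s0 t0|k _]; [exact: oner_neq0|exact: mulf_neq0|exact: h0].
- have -> : x - (Negz m)%:~R * (tau + 1) = x + m.+1%:R * (tau + 1).
    by rewrite NegzE mulrNz mulNr opprK.
  by rewrite -pE; exact: (Rhat_amxX N2 hg q1 p1 m.+1 gx).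
- have FE := @F_N_neg R N zeta tau (Negz m) (- y) isT.
  rewrite FE opprK; exact: (prod_ratio_neg m.+1 h0).
Qed.

End SurfaceShift.

Theorem theorem3 (R : realType) (N : nat) (hN : (2 <= N)%N)
    (zeta tau c : R[i]) (hpar : admissible zeta tau c)
    (g12 : 'M[R[i]]_N) (hg12 : is_sqrt_g g12)
    (n : int) (hn : n <> 0) (hsurf : on_surface N zeta tau c n)
    (A : algType R[i]) (L : R[i] -> 'M[A]_N)
    (hL : Aqp_sl g12 zeta tau c L)
    (Lminv : R[i] -> 'M[A]_N)
    (hLminv : forall u : R[i], is_mxinv (Lminus g12 tau L u) (Lminv u))
    (u v : R[i]) (huv : generic_ratio zeta tau c (v - u)) (i j : 'I_N) :
  tgen g12 zeta c n L Lminv u * L v i j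
  = F_N N zeta tau n (epi (v - u)) *: (L v i j * tgen g12 zeta c n L Lminv u).
Proof.
have N0 := ltnW hN; set ts := taustar zeta tau c.
have q1 := admissible_q1 hpar; have p1 := admissible_p1 hpar.
have ps1 := admissible_ps1 hpar; have oz := admissible_off hpar.
have ozs := admissible_off_star hpar; rewrite -/ts in ps1 ozs.
set y := u - v.
have gy : generic3 zeta tau c y.
  have -> : y = - (v - u) by rewrite opprB.
  by apply/generic3N/generic_ratioP.
have gyc : generic3 zeta tau c (y + c * zeta).
  by apply: (generic3_shift (j := 0) (k := 0) (l := 1) (m := 0) gy); ring.
have gyt : generic3 zeta tau c (y + tau + 1).
  by apply: (generic3_shift (j := 0) (k := 1) (l := 0) (m := 1) gy); ring.
have gx : generic3 zeta tau c (y - N%:R * zeta).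
  apply: (generic3_shift (j := - N%:Z) (k := 0) (l := 0) (m := 0) gy).
  by rewrite mulrNz -[N%:~R]/(N%:R); ring.
have rll t : generic3 zeta tau c (t - v) ->
    scal_mx A (Rhat g12 zeta tau (t - v)) *m (L t *t 1%:M) *m (1%:M *t L v) =
    (1%:M *t L v) *m (L t *t 1%:M) *m scal_mx A (Rhat g12 zeta ts (t - v)).
  by case: hL => h _ /generic_ratioP; exact: h.
have rll1 := rll (u + c * zeta); have rll2 := rll (u + tau + 1).
(* L^+ (q^{c/2} z) is L (q^c z), and L^- (z) involves L (-p^{1/2} z); these are their ratios to
   w. *)
have yE1 : u + c * zeta - v = y + c * zeta by rewrite /y; ring.
have yE2 : u + tau + 1 - v = y + tau + 1 by rewrite /y; ring.
rewrite yE1 in rll1; rewrite yE2 in rll2.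
have y0 : y - N%:R * zeta + N%:R * zeta = y by rewrite subrK.
have qp2 := Rhat_quasiperiod hN hg12 q1 ps1 (generic3_2star gyc).
(* The coincidence that lets R^* be eliminated: the starred quasi-period from y + c zeta reaches the
   same point as the unstarred one from y. *)
have ytsE : y + c * zeta + ts + 1 = y + tau + 1 by rewrite /ts /taustar; ring.
rewrite ytsE in qp2.
have au := amx_unit hN hg12.
have cr := fun j j' k l =>
  Rhat_crossing hN hg12 q1 p1 oz j j' k l (generic3_2 gx).
rewrite /= y0 in cr.
have [mu mu0 []] := Rhat_shift hN hg12 q1 p1 (generic3_2 gy) (introN eqP hn).
(* The only use of the surface equation. *)
have -> : y - N%:R * zeta - n%:~R * (tau + 1) = y + c * zeta by rewrite hsurf; ring.
have -> : - y = v - u by rewrite /y opprB.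
move=> qpb <-.
have l0 t : generic3 zeta tau c t -> Lam N zeta t != 0.
  by move=> /generic3_2; exact: Lam_neq0.
have [MK KM] := hLminv u.
have := exchange_trace au (l0 _ gy) (l0 _ gyc) mu0 (Rhat_mulVl hN hg12 q1 p1 oz (generic3_2 gy))
  (Rhat_mulV hN hg12 q1 ps1 ozs (generic3_2star gyc))
  (Rhat_quasiperiod hN hg12 q1 p1 (generic3_2 gy)) qp2 qpb cr MK KM (rll1 gyc) (rll2 gyt) i j.
rewrite /tgen /Lplus.
by have -> : u + c / 2 * zeta + c / 2 * zeta = u + c * zeta by field.
Qed.
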